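(* For $\alpha\in(0,1]$ let $h(\alpha)$ denote the Kolmogorov--Sinai entropy of the map $T_\alpha$ with respect to its unique absolutely continuous invariant probability measure $\mu_\alpha$. Then the function $\alpha\mapsto h(\alpha)$ is continuous on $(0,1]$, and $$\lim_{\alpha\to 0^+}h(\alpha)=0.$$
   Context: For $\alpha\in[0,1]$ let $I_\alpha=[\alpha-1,\alpha]$ and let $T_\alpha:I_\alpha\to I_\alpha$ be defined by $$T_\alpha(x)=\left|\frac1x\right|-\left[\left|\frac1x\right|+1-\alpha\right]\quad (x\neq 0),$$ where $[\cdot]$ denotes the integer part (floor); the value at $x=0$ is irrelevant (e.g. $T_\alpha(0)=0$). It is known that for every $\alpha\in(0,1]$ the map $T_\alpha$ admits a unique invariant probability measure $\mu_\alpha$ which is absolutely continuous with respect to Lebesgue measure, $d\mu_\alpha=\rho_\alpha(x)\,dx$. The entropy is given by Rohlin's formula $h(\alpha)=\int_{\alpha-1}^{\alpha}\log|T_\alpha'(x)|\,d\mu_\alpha(x)=-2\int_{\alpha-1}^{\alpha}\log|x|\,\rho_\alpha(x)\,dx$. *)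

(* Defs.v *)
From HB Require Import structures.
From mathcomp Require Export all_boot all_order all_algebra.
From mathcomp Require Export all_classical all_reals all_analysis.

Set Implicit Arguments.
Unset Strict Implicit.
Unset Printing Implicit Defensive.

Import Order.TTheory GRing.Theory Num.Theory.
Import numFieldNormedType.Exports.

Local Open Scope classical_set_scope.
Local Open Scope ring_scope.

Section KolmogorovSinaiEntropy.
Context d (X : measurableType d) (R : realType).
Implicit Types (P : probability X R) (T : X -> X).

(* Atoms are allowed to be empty. *)
Definition is_partition (I : finType) (A : I -> set X) : Prop :=
  [/\ forall i, measurable (A i), trivIset setT A & \bigcup_i A i = setT].

(* [ln] is total, so a null atom contributes 0, as in 0 log 0 = 0. *)
Definition partition_entropy P (I : finType) (A : I -> set X) : R :=
  \sum_(i : I) - (fine (P (A i)) * ln (fine (P (A i)))).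

(* The join A \/ T^-1 A \/ ... \/ T^-(n-1) A; the atom of index w is the set
   of points whose itinerary of length n is w. *)
Definition iterated_join T (I : finType) (A : I -> set X) (n : nat)
    (w : {ffun 'I_n -> I}) : set X :=
  [set x | forall j : 'I_n, A (w j) (iter j T x)].

(* The limit exists by subadditivity when P is T-invariant. *)
Definition entropy_of_partition P T (I : finType) (A : I -> set X) : R :=
  limn (fun n => partition_entropy P (@iterated_join T I A n) / n%:R).

Definition ks_entropy P T : \bar R :=
  ereal_sup [set h : \bar R | exists (k : nat) (A : 'I_k -> set X),
    is_partition A /\ h = (entropy_of_partition P T A)%:E].

End KolmogorovSinaiEntropy.

Section AlphaContinuedFractions.
Context {R : realType}.

(* The defining formula, read on the whole line; it sends every point into
   [alpha - 1, alpha], and 0 to 0 when 0 < alpha <= 1 since [0^-1 = 0]. *)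
Definition Talpha (alpha : R) (x : measurableTypeR R) : measurableTypeR R :=
  `|x^-1| - (Num.floor (`|x^-1| + 1 - alpha))%:~R.

(* Measures on I_alpha = [alpha - 1, alpha] are represented by the measures on
   the line that are carried by this interval. *)
Definition is_acip (alpha : R) (mu : probability (measurableTypeR R) R) : Prop :=
  [/\ mu [set` `[alpha - 1, alpha]] = 1%E,
      forall A : set (measurableTypeR R), measurable A -> mu (Talpha alpha @^-1` A) = mu A
    & mu `<< @lebesgue_measure R].

Definition is_unique_acip (alpha : R)
    (mu : probability (measurableTypeR R) R) : Prop :=
  is_acip alpha mu /\
  forall nu : probability (measurableTypeR R) R, is_acip alpha nu ->
    forall A : set (measurableTypeR R), measurable A -> nu A = mu A.

End AlphaContinuedFractions.

(* Main.v *)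
Require Import Defs.
From mathcomp Require Import all_boot all_order all_algebra.
From mathcomp Require Import all_classical all_reals all_analysis.
From HB Require Import structures.
From mathcomp Require Import measurable_realfun ring lra zify.
Import Order.TTheory GRing.Theory Num.Theory.
Import numFieldNormedType.Exports.
Local Open Scope classical_set_scope.
Local Open Scope ring_scope.
Set Implicit Arguments.
Unset Strict Implicit.
Unset Printing Implicit Defensive.

(* Rokhlin's formula [h = -2 int ln |x| dmu] holds for every absolutely
   continuous invariant probability measure (acip) of bounded density: the upper
   bound for the entropy of a finite partition comes from Gibbs' inequality
   against an explicit coding law, the lower bound from partitions recording the
   branch and the approximate size of each iterate.

   Everything else rests on a density bound uniform in [alpha]: on
   [{x | dl <= 1 + x}] the acip is at most [C / dl] times Lebesgue measure, [C]
   being universal. Count the pairs [(y, k)] such that the [k]-th denominator of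
   [y] is at most [N] and the [k]-th iterate lies in [E]. Since iterates are
   Moebius functions of [y] with integer coefficients, this occupation measure is
   [O (ln N / dl) |E|], while its total mass is at least [c ln N]; it is almost
   invariant, so its normalized ultralimit is an acip, hence the acip by
   uniqueness.

   With the densities locally uniformly bounded, any ultralimit of the acips as
   [beta -> alpha] is an acip for [alpha], whence setwise convergence and the
   continuity of the entropy. As [alpha -> 0+] an ultralimit is an invariant
   finitely additive probability for the backward continued fraction map
   [Talpha 0], which has full branches and only infinite absolutely continuous
   invariant measures; so all its mass sits next to [-1], where [ln |x|]
   vanishes. *)

(** * Entropy of finite partitions *)

(** For general [alpha] the branches of [Talpha alpha] are not all onto, so distortion estimates for
    full branches do not apply. Arithmetic replaces them: a pair [(q', q)] of successive
    denominators leaves boundedly many inverse Moebius maps, whatever the time at which the pair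
    occurs, and each contracts by [(q + q' x)^-2]. On [1 + x >= dl] these factors, summed over
    [q' <= q <= N], are of order [ln N / dl]. The mass yields the same [ln N], since [q + q' x] is
    the reciprocal of the product of the absolute values of the previous iterates. The two
    logarithms cancel, which makes [C] universal. The loss [1 / dl] is tied to -1, the neutral fixed
    point of [Talpha 0]. Near 0, where [ln |x|] is large, [dl = 1/2] is available for every [alpha],
    so the integrals of [ln |x|] have uniform tails. Ultralimits are a priori only finitely
    additive. For [alpha > 0] every point of [I_alpha] satisfies [1 + x >= alpha], and domination
    restores a measure; as [alpha -> 0+] mass can concentrate at -1, and the limit has to be treated
    as a content. *)

Lemma fekete (R : realType) (u : nat -> R) :
  (forall n, 0 <= u n) -> (forall n m, u (n + m)%N <= u n + u m) ->
  cvgn (fun n => u n / n%:R).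
Proof.
move=> u0 usub.
pose E : set R := [set u n.+1 / n.+1%:R | n in setT].
have E0 : E !=set0 by exists (u 1%N / 1%:R); exists 0%N.
have lE : lbound E 0 by move=> _ [n _ <-]; rewrite divr_ge0.
have hE : has_inf E by split => //; exists 0.
have mulu m q : u (q * m)%N <= u 0%N + q%:R * u m.
  elim: q => [|q IH]; first by rewrite mul0n mul0r addr0.
  rewrite mulSn (le_trans (usub _ _))// -natr1 mulrDl mul1r; lra.
apply/cvg_ex; exists (inf E); apply/cvgrPdist_le => e e0.
have [_ [m _ <-] hm] := @inf_adherent _ E (e / 2) ltac:(lra) hE.
set M := m.+1 in hm *.
(* [B] absorbs the remainder modulo [M] together with [u 0], which subadditivity does not force to
   vanish. *)
pose B := u 0%N + \sum_(r < M) u r.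
have uB r : (r < M)%N -> u 0%N + u r <= B.
  by move=> rM; rewrite /B lerD2l (bigD1 (Ordinal rM))//= lerDl sumr_ge0.
have B0 : 0 <= B by rewrite addr_ge0// sumr_ge0.
near=> n.
have n0 : (0 < n)%N by near: n; exact: nbhs_infty_gt.
have nB : 2 * B / e <= n%:R by near: n; exact: nbhs_infty_ger.
have n0' : 0 < n%:R :> R by rewrite ltr0n.
have infle : inf E <= u n / n%:R.
  by apply: ge_inf; [exists 0 | exists n.-1 => //; rewrite prednK].
rewrite distrC ger0_norm ?subr_ge0// lerBlDr.
have un : u n <= B + (n %/ M)%:R * u M.
  rewrite {1}(divn_eq n M) (le_trans (usub _ _))//.
  have := mulu M (n %/ M)%N; have := uB (n %% M)%N (ltn_pmod _ (ltn0Sn _)).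
  by move=> *; lra.
rewrite ler_pdivrMr//.
have M0 : 0 < M%:R :> R by rewrite ltr0n.
have uM : u M < (inf E + e / 2) * M%:R by rewrite -ltr_pdivrMr.
have qM : (n %/ M)%:R * M%:R <= n%:R :> R by rewrite -natrM ler_nat leq_divM.
have infE0 : 0 <= inf E by apply: lb_le_inf.
have Bn : B <= e / 2 * n%:R.
  by move: nB; rewrite ler_pdivrMr//; lra.
apply: (le_trans un).
have : (n %/ M)%:R * u M <= (inf E + e / 2) * n%:R.
  apply: (@le_trans _ _ ((n %/ M)%:R * ((inf E + e / 2) * M%:R))).
    by rewrite ler_wpM2l// ltW.
  by rewrite mulrCA ler_wpM2l//; lra.
by move=> H; rewrite !mulrDl in H *; lra.
Unshelve. all: by end_near. Qed.

(** Termwise, [ln t <= t - 1] at [t = q j / p j] gives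
    [p j * (ln (q j) - ln (p j)) <= q j - p j]. *)
Lemma gibbs (R : realType) (J : finType) (p q : J -> R) :
  (forall j, 0 <= p j) -> (forall j, 0 <= q j) ->
  (forall j, 0 < p j -> 0 < q j) -> \sum_j q j <= \sum_j p j ->
  \sum_j - (p j * ln (p j)) <= \sum_j - (p j * ln (q j)).
Proof.
move=> p0 q0 pq s; rewrite -subr_ge0 -sumrB.
apply: (@le_trans _ _ (\sum_j (p j - q j))); first by rewrite sumrB subr_ge0.
apply: ler_sum => j _.
have [pj0|] := ltP 0 (p j); last first.
  move=> pj; have -> : p j = 0 by apply/eqP; rewrite eq_le pj p0.
  by rewrite !mul0r subrr sub0r oppr_le0.
have qj := pq _ pj0.
have H : ln (q j / p j) <= q j / p j - 1.
  have := @le_ln1Dx R (q j / p j - 1); rewrite (_ : 1 + _ = q j / p j); last by ring.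
  apply.
  by rewrite ltrBrDr addrC subrr divr_gt0.
rewrite ln_div ?posrE// in H.
have : p j * (ln (q j) - ln (p j)) <= q j - p j.
  apply: (le_trans (ler_wpM2l (p0 j) H)).
  by rewrite mulrBr mulrCA divff ?gt_eqF// !mulr1.
by rewrite mulrBr; lra.
Qed.

Lemma trivIset_disj (U : Type) (I : eqType) (F : I -> set U) (i j : I) :
  trivIset setT F -> i != j -> F i `&` F j = set0.
Proof. by move=> /trivIsetP tF; apply: tF. Qed.

Section Joins.
Context d (X : measurableType d) (R : realType) (P : probability X R) (T : X -> X).
Hypothesis mT : measurable_fun setT T.
Hypothesis inv : forall A, measurable A -> P (T @^-1` A) = P A.

Lemma measurable_iter n : measurable_fun setT (iter n T).
Proof.
by elim: n => [|n IH]; [exact: measurable_id | exact: measurableT_comp].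
Qed.

Lemma measurable_preimT (Y : measurableType d) (f : X -> Y) (A : set Y) :
  measurable_fun setT f -> measurable A -> measurable (f @^-1` A).
Proof. by move=> mf mA; rewrite -[_ @^-1` _]setTI; exact: mf. Qed.

Lemma preim_iterS n A : iter n.+1 T @^-1` A = T @^-1` (iter n T @^-1` A).
Proof. by apply/seteqP; split=> x; rewrite /preimage/= -iterSr. Qed.

Lemma inv_iter n A : measurable A -> P (iter n T @^-1` A) = P A.
Proof.
move=> mA; elim: n => [//|n IH].
by rewrite preim_iterS inv//; apply: measurable_preimT => //; exact: measurable_iter.
Qed.

Let Pr (A : set X) : R := fine (P A).

Lemma prE A : measurable A -> P A = (Pr A)%:E.
Proof. by move=> mA; rewrite fineK// fin_num_measure. Qed.

Lemma pr_ge0 A : 0 <= Pr A. Proof. by rewrite fine_ge0. Qed.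

Lemma le_pr A B : measurable A -> measurable B -> A `<=` B -> Pr A <= Pr B.
Proof.
by move=> mA mB AB; rewrite fine_le ?fin_num_measure// le_measure ?inE.
Qed.

Lemma pr_le1 A : measurable A -> Pr A <= 1.
Proof. by move=> mA; rewrite -lee_fin -prE// probability_le1. Qed.

Lemma pr_iter n A : measurable A -> Pr (iter n T @^-1` A) = Pr A.
Proof. by move=> mA; rewrite /Pr inv_iter. Qed.

Lemma pr_cover (I : finType) (F : I -> set X) B :
  (forall i, measurable (F i)) -> trivIset setT F -> \bigcup_i F i = setT ->
  measurable B -> \sum_i Pr (F i `&` B) = Pr B.
Proof.
move=> mF tF cF mB.
have : P (\bigcup_(i in [set: I]) (F i `&` B)) = \sum_(i \in [set: I]) P (F i `&` B).
  apply: measure_fin_bigcup; [exact: finite_finset| |by move=> i _; exact: measurableI].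
  apply/trivIsetP => i j _ _ ij.
  by rewrite setIACA (trivIset_disj tF)// set0I.
rewrite -setI_bigcupl cF setTI fsbig_finite/=; last exact: finite_finset.
move=> H.
rewrite (perm_big (index_enum I)) /= in H; last first.
  apply: uniq_perm; rewrite ?finmap.fset_uniq ?index_enum_uniq// => i.
  by rewrite mem_index_enum in_fset_set//= in_setT.
rewrite {2}/Pr H (eq_bigr (fun i => (Pr (F i `&` B))%:E)); last first.
  by move=> i _; rewrite prE//; exact: measurableI.
by rewrite sumEFin.
Qed.

Lemma le_sum_integral (I : finType) (F : I -> set X) (g : I -> R) (h : X -> \bar R) :
  (forall i, measurable (F i)) -> trivIset setT F -> \bigcup_i F i = setT ->
  (forall i, 0 <= g i) -> (forall x, 0 <= h x)%E -> measurable_fun setT h ->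
  (forall i x, F i x -> ((g i)%:E <= h x)%E) ->
  ((\sum_i Pr (F i) * g i)%:E <= \int[P]_x h x)%E.
Proof.
move=> mF tF cF g0 h0 mh gh.
have -> : ((\sum_i Pr (F i) * g i)%:E
    = \int[P]_x (\sum_i (g i * \1_(F i) x)%:E)%E)%E.
  rewrite ge0_integral_sum//; last 2 first.
  - move=> i; apply/measurable_EFinP; apply: measurable_funM => //.
  - by move=> i x _; rewrite lee_fin mulr_ge0.
  rewrite -sumEFin; apply: eq_bigr => i _.
  under eq_integral do rewrite EFinM.
  rewrite ge0_integralZl//; last 2 first.
  - by apply/measurable_EFinP.
  - by rewrite lee_fin.
  by rewrite integral_indic// setIT EFinM muleC; congr (_ * _)%E; exact/esym/prE.
apply: ge0_le_integral => //.
- by move=> x _; apply: sume_ge0 => i _; rewrite lee_fin mulr_ge0.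
- apply: emeasurable_sum => i; apply/measurable_EFinP.
  by apply: measurable_funM.
move=> x _.
have [i _ Fix] : (\bigcup_i F i) x by rewrite cF.
rewrite (bigD1 i)//= big1 ?adde0.
  by rewrite indicE mem_set// mulr1; exact: gh.
move=> j ji; rewrite indicE memNset ?mulr0// => Fjx.
have /seteqP[sub _] := trivIset_disj tF ji; exact: (sub x (conj Fjx Fix)).
Qed.

Context (I : finType) (A : I -> set X).
Hypothesis pA : is_partition A.

Let mA : forall i, measurable (A i). Proof. by case: pA. Qed.
Let tA : trivIset setT A. Proof. by case: pA. Qed.
Let cA : \bigcup_i A i = setT. Proof. by case: pA. Qed.

Lemma measurable_join n w : measurable (@iterated_join _ X T I A n w).
Proof.
rewrite (_ : iterated_join _ _ _ = \bigcap_(j in [set: 'I_n]) (iter j T @^-1` A (w j))).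
  apply: fin_bigcap_measurable => // j _.
  by apply: measurable_preimT => //; exact: measurable_iter.
by apply/seteqP; split => [x H j _|x H j]; [exact: H | exact: (H j Logic.I)].
Qed.

Lemma trivIset_join n : trivIset setT (@iterated_join _ X T I A n).
Proof.
apply/trivIsetP => w v _ _ /eqP wv; apply/seteqP; split => // x [xw xv].
apply: wv; apply/ffunP => j; apply/eqP/negPn/negP => ne.
have : (A (w j) `&` A (v j)) (iter j T x) by split; [exact: xw | exact: xv].
by rewrite (trivIset_disj tA ne).
Qed.

Lemma cover_join n : \bigcup_w (@iterated_join _ X T I A n w) = setT.
Proof.
apply/seteqP; split => // x _.
have /choice [q Hq] y : exists i, A i y.
  by have : setT y by []; rewrite -cA => -[i _ Ai]; exists i.
by exists [ffun j : 'I_n => q (iter j T x)] => // j; rewrite ffunE.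
Qed.

(** By invariance every letter of an itinerary has the law of the first one, so the mean of a sum
    over the [n] letters is [n] times a mean over [A]. *)
Lemma sum_join_marginal n (phi : I -> R) (j : 'I_n) :
  \sum_(w : {ffun 'I_n -> I}) Pr (iterated_join T A w) * phi (w j) =
  \sum_i Pr (A i) * phi i.
Proof.
rewrite (partition_big (fun w : {ffun 'I_n -> I} => w j) xpredT)//=.
apply: eq_bigr => i _.
under eq_bigr => w /eqP -> do [].
rewrite -mulr_suml; congr (_ * _).
rewrite -(pr_iter j (mA i)) -(pr_cover (@measurable_join n) (@trivIset_join n) (cover_join n)); last first.
  by apply: measurable_preimT => //; exact: measurable_iter.
rewrite [RHS](bigID (fun w : {ffun 'I_n -> I} => w j == i))/= [X in _ + X]big1 ?addr0.
  apply: eq_bigr => w /eqP wj; congr Pr; apply/seteqP; split => [x H|x []//].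
  by split => //; rewrite /preimage/= -wj; exact: H.
move=> w wj; rewrite (_ : _ `&` _ = set0) ?/Pr ?measure0//.
apply/seteqP; split => // x [xw xi].
have : (A (w j) `&` A i) (iter j T x) by split => //; exact: xw.
by rewrite (trivIset_disj tA wj).
Qed.

Lemma partition_entropy_ge0 n : 0 <= partition_entropy P (@iterated_join _ X T I A n).
Proof.
apply: sumr_ge0 => w _; rewrite -mulrN mulr_ge0 ?pr_ge0// oppr_ge0.
by apply: ln_le0; exact: pr_le1 (measurable_join w).
Qed.

(** A subprobability [q] on words acts as a code whose mean length dominates the entropy; the upper
    bound in Rokhlin's formula is one good choice of [q]. *)
Lemma gibbs_join n (q : {ffun 'I_n -> I} -> R) :
  (forall w, 0 <= q w) -> (forall w, 0 < Pr (iterated_join T A w) -> 0 < q w) ->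
  \sum_w q w <= 1 ->
  partition_entropy P (@iterated_join _ X T I A n) <=
  \sum_w Pr (iterated_join T A w) * - ln (q w).
Proof.
move=> q0 pq sq; under [leRHS]eq_bigr do rewrite mulrN.
apply: gibbs => //; first by move=> ?; exact: pr_ge0.
rewrite (le_trans sq)//.
have := pr_cover (@measurable_join n) (@trivIset_join n) (cover_join n) measurableT.
under eq_bigr do rewrite setIT.
by move=> ->; rewrite /Pr probability_setT.
Qed.

(** Gibbs' inequality for the joint law of a prefix [u] and a suffix [v] against the product of
    their laws; by invariance the suffix has the law of a word of length [m]. *)
Lemma partition_entropy_subadd n m :
  partition_entropy P (@iterated_join _ X T I A (n + m)) <=
  partition_entropy P (@iterated_join _ X T I A n) +
  partition_entropy P (@iterated_join _ X T I A m).
Proof.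
pose l (w : {ffun 'I_(n + m) -> I}) : {ffun 'I_n -> I} := [ffun j => w (lshift m j)].
pose r (w : {ffun 'I_(n + m) -> I}) : {ffun 'I_m -> I} := [ffun j => w (rshift n j)].
pose lr w := (l w, r w).
pose gl (p : {ffun 'I_n -> I} * {ffun 'I_m -> I}) : {ffun 'I_(n + m) -> I} :=
  [ffun j => match fintype.split j with inl a => p.1 a | inr b => p.2 b end].
have lrK : cancel lr gl.
  move=> w; apply/ffunP => j; rewrite ffunE.
  by case: splitP => k jk; rewrite /= ffunE; congr (w _); apply: val_inj.
have glK : cancel gl lr.
  move=> [u v]; congr pair; apply/ffunP => j; rewrite !ffunE.
    by rewrite (unsplitK (inl j)).
  by rewrite (unsplitK (inr j)).
pose J k w := @iterated_join _ X T I A k w.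
have Jgl u v : J _ (gl (u, v)) = J n u `&` (iter n T @^-1` J m v).
  apply/seteqP; split => x.
    move=> H; split=> j.
      have := H (lshift m j); rewrite ffunE.
      by rewrite (unsplitK (inl j)).
    have := H (rshift n j); rewrite ffunE (unsplitK (inr j))/=.
    by rewrite addnC iterD.
  move=> [Hu Hv] j; rewrite ffunE; case: splitP => k jk; rewrite jk.
    exact: Hu.
  by rewrite addnC iterD; exact: Hv.
have JP k v : Pr (iter k T @^-1` J m v) = Pr (J m v).
  by apply: pr_iter; exact: measurable_join.
have mJ k w : measurable (J k w) by exact: measurable_join.
have mJ' k v : measurable (iter n T @^-1` J k v).
  by apply: measurable_preimT => //; exact: measurable_iter.
pose p (uv : {ffun 'I_n -> I} * {ffun 'I_m -> I}) := Pr (J n uv.1 `&` (iter n T @^-1` J m uv.2)).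
pose q (uv : {ffun 'I_n -> I} * {ffun 'I_m -> I}) := Pr (J n uv.1) * Pr (J m uv.2).
have sum1 k : \sum_w Pr (J k w) = 1.
  have := pr_cover (@measurable_join k) (@trivIset_join k) (cover_join k) measurableT.
  under eq_bigr do rewrite setIT.
  by move=> ->; rewrite /Pr probability_setT.
have sumu v : \sum_u p (u, v) = Pr (J m v).
  by rewrite -(JP n) -(pr_cover (@measurable_join n) (@trivIset_join n) (cover_join n) (mJ' _ v)).
have sumv u : \sum_v p (u, v) = Pr (J n u).
  rewrite -[RHS](@pr_cover _ (fun v => iter n T @^-1` J m v))//; last 2 first.
  - apply/trivIsetP => v v' _ _ vv'; rewrite -preimage_setI.
    by rewrite (trivIset_disj (@trivIset_join m) vv')// preimage_set0.
  - by rewrite -preimage_bigcup cover_join preimage_setT.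
  by apply: eq_bigr => v _; rewrite setIC.
have -> : partition_entropy P (J (n + m)%N) = \sum_uv - (p uv * ln (p uv)).
  rewrite /partition_entropy (reindex gl) /=; last first.
    by exists lr => ? _; [exact: glK | exact: lrK].
  by apply: eq_bigr => -[u v] _; rewrite Jgl.
apply: (@le_trans _ _ (\sum_uv - (p uv * ln (q uv)))).
  apply: gibbs => [j|[u v]|[u v]/= p0|].
  - exact: pr_ge0.
  - by rewrite mulr_ge0// pr_ge0.
  - rewrite mulr_gt0// (lt_le_trans p0)//.
      by apply: le_pr => //; exact: measurableI.
    rewrite -(JP n); apply: le_pr => //; exact: measurableI.
  - rewrite -(pair_bigA _ (fun u v => q (u, v)))/= -(pair_bigA _ (fun u v => p (u, v)))/=.
    under [leRHS]eq_bigr do rewrite sumv.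
    under eq_bigr do rewrite /q/= -mulr_sumr sum1 mulr1.
    by [].
have -> : \sum_uv - (p uv * ln (q uv)) = \sum_uv - (p uv * (ln (Pr (J n uv.1)) + ln (Pr (J m uv.2)))).
  apply: eq_bigr => -[u v] _; congr (- _).
  have [p0|] := ltP 0 (p (u, v)).
    have u0 : 0 < Pr (J n u) by apply: (lt_le_trans p0); apply: le_pr => //; exact: measurableI.
    have v0 : 0 < Pr (J m v).
      by apply: (lt_le_trans p0); rewrite -(JP n); apply: le_pr => //; exact: measurableI.
    by rewrite /q lnM ?posrE.
  move=> pj; have -> : p (u, v) = 0 by apply/eqP; rewrite eq_le pj pr_ge0.
  by rewrite !mul0r.
under eq_bigr do rewrite mulrDr opprD.
rewrite big_split/= lerD//.
  rewrite -(pair_bigA _ (fun u v => - (p (u, v) * ln (Pr (J n u)))))/=.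
  by apply: ler_sum => u _; rewrite sumrN -mulr_suml sumv.
rewrite -(pair_bigA _ (fun u v => - (p (u, v) * ln (Pr (J m v)))))/= exchange_big/=.
by apply: ler_sum => v _; rewrite sumrN -mulr_suml sumu.
Qed.

Lemma is_cvg_entropy :
  cvgn (fun n => partition_entropy P (@iterated_join _ X T I A n) / n%:R).
Proof.
by apply: fekete; [exact: partition_entropy_ge0 | exact: partition_entropy_subadd].
Qed.

End Joins.

(** * Lebesgue measure and the maps [Talpha] *)

Section MeasureOf.
Context d (X : measurableType d) (R : realType) (m : set X -> \bar R).
Hypotheses (m0 : m set0 = 0%E) (m_ge0 : forall A, (0 <= m A)%E)
  (m_add : semi_sigma_additive m).

(** The properties of [m] are arguments of the constant so that the canonical measure structure can
    read them off the term. *)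
Definition measure_of_fun (_ : m set0 = 0%E) (_ : forall A, (0 <= m A)%E)
  (_ : semi_sigma_additive m) : set X -> \bar R := m.

Local Notation mm := (measure_of_fun m0 m_ge0 m_add).

HB.instance Definition _ := isMeasure.Build _ _ _ mm m0 m_ge0 m_add.

Lemma measure_of_funP : exists m' : {measure set X -> \bar R}, forall A, m' A = m A.
Proof. by exists mm. Qed.

Section Probability.
Hypothesis m1 : m setT = 1%E.

Definition probability_of_fun (_ : m setT = 1%E) : set X -> \bar R := mm.

Local Notation pp := (probability_of_fun m1).

HB.instance Definition _ := Measure.on pp.

HB.instance Definition _ := Measure_isProbability.Build _ _ _ pp m1.

Lemma probability_of_funP : exists m' : probability X R, forall A, m' A = m A.
Proof. by exists pp. Qed.

End Probability.
End MeasureOf.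

(** The image under [T] of the restriction of [m] to [Q]. With [T] the identity it is a plain
    restriction; summed over times it gives occupation measures. *)
Lemma pushforward_restrP d (X : measurableType d) (R : realType)
    (m : {measure set X -> \bar R}) (Q : set X) (T : X -> X) :
  measurable Q -> measurable_fun setT T ->
  exists m' : {measure set X -> \bar R}, forall A, m' A = m (Q `&` T @^-1` A).
Proof.
move=> mQ mT; apply: measure_of_funP.
- by rewrite preimage_set0 setI0 measure0.
- by move=> A; exact: measure_ge0.
move=> F mF tF mUF; rewrite preimage_bigcup setI_bigcupr.
have mTF i : measurable (Q `&` T @^-1` F i).
  by apply: measurableI => //; exact: measurable_preimT.
apply: measure_semi_sigma_additive => //.
- apply/trivIsetP => i j _ _ ij /=.
  by rewrite setIACA -preimage_setI (trivIset_disj tF)// preimage_set0 setI0.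
- exact: bigcup_measurable.
Qed.

Section LebesgueTools.
Context {R : realType}.
Let X := measurableTypeR R.
Local Notation leb := (@lebesgue_measure R).

(** Lebesgue measure is the infimum of total lengths of countable covers by half-open intervals, so
    domination only has to be tested on those. *)
Lemma le_lebesgue_of_intervals (m : {measure set X -> \bar R}) (L : R) :
  0 < L ->
  (forall a b : R, a < b -> (m `]a, b]%classic <= (L * (b - a))%:E)%E) ->
  forall A : set X, measurable A -> (m A <= L%:E * leb A)%E.
Proof.
move=> L0 mL A mA.
have [lA|] := ltP (leb A) +oo%E; last first.
  by rewrite leye_eq => /eqP ->; rewrite gt0_muley ?lte_fin// leey.
apply/lee_addgt0Pr => e e0.
have /ereal_inf_lt[z [/= M covDM sMz zDe]] : (leb A < leb A + (e / L)%:E)%E.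
  by rewrite lte_spaddre ?lte_fin ?divr_gt0// ge0_fin_numE.
have [Mm AM] := covDM.
apply: (@le_trans _ _ (\sum_(0 <= k <oo) m (M k))%E).
  apply: measure_sigma_subadditive => // k.
  have /ocitvP[->//|[[a b] _ ->]] := Mm k; exact: measurable_itv.
apply: (@le_trans _ _ (\sum_(0 <= k <oo) (L%:E * wlength idfun (M k))))%E.
  apply: lee_nneseries => k _ //.
  have /ocitvP[->//|[[a b] /= ab ->]] := Mm k.
    by rewrite measure0 wlength0 mule0.
  by rewrite wlength_itv_bnd; [rewrite -EFinM; exact: mL | exact: ltW].
rewrite nneseriesZl// sMz.
apply: (le_trans (lee_wpmul2l _ (ltW zDe))); first by rewrite lee_fin ltW.
have eL : (0 <= (e / L)%:E)%E by rewrite lee_fin; apply: divr_ge0; exact: ltW.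
rewrite ge0_muleDr//.
by rewrite -EFinM mulrCA divff ?gt_eqF// mulr1.
Qed.

Lemma lebesgue_diam (S : set X) (l : R) : measurable S -> 0 <= l ->
  (forall x y, S x -> S y -> `|x - y| <= l) -> (leb S <= l%:E)%E.
Proof.
move=> mS l0 Sl.
have [->|/set0P[x0 Sx0]] := eqVneq S set0; first by rewrite measure0 lee_fin.
have uS y : S y -> y <= inf S + l.
  move=> Sy; rewrite -lerBlDr; apply: lb_le_inf; first by exists x0.
  by move=> z Sz; have := Sl _ _ Sy Sz; rewrite ler_norml; lra.
have lS y : S y -> inf S <= y.
  move=> Sy; apply: ge_inf => //; exists (x0 - l) => z Sz.
  by have := Sl _ _ Sx0 Sz; rewrite ler_norml; lra.
apply: (@le_trans _ _ (leb `[inf S, inf S + l]%classic)).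
  apply: le_measure; rewrite ?inE//=.
  by move=> y Sy /=; rewrite in_itv/= lS// uS.
rewrite lebesgue_measure_itv/= lte_fin; case: ifP => _; last by rewrite lee_fin.
by rewrite -EFinB lee_fin; lra.
Qed.

(** The part of [Q] sent into an interval of length [l] has diameter at most [L * l], whatever its
    shape; intervals then suffice by [le_lebesgue_of_intervals]. *)
Lemma lebesgue_contraction (Q : set X) (T : X -> X) (L : R) :
  measurable Q -> measurable_fun setT T -> 0 < L ->
  (forall x y, Q x -> Q y -> `|x - y| <= L * `|T x - T y|) ->
  forall E : set X, measurable E -> (leb (Q `&` T @^-1` E) <= L%:E * leb E)%E.
Proof.
move=> mQ mT L0 QL E mE.
have [m mE'] := pushforward_restrP leb mQ mT.
rewrite -mE'; apply: le_lebesgue_of_intervals => // a b ab.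
rewrite mE'; apply: lebesgue_diam.
- by apply: measurableI => //; apply: measurable_preimT => //; exact: measurable_itv.
- by rewrite mulr_ge0 ?subr_ge0 ?ltW.
move=> x y [/= Qx Tx] [/= Qy Ty]; apply: (le_trans (QL _ _ Qx Qy)).
rewrite ler_pM2l//; move: Tx Ty; rewrite !in_itv/= => /andP[? ?] /andP[? ?].
by rewrite ler_norml; lra.
Qed.

Lemma measurable_inv : measurable_fun [set: X] (@GRing.inv R : X -> X).
Proof.
rewrite (_ : [set: X] = [set x : R | x != 0] `|` [set 0]); last first.
  by apply/seteqP; split=> x //= _; case: (eqVneq x 0); [right|left].
have oD : open [set x : R | x != 0].
  rewrite (_ : [set x : R | x != 0] = ~` [set 0]); last first.
    by apply/seteqP; split=> x /= /eqP.
  exact/closed_openC/closed_eq.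
apply/measurable_funU; [exact: open_measurable | exact: measurable_set1 | split].
  by apply: open_continuous_measurable_fun => // x; rewrite inE/=; exact: inv_continuous.
exact: measurable_fun_set1.
Qed.

Lemma measurable_floor : measurable_fun [set: X] (fun x : X => (Num.floor x)%:~R : X).
Proof.
apply: nondecreasing_measurable => // x y xy; rewrite ler_int; exact: le_floor.
Qed.

Lemma measurable_Talpha (a : R) : measurable_fun [set: X] (Talpha a : X -> X).
Proof.
have m1 : measurable_fun [set: X] (fun x : X => `|x^-1|).
  by apply: measurableT_comp => //; exact: measurable_inv.
apply: measurable_funB => //.
apply: (measurableT_comp measurable_floor).
by apply: measurable_funB => //; exact: measurable_funD.
Qed.

End LebesgueTools.

Section TalphaBasics.
Context {R : realType}.
Implicit Types (a b x : R).

Lemma Talpha_itv a x : a - 1 <= Talpha a x < a.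
Proof.
rewrite /Talpha; set z := `|x^-1|.
have /andP[] := floor_itv (z + 1 - a); rewrite intrD => *; lra.
Qed.

(** Both maps reduce the same number [|1/x|] modulo the integers, into two different unit intervals.
    This is what makes the acip of one parameter almost invariant under the map of a nearby one. *)
Lemma Talpha_eq a b x : a - 1 <= Talpha b x < a -> Talpha a x = Talpha b x.
Proof.
move=> /andP[h1 h2]; rewrite {1}/Talpha; rewrite /Talpha in h1 h2 *.
set z := `|x^-1| in h1 h2 *; congr (_ - _%:~R).
by apply: floor_def; rewrite intrD; lra.
Qed.

Lemma Talpha_int a x : `|x^-1| - Talpha a x = (Num.floor (`|x^-1| + 1 - a))%:~R.
Proof. by rewrite /Talpha opprB addrC subrK. Qed.

End TalphaBasics.

Lemma sum_series_le (R : realType) (u : nat -> \bar R) (Z D : R) (m : nat) :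
  (forall i, 0 <= u i)%E -> 0 <= D -> (forall i, u i <= Z%:E)%E ->
  (forall i, (m <= i)%N -> (u i <= (D * 2^-1 ^+ i)%:E)%E) ->
  (\sum_(0 <= i <oo) u i <= (m%:R * Z + 2 * D * 2^-1 ^+ m)%:E)%E.
Proof.
move=> u0 D0 uZ uD; have h0 : (0 <= 2^-1 :> R) by rewrite invr_ge0.
apply: lime_le; first by apply: is_cvg_nneseries => i _ _.
near=> n.
have mn : (m <= n)%N by near: n; exact: nbhs_infty_ge.
rewrite (@big_cat_nat _ _ _ m)//= EFinD; apply: leeD.
  have -> : m%:R * Z = \sum_(0 <= i < m) Z.
    by rewrite big_const_nat subn0 iter_addr_0 mulr_natl.
  by rewrite -sumEFin; apply: lee_sum => i _; exact: uZ.
apply: (@le_trans _ _ (\sum_(m <= i < n) (D * 2^-1 ^+ i)%:E)%E).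
  by rewrite big_nat [leRHS]big_nat; apply: lee_sum => i /andP[mi _]; exact: uD.
rewrite sumEFin lee_fin.
suff : \sum_(m <= i < n) (D * 2^-1 ^+ i) <= 2 * (D * 2^-1 ^+ m) - 2 * (D * 2^-1 ^+ n).
  by have := mulr_ge0 D0 (exprn_ge0 n h0); lra.
rewrite -(subnKC mn); elim: (n - m)%N => [|k IH]; first by rewrite addn0 big_geq// subrr.
rewrite addnS big_nat_recr ?leq_addr//= exprS.
by move: IH; lra.
Unshelve. all: by end_near. Qed.

(** * Dyadic and layer-cake control of the logarithm *)

Section LogIntegral.
Context {R : realType}.
Let X := measurableTypeR R.

(** On [[-1, 1]] this is [- ln |x|]; the truncation keeps it nonnegative elsewhere. Its value at 0
    is 0, because [ln 0 = 0]. *)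
Definition neglog (x : R) : R := Num.max 0 (- ln `|x|).

Lemma neglog_ge0 x : 0 <= neglog x. Proof. by rewrite le_max lexx. Qed.

Lemma measurable_neglog : measurable_fun [set: X] (neglog : X -> R).
Proof.
apply: measurable_maxr => //; apply: measurableT_comp => //.
by apply: (measurableT_comp (@measurable_ln R)).
Qed.

Lemma neglogE (x : R) : `|x| <= 1 -> neglog x = - ln `|x|.
Proof.
by move=> x1; apply/max_idPr; rewrite oppr_ge0 ln_le0.
Qed.

Lemma neglog_lt (x : R) (t : R) : 0 < t -> t <= neglog x -> `|x| <= expR (- t).
Proof.
move=> t0; rewrite le_max => /orP[]; first by lra.
have [->|x0] := eqVneq x 0; first by rewrite normr0 expR_ge0.
have n0 : 0 < `|x| by rewrite normr_gt0.
by move=> h; rewrite -[leLHS]lnK ?posrE// ler_expR lerNr.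
Qed.

Definition nball (i : nat) : set X := [set x | `|x| < 2^-1 ^+ i].

Lemma measurable_nball i : measurable (nball i).
Proof.
rewrite (_ : nball i = `](- 2^-1 ^+ i)%R, (2^-1 ^+ i)%R[%classic); first exact: measurable_itv.
by apply/seteqP; split => x; rewrite /nball/= in_itv/= ltr_norml.
Qed.

Lemma lebesgue_nball i : (@lebesgue_measure R (nball i) <= (2 * 2^-1 ^+ i)%:E)%E.
Proof.
have h2 : 0 <= 2 * 2^-1 ^+ i :> R by rewrite mulr_ge0// exprn_ge0// invr_ge0.
apply: lebesgue_diam (measurable_nball i) h2 _ => x y.
rewrite /nball/= !ltr_norml => /andP[? ?] /andP[? ?].
by rewrite ler_norml; apply/andP; split; lra.
Qed.

(** If [2^-(k+1) <= |x| < 2^-k], then [- ln |x| <= (k + 1) ln 2 <= k + 1], and [x] lies in the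
    [k + 1] balls [nball 0], ..., [nball k]. *)
Lemma neglog_le_nball (x : R) :
  ((neglog x)%:E <= \sum_(0 <= i <oo) (\1_(nball i) x)%:E)%E.
Proof.
have S0 n : (0 <= \sum_(0 <= i < n) (\1_(nball i : set R) x : R)%:E)%E.
  by apply: sume_ge0 => i _; rewrite lee_fin.
have Snn : (0 <= \sum_(0 <= i <oo) (\1_(nball i : set R) x : R)%:E)%E.
  by apply: nneseries_ge0 => i _ _; rewrite lee_fin.
have [x1|x1] := leP 1 `|x|.
  rewrite (_ : neglog x = 0)//.
  by apply/max_idPl; rewrite oppr_le0 ln_ge0.
have [x0|x0] := eqVneq x 0.
  rewrite (_ : neglog x = 0)//.
  by apply/max_idPl; rewrite x0 normr0 ln0// oppr0.
have n0 : 0 < `|x| by rewrite normr_gt0.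
have h0 : (0 < 2^-1 :> R) by rewrite invr_gt0.
have h1 : (2^-1 < 1 :> R) by rewrite invf_lt1// ltr1n.
have [k [xk]] : exists k, `|x| < 2^-1 ^+ k /\ 2^-1 ^+ k.+1 <= `|x|.
  pose p k := 2^-1 ^+ k <= `|x|.
  have exp : exists k, p k.
    have /cvgrPdist_lt /(_ `|x| n0) := @cvg_expr R (2^-1) ltac:(by rewrite ger0_norm// ltW).
    move=> [N _ /(_ N (leqnn _))]; rewrite /= sub0r normrN ger0_norm; last first.
      by rewrite exprn_ge0// ltW.
    by move=> /ltW; exists N.
  case: (ex_minnP exp) => -[|k] pk mk.
    by move: pk; rewrite /p expr0 leNgt x1.
  exists k; split => //; rewrite ltNge; apply/negP => /mk.
  by rewrite ltnn.
move=> kx; rewrite neglogE; last exact: ltW.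
apply: (@le_trans _ _ (\sum_(0 <= i < k.+1) (\1_(nball i) x)%:E)%E); last first.
  by apply: nneseries_lim_ge => i _ _; rewrite lee_fin.
rewrite sumEFin lee_fin big_nat (eq_bigr (fun=> 1)); last first.
  move=> i /andP[_ ik]; rewrite indicE mem_set// /nball/=.
  by apply: (lt_le_trans xk); rewrite ler_wiXn2l// ltW.
rewrite -big_nat big_const_nat iter_addr_0 subn0.
rewrite lerNl -ler_expR lnK ?posrE// (le_trans _ kx)//.
rewrite -(@lnK _ (2^-1 ^+ k.+1)) ?posrE ?exprn_gt0// ler_expR lnXn// lnV ?posrE//.
rewrite mulNrn lerN2 lerMn2r/=.
have := @le_ln1Dx R 1 ltac:(lra); rewrite (_ : 1 + 1 = 2 :> R)//.
Qed.

(** In the series of [neglog_le_nball] the [m] first terms are each at most the measure of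
    [nball m]; the others form a geometric series. *)
Lemma neglog_tail (nu : {measure set X -> \bar R}) (D : R) m :
  0 <= D -> (forall i, (m <= i)%N -> (nu (nball i) <= (D * 2^-1 ^+ i)%:E)%E) ->
  (\int[nu]_(x in nball m) (neglog x)%:E <= (D * 2^-1 ^+ m * (m%:R + 2))%:E)%E.
Proof.
move=> D0 nuD; have mB := measurable_nball.
have h0 : (0 <= 2^-1 :> R) by rewrite invr_ge0.
apply: (@le_trans _ _ (\int[nu]_(x in nball m) (\sum_(0 <= i <oo) (\1_(nball i) x)%:E))%E).
  apply: ge0_le_integral => //.
  - by move=> x _; rewrite lee_fin neglog_ge0.
  - by apply/measurable_EFinP; apply: measurable_funTS; exact: measurable_neglog.
  - apply: ge0_emeasurable_sum => //.
    by move=> i _; apply/measurable_EFinP; apply: measurable_funTS; exact: measurable_indic.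
  - by move=> x _; exact: neglog_le_nball.
rewrite integral_nneseries//; last first.
  by move=> i; apply/measurable_EFinP; apply: measurable_funTS; exact: measurable_indic.
have -> : D * 2^-1 ^+ m * (m%:R + 2) = m%:R * (D * 2^-1 ^+ m) + 2 * D * 2^-1 ^+ m by ring.
apply: sum_series_le => // i => [||mi].
- by apply: integral_ge0 => x _; rewrite lee_fin.
- by rewrite integral_indic//; apply: le_trans (nuD m (leqnn _)); exact: measureIr.
- by rewrite integral_indic//; apply: le_trans (nuD i mi); exact: measureIl.
Qed.

(** The sum counts the integers from 1 to [M] that do not exceed [t]. It reduces integrals of
    [neglog] to the measures of finitely many level sets, which pass to setwise limits. *)
Lemma staircase_le (t : R) M : 0 <= t -> \sum_(i < M) ((i.+1%:R <= t)%R : nat)%:R <= t.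
Proof.
move=> t0; suff : \sum_(i < M) ((i.+1%:R <= t)%R : nat)%:R <= Num.min t M%:R.
  by rewrite le_min => /andP[].
elim: M => [|M IH]; first by rewrite big_ord0 le_min t0 lexx.
rewrite big_ord_recr/=; move: IH; rewrite !le_min => /andP[h1 h2].
rewrite -natr1; case: (leP (M%:R + 1) t) => h /=; rewrite ?mulr1n ?mulr0n ?addr0; apply/andP; split; lra.
Qed.

Lemma staircase_ge (t : R) M : t < M%:R -> t <= 1 + \sum_(i < M) ((i.+1%:R <= t)%R : nat)%:R.
Proof.
elim: M => [|M IH] tM.
  by rewrite big_ord0; move: tM; rewrite /=; lra.
rewrite big_ord_recr/=.
have [/IH h|h] := ltP t M%:R.
  by apply: (le_trans h); rewrite addrA lerDl.
rewrite (eq_bigr (fun=> 1)); last first.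
  by move=> i _; rewrite (le_trans _ h)// ler_nat.
rewrite sumr_const card_ord -natr1 in tM *.
have := ler0n R ((M%:R + 1 <= t)%R : nat); lra.
Qed.

Definition nlevel (t : R) : set X := [set x | t <= neglog x].

Lemma measurable_nlevel t : measurable (nlevel t).
Proof.
rewrite (_ : nlevel t = neglog @^-1` `[t, +oo[%classic).
  by rewrite -[_ @^-1` _]setTI; apply: measurable_neglog => //; exact: measurable_itv.
by apply/seteqP; split => x; rewrite /nlevel/= in_itv/= andbT.
Qed.

Variable mu : probability X R.
Let Pr (A : set X) : R := fine (mu A).

Lemma neglog_integral_ge (e : R) M : 0 < e ->
  ((\sum_(i < M) e * Pr (nlevel (i.+1%:R * e)))%:E <= \int[mu]_x (neglog x)%:E)%E.
Proof.
move=> e0.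
have -> : ((\sum_(i < M) e * Pr (nlevel (i.+1%:R * e)))%:E =
   \int[mu]_x (\sum_(i < M) (e * \1_(nlevel (i.+1%:R * e)) x)%:E)%E)%E.
  rewrite ge0_integral_sum//; last 2 first.
  - move=> i; apply/measurable_EFinP; apply: measurable_funM => //.
    by apply: measurable_indic; exact: measurable_nlevel.
  - by move=> i x _; rewrite lee_fin mulr_ge0// ltW.
  rewrite -sumEFin; apply: eq_bigr => i _.
  under eq_integral do rewrite EFinM.
  have mi := measurable_nlevel (i.+1%:R * e).
  rewrite ge0_integralZl ?lee_fin ?(ltW e0)//; last first.
    by apply/measurable_EFinP; exact: measurable_indic.
  by rewrite integral_indic// setIT EFinM; congr (_ * _)%E; rewrite /Pr fineK// fin_num_measure.
apply: ge0_le_integral => //.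
- by move=> x _; apply: sume_ge0 => i _; rewrite lee_fin mulr_ge0// ltW.
- apply: emeasurable_sum => i; apply/measurable_EFinP; apply: measurable_funM => //.
  by apply: measurable_indic; exact: measurable_nlevel.
- by apply/measurable_EFinP; exact: measurable_neglog.
move=> x _; rewrite sumEFin lee_fin -mulr_sumr mulrC -ler_pdivlMr//.
apply: le_trans (staircase_le M (_ : 0 <= neglog x / e)); last by rewrite divr_ge0 ?neglog_ge0// ltW.
apply: ler_sum => i _; rewrite indicE /nlevel ler_pdivlMr//.
by case: (boolP (i.+1%:R * e <= neglog x)) => h; [rewrite mem_set | rewrite memNset//; exact/negP].
Qed.

(** Layer-cake sum of mesh [e]: rounding costs at most [e], and the points above the last level
    [M * e] lie in [nball m], where the tail integral takes over. *)
Lemma neglog_integral_le (e : R) M m : 0 < e -> expR (- (M%:R * e)) < 2^-1 ^+ m ->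
  (\int[mu]_x (neglog x)%:E <= (e + \sum_(i < M) e * Pr (nlevel (i.+1%:R * e)))%:E
     + \int[mu]_(x in nball m) (neglog x)%:E)%E.
Proof.
move=> e0 eM.
have mN : measurable_fun [set: X] (fun x : X => (neglog x)%:E).
  by apply/measurable_EFinP; exact: measurable_neglog.
have mB := measurable_nball m.
pose h (x : X) := (e + \sum_(i < M) e * \1_(nlevel (i.+1%:R * e)) x)%:E.
have mh : measurable_fun [set: X] h.
  apply/measurable_EFinP; apply: measurable_funD => //.
  apply: measurable_sum => i; apply: measurable_funM => //.
  by apply: measurable_indic; exact: measurable_nlevel.
have h0 x : (0 <= h x)%E.
  by rewrite lee_fin addr_ge0 ?(ltW e0)// sumr_ge0// => i _; rewrite mulr_ge0// ltW.
have -> : (e + \sum_(i < M) e * Pr (nlevel (i.+1%:R * e)))%:E = (\int[mu]_x h x)%E.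
  rewrite /h; under eq_integral do rewrite EFinD -sumEFin.
  rewrite ge0_integralD//; last 3 first.
  - by move=> x _; rewrite lee_fin ltW.
  - by move=> x _; apply: sume_ge0 => i _; rewrite lee_fin mulr_ge0// ltW.
  - apply: emeasurable_sum => i; apply/measurable_EFinP; apply: measurable_funM => //.
    by apply: measurable_indic; exact: measurable_nlevel.
  rewrite integral_cst//= probability_setT mule1 EFinD; congr (_ + _)%E.
  rewrite ge0_integral_sum//; last 2 first.
  - move=> i; apply/measurable_EFinP; apply: measurable_funM => //.
    by apply: measurable_indic; exact: measurable_nlevel.
  - by move=> i x _; rewrite lee_fin mulr_ge0// ltW.
  rewrite -sumEFin; apply: eq_bigr => i _.
  under eq_integral do rewrite EFinM.
  have mi := measurable_nlevel (i.+1%:R * e).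
  rewrite ge0_integralZl ?lee_fin ?(ltW e0)//; last first.
    by apply/measurable_EFinP; exact: measurable_indic.
  by rewrite integral_indic// setIT EFinM; congr (_ * _)%E; rewrite /Pr fineK// fin_num_measure.
rewrite (integral_mkcond (nball m)) -ge0_integralD//; last 2 first.
- by move=> x _; apply: erestrict_ge0 => ? _; rewrite lee_fin neglog_ge0.
- by apply/(measurable_restrictT _ mB)/measurable_funTS.
apply: ge0_le_integral => //.
- by move=> x _; rewrite lee_fin neglog_ge0.
- by apply: emeasurable_funD => //; apply/(measurable_restrictT _ mB)/measurable_funTS.
move=> x _; rewrite patchE; case: ifPn => [_|xB].
  by rewrite leeDr.
rewrite adde0 lee_fin.
have xM : neglog x < M%:R * e.
  rewrite ltNge; apply/negP => h1; move/negP: xB; apply; rewrite inE.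
  have [M0|M0] := ltP 0 (M%:R * e).
    by apply: (le_lt_trans _ eM); exact: neglog_lt.
  move: eM; rewrite ltNge => /negP; case.
  apply: (@le_trans _ _ 1); last by rewrite -[leLHS]expR0 ler_expR oppr_ge0.
  by rewrite exprn_ile1// invf_le1// ler1n.
have -> : neglog x = e * (neglog x / e) by rewrite mulrCA divff ?gt_eqF// mulr1.
rewrite -mulr_sumr -{3}[e]mulr1 -mulrDr ler_pM2l//.
apply: (le_trans (staircase_ge _ : _ <= 1 + \sum_(i < M) ((i.+1%:R <= neglog x / e)%R : nat)%:R)).
  by rewrite ltr_pdivrMr.
rewrite lerD2l; apply: ler_sum => i _; rewrite indicE /nlevel ler_pdivlMr//.
by case: (boolP (i.+1%:R * e <= neglog x)) => h1; [rewrite mem_set | rewrite memNset//; exact/negP].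
Qed.

End LogIntegral.

(** * Rokhlin's formula, upper bound *)

Lemma ln_prodr (R : realType) (I : Type) (s : seq I) (c : I -> R) :
  (forall i, 0 < c i) -> ln (\prod_(i <- s) c i) = \sum_(i <- s) ln (c i).
Proof.
move=> c0; elim: s => [|i s IH]; first by rewrite !big_nil ln1.
by rewrite !big_cons lnM ?posrE ?prodr_gt0// IH.
Qed.

Lemma integral_iter d (X : measurableType d) (R : realType) (P : probability X R)
    (T : X -> X) (f : X -> \bar R) j :
  measurable_fun setT T -> (forall A, measurable A -> P (T @^-1` A) = P A) ->
  measurable_fun setT f -> (forall x, 0 <= f x)%E ->
  (\int[P]_x f (iter j T x) = \int[P]_x f x)%E.
Proof.
move=> mT inv mf f0.
have mj := measurable_iter mT j.
have := @ge0_integral_pushforward _ _ X X R _ mj P setT f measurableT mf (fun y _ => f0 y).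
rewrite preimage_setT => <-; apply: eq_measure_integral => A mA _.
by rewrite -[RHS](inv_iter mT inv j mA).
Qed.

(** * Replacing a partition by well separated sets *)

Section Separation.
Context {R : realType}.
Let X := measurableTypeR R.
Local Notation leb := (@lebesgue_measure R).

Lemma compact_closed_gap (V W : set R) : compact V -> closed W -> V `&` W = set0 ->
  exists2 d, 0 < d & forall x z, V x -> W z -> d <= `|x - z|.
Proof.
move=> cV cW VW.
have /compact_near_coveringP/(_ R (0 : R)^'+ (fun d x => forall z, W z -> d <= `|x - z|) _) H := cV.
have {H} : \forall d \near (0 : R)^'+, V `<=` (fun x => forall z, W z -> d <= `|x - z|).
  apply: H => x Vx.
  have xW : ~ W x.
    by move=> Wx; have : (V `&` W) x by []; rewrite VW.
  have : nbhs x (~` W) by apply: open_nbhs_nbhs; split => //; exact: closed_openC.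
  move=> /nbhs_ballP[r /= r0 rW].
  exists (ball x (r / 2), [set d | d < r / 2]).
    split; first by apply: nbhsx_ballx; rewrite divr_gt0.
    by apply: nbhs_right_lt; rewrite divr_gt0.
  move=> [y d] /= [xy dr] z Wz.
  rewrite leNgt; apply/negP => yz; apply: (rW z) => //=.
  rewrite /ball/= in xy *; rewrite -(subrK y x) -addrA.
  by apply: (le_lt_trans (ler_normD _ _)); lra.
move=> H; near ((0 : R)^'+) => d; exists d; first by near: d; exact: nbhs_right_gt.
by near: d; apply: filterS H => d Hd x z Vx; exact: Hd.
Unshelve. all: by end_near. Qed.

(** Inner regularity gives compact subsets of the atoms with Lebesgue deficit below [e / (C * k)],
    which the density bound turns into a [mu]-deficit of [e / k] per atom; disjoint compact sets lie
    at positive distance. *)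
Lemma separated_approximation (mu : probability X R) (C e : R) (k : nat) (Q : 'I_k -> set X) :
  0 < C -> 0 < e -> mu `[-1, 1]%classic = 1%E ->
  (forall A, measurable A -> (mu A <= C%:E * leb A)%E) -> is_partition Q ->
  exists (d : R) (E : 'I_k -> set X), [/\ 0 < d,
    forall i, measurable (E i), forall i, E i `<=` Q i,
    forall i l x y, i != l -> E i x -> E l y -> d <= `|x - y| &
    (mu (~` \bigcup_i E i) <= e%:E)%E].
Proof.
move=> C0 e0 mu1 muC [mQ tQ cQ].
have k0 : 0 < k%:R :> R.
  rewrite ltr0n lt0n; apply/eqP => k0; move: (Q) cQ; rewrite k0 => Q' cQ'.
  by have : setT (0 : X) by []; rewrite -cQ' => -[[]].
pose I1 : set X := `[-1, 1]%classic.
have mI1 : measurable I1 by exact: measurable_itv.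
have e1 : 0 < e / (C * k%:R) by rewrite divr_gt0// mulr_gt0.
have /choice[V VP] i : exists V : set R, [/\ compact V, V `<=` Q i `&` I1 &
    (leb ((Q i `&` I1) `\` V) < (e / (C * k%:R))%:E)%E].
  have mQI : measurable (Q i `&` I1) by exact: measurableI.
  apply: lebesgue_regularity_inner => //.
  apply: (@le_lt_trans _ _ (leb I1)); first exact: measureIr.
  by rewrite lebesgue_measure_itv/= lte_fin; case: ifP => _; rewrite ?ltry.
have clV i : closed (V i) by apply: compact_closed; [exact: Rhausdorff|have [] := VP i].
have mV i : measurable (V i : set X) by exact: closed_measurable.
have /choice[g gP] (il : 'I_k * 'I_k) : exists g : R, 0 < g /\ (il.1 != il.2 ->
    forall x z, V il.1 x -> V il.2 z -> g <= `|x - z|).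
  have [->|il12] := eqVneq il.1 il.2; first by exists 1.
  have V12 : V il.1 `&` V il.2 = set0.
    apply/seteqP; split => // x [].
    have [_ s1 _] := VP il.1; have [_ s2 _] := VP il.2.
    move=> /s1[Q1 _] /s2[Q2 _].
    have : (Q il.1 `&` Q il.2) x by [].
    by rewrite (trivIset_disj tQ il12).
  have cV1 : compact (V il.1) by have [] := VP il.1.
  by have [g g0 gg] := compact_closed_gap cV1 (clV _) V12; exists g.
have mcV : measurable (~` \bigcup_i V i : set X).
  by apply: measurableC; apply: fin_bigcup_measurable => //; exact: finite_finset.
exists (\big[Order.min/1]_il g il), V; split => //.
- by apply/bigmin_gtP; split => // il _; have [] := gP il.
- by move=> i x Vx; have [_ /(_ x Vx)[]] := VP i.
- move=> i l x y il Vx Vy; apply: (@le_trans _ _ (g (i, l))).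
    exact: bigmin_le_cond.
  by have [_] := gP (i, l); apply.
have mD i : measurable ((Q i `&` I1) `\` V i).
  by apply: measurableD; [exact: measurableI | exact: mV].
have mu0 : mu (~` I1) = 0%E by rewrite probability_setC// mu1 subee.
have mB i : measurable (Q i `&` ~` \bigcup_i V i) by exact: measurableI.
rewrite (prE _ mcV) lee_fin -(pr_cover mu mQ tQ cQ mcV).
have -> : e = \sum_(i < k) (e / k%:R).
  by rewrite sumr_const card_ord -[RHS]mulr_natr divfK// gt_eqF.
apply: ler_sum => i _; rewrite -lee_fin -prE//.
apply: (@le_trans _ _ (mu (((Q i `&` I1) `\` V i) `|` ~` I1))).
  apply: le_measure; rewrite ?inE//.
    by apply: measurableU => //; exact: measurableC.
  move=> x [Qx nV]; have [xI|] := pselect (I1 x); last by right.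
  by left; split => // Vx; apply: nV; exists i.
have mI1C : measurable (~` I1) by exact: measurableC.
rewrite measureU0//.
apply: (le_trans (muC _ (mD i))).
have [_ _ /ltW le] := VP i.
apply: (le_trans (lee_wpmul2l _ le)); first by rewrite lee_fin ltW.
rewrite -EFinM lee_fin le_eqVlt; apply/orP; left; apply/eqP; field.
by rewrite !gt_eqF.
Qed.

End Separation.

(** * Points that shadow an orbit *)

Section OrbitCloseness.
Context {R : realType}.
Implicit Types (a x y : R).

(** The margin from the endpoints matters for the image: if [Talpha a x] is in the core, then
    [|1/x|] can move by less than [eta] without changing the digit. The margin from 0 keeps [|1/x|]
    bounded. *)
Definition core a (eta : R) : set R :=
  [set x | (a - 1 + eta <= x <= a - eta) && (eta <= `|x|)].

(** The points [x] and [y] have the same digit, so [Talpha a x - Talpha a y = |1/x| - |1/y|]. *)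
Lemma Talpha_close a eta x y : 0 < eta -> 0 < `|y| -> eta <= `|x| ->
  a - 1 + eta <= Talpha a x <= a - eta -> `|x - y| < eta * (`|x| * `|y|) ->
  `|Talpha a x - Talpha a y| * (`|x| * `|y|) <= `|x - y|.
Proof.
move=> eta0 y0 ex /andP[h1 h2] xy.
have x0 : 0 < `|x| by exact: lt_le_trans ex.
have xy0 : 0 < `|x| * `|y| by exact: mulr_gt0.
set z := `|x^-1| in h1 h2 *; set w := `|y^-1|.
have zw : `|z - w| * (`|x| * `|y|) <= `|x - y|.
  rewrite /z /w !normfV -[X in _ * X](gtr0_norm xy0) -normrM.
  rewrite (_ : _ * (_ * _) = `|y| - `|x|); last first.
    by field; rewrite !gt_eqF.
  by rewrite distrC; exact: ler_dist_dist.
have zw1 : `|z - w| < eta.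
  by rewrite -(ltr_pM2r xy0) (le_lt_trans zw).
have E : Talpha a x - Talpha a y = z - w.
  rewrite /Talpha -/z -/w in h1 h2 *.
  suff -> : Num.floor (w + 1 - a) = Num.floor (z + 1 - a) by ring.
  apply: floor_def; rewrite intrD; move: zw1; rewrite ltr_norml; lra.
by rewrite E.
Qed.

(** Staying within [kap * eta <= kap * |x|] of [x] forces [|y| >= (1 - kap) * |x|]. One step thus
    expands distances by at most [1 / ((1 - kap) * |x| ^ 2)], which uses up one factor of the
    initial bound. *)
Lemma orbit_close a eta kap x y n : 0 <= a <= 1 -> 0 < eta -> 0 < kap < 1 ->
  (forall j, (j <= n)%N -> core a eta (iter j (Talpha a) x)) ->
  `|x - y| <= kap * eta * (1 - kap) ^+ n * \prod_(j < n) `|iter j (Talpha a) x| ^+ 2 ->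
  forall j, (j <= n)%N -> `|iter j (Talpha a) x - iter j (Talpha a) y| <= kap * eta.
Proof.
move=> a01 eta0 kap01; have /andP[kap0 kap1] := kap01.
have ke0 : 0 < kap * eta by exact: mulr_gt0.
have core1 z : core a eta z -> `|z| <= 1.
  by move=> /andP[/andP[? ?] _]; rewrite ler_norml; lra.
have pow1 n' : 0 <= (1 - kap) ^+ n' <= 1.
  by rewrite exprn_ge0 ?exprn_ile1//; lra.
elim: n x y => [|n IH] x y xc xy j jn.
  by move: jn xy; rewrite leqn0 => /eqP ->; rewrite big_ord0 expr0 !mulr1.
have prod1 m z : (forall j, (j <= m)%N -> core a eta (iter j (Talpha a) z)) ->
    0 <= \prod_(j < m) `|iter j (Talpha a) z| ^+ 2 <= 1.
  move=> zc; rewrite prodr_ge0//=.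
  apply: prodr_ile1 => i _; rewrite exprn_ge0// exprn_ile1//.
  by apply: core1; apply: zc; exact: ltnW.
have xy1 : `|x - y| <= kap * eta.
  apply: (le_trans xy); have /andP[p0 p1] := prod1 _ _ xc; have /andP[q0 q1] := pow1 n.+1.
  rewrite -mulrA ler_piMr ?(ltW ke0)//.
  by apply: mulr_ile1.
have x0c := xc 0%N isT; have x1c := xc 1%N isT; rewrite /= in x0c x1c.
have /andP[_ ex] := x0c.
have x0 : 0 < `|x| by exact: lt_le_trans ex.
have yx : `|x| * (1 - kap) <= `|y|.
  have : `|x| <= `|y| + `|x - y| by rewrite addrC -lerBlDr; exact: lerB_dist.
  have : kap * eta <= kap * `|x| by rewrite ler_pM2l.
  by lra.
have kx0 : 0 < `|x| * (1 - kap) by rewrite mulr_gt0//; lra.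
have y0 : 0 < `|y| by exact: lt_le_trans yx.
rewrite big_ord_recl/= in xy.
set Pi := \prod_(i < n) _ in xy.
have PiE : Pi = \prod_(j < n) `|iter j (Talpha a) (Talpha a x)| ^+ 2.
  by apply: eq_bigr => i _; rewrite /= -iterSr.
have xcT j' : (j' <= n)%N -> core a eta (iter j' (Talpha a) (Talpha a x)).
  by move=> j'n; rewrite -iterSr; exact: xc.
have /andP[Pi0 Pi1] := prod1 _ _ xcT; rewrite -PiE in Pi0 Pi1.
have /andP[q0 q1] := pow1 n.
set K := kap * eta * (1 - kap) ^+ n * Pi.
have K0 : 0 <= K by rewrite !mulr_ge0// ltW.
have Kke : K <= kap * eta.
  by rewrite /K -mulrA ler_piMr ?(ltW ke0)//; exact: mulr_ile1.
have xyK : `|x - y| <= K * (`|x| * `|y|).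
  apply: (@le_trans _ _ (K * (`|x| * (`|x| * (1 - kap))))).
    by apply: (le_trans xy); rewrite /K exprS expr2 le_eqVlt; apply/orP; left; apply/eqP; ring.
  by rewrite ler_wpM2l// ler_pM2l.
have Tc : `|Talpha a x - Talpha a y| <= K.
  have xy0 : 0 < `|x| * `|y| by exact: mulr_gt0.
  rewrite -(ler_pM2r xy0); apply: le_trans (xyK); apply: (Talpha_close (eta := eta)) => //.
  - by have /andP[] := x1c.
  - apply: (le_lt_trans xyK); rewrite ltr_pM2r//.
    by apply: (le_lt_trans Kke); rewrite gtr_pMl.
case: j jn => [//|j jn]; rewrite !iterSr; apply: IH => //.
by rewrite -PiE.
Qed.

End OrbitCloseness.

Section UpperBound.
Context {R : realType}.
Let X := measurableTypeR R.
Local Notation leb := (@lebesgue_measure R).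
Variables (a C : R) (mu : probability X R).
Hypotheses (a01 : 0 < a <= 1) (C0 : 0 < C).
Hypothesis mua : is_acip a mu.
Hypothesis muC : forall A, measurable A -> (mu A <= C%:E * leb A)%E.
Let T : X -> X := Talpha a.
Let Pr (A : set X) : R := fine (mu A).

Let inv A : measurable A -> mu (T @^-1` A) = mu A.
Proof. by case: mua => _ + _; apply. Qed.

Let mT : measurable_fun setT T. Proof. exact: measurable_Talpha. Qed.

Lemma acip_itv11 : mu `[-1, 1]%classic = 1%E.
Proof.
case: mua => m1 _ _; apply/eqP; rewrite eq_le probability_le1 ?measurable_itv//= -m1.
apply: le_measure; rewrite ?inE//; try exact: measurable_itv.
move=> x /=; rewrite !in_itv/= => /andP[h1 h2]; case/andP: a01 => h3 h4.
by apply/andP; split; lra.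
Qed.

Lemma measurable_core eta : measurable (core a eta : set X).
Proof.
rewrite (_ : core a eta = `[a - 1 + eta, a - eta]%classic `&` ~` `](- eta)%R, eta[%classic).
  by apply: measurableI; [|apply: measurableC]; exact: measurable_itv.
apply/seteqP; split=> x; rewrite /core/= !in_itv/=.
  move=> /andP[-> h]; split=> //; apply/negP; rewrite -ltr_norml; lra.
by move=> [-> /negP]; rewrite -ltr_norml -leNgt => ->.
Qed.

Lemma core_compl_le eta : 0 < eta -> (mu (~` core a eta) <= (6 * C * eta)%:E)%E.
Proof.
move=> eta0.
pose J u v : set X := `[u, v]%classic.
have mJ u v : measurable (J u v) by exact: measurable_itv.
have muJ u v : u <= v -> (mu (J u v) <= (C * (v - u))%:E)%E.
  move=> uv; apply: (le_trans (muC (mJ u v))).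
  rewrite /J lebesgue_measure_itv/= lte_fin EFinM; apply: lee_wpmul2l.
    by rewrite lee_fin ltW.
  by case: ifP => _; rewrite ?lee_fin ?subr_ge0.
have mI : mu (~` J (a - 1) a) = 0%E.
  by rewrite probability_setC//; case: mua => -> _ _; rewrite subee.
pose U := J (a - 1) (a - 1 + eta) `|` J (a - eta) a `|` J (- eta) eta.
have mU : measurable U by apply: measurableU => //; exact: measurableU.
have mIC : measurable (~` J (a - 1) a) by exact: measurableC.
apply: (@le_trans _ _ (mu (U `|` ~` J (a - 1) a))).
  apply: le_measure; rewrite ?inE; [by apply: measurableC; exact: measurable_core| exact: measurableU|].
  move=> x nx; have [xI|] := pselect (J (a - 1) a x); last by right.
  left; move: xI; rewrite /U /J/= !in_itv/= => /andP[xl xr].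
  have [h1|h1] := leP x (a - 1 + eta); first by left; left; rewrite xl.
  have [h2|h2] := leP (a - eta) x; first by left; right; rewrite xr.
  right; rewrite -ler_norml leNgt; apply/negP => h3; apply: nx.
  by rewrite /core/= (ltW h1) (ltW h2) (ltW h3).
rewrite measureU0//.
apply: (le_trans (measureU2 _ (measurableU _ _ (mJ _ _) (mJ _ _)) (mJ _ _))).
(* The strips at the two endpoints and around 0 have total length [4 * eta]; the last term is
   slack. *)
have -> : 6 * C * eta = C * (a - 1 + eta - (a - 1)) + C * (a - (a - eta)) + C * (eta - - eta) + 2 * C * eta.
  by ring.
have Ce : 0 <= 2 * C * eta by rewrite !mulr_ge0// ltW.
have h12 := measureU2 mu (mJ (a - 1) (a - 1 + eta)) (mJ (a - eta) a).
have h1 : (mu (J (a - 1)%R (a - 1 + eta)%R) <= (C * (a - 1 + eta - (a - 1)))%:E)%E.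
  by apply: muJ; lra.
have h2 : (mu (J (a - eta)%R a) <= (C * (a - (a - eta)))%:E)%E by apply: muJ; lra.
have h3 : (mu (J (- eta)%R eta) <= (C * (eta - - eta))%:E)%E by apply: muJ; lra.
rewrite !EFinD; apply: (@le_trans _ _ (mu (J (a - 1)%R (a - 1 + eta)%R) + mu (J (a - eta)%R a) + mu (J (- eta)%R eta))%E).
  exact: leeD.
apply: le_trans (leeD (leeD h1 h2) h3) _.
by rewrite leeDl// lee_fin.
Qed.

Variables (k : nat) (Q : 'I_k -> set X).
Hypothesis pQ : is_partition Q.

(** The time [j = n] is included because following [n] steps of an orbit requires the image of the
    last step to be in the core. *)
Definition good_set eta n : set X :=
  [set x | forall j, (j <= n)%N -> core a eta (iter j T x)].

Lemma measurable_good_set eta n : measurable (good_set eta n).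
Proof.
rewrite (_ : good_set eta n = \bigcap_(j in [set j | (j <= n)%N]) (iter j T @^-1` core a eta)).
  apply: bigcap_measurable => [|j _]; first by exists 0%N.
  by apply: measurable_preimT; [exact: measurable_iter | exact: measurable_core].
by apply/seteqP; split => [x h j /= jn|x h j jn]; exact: h.
Qed.

Lemma good_set_compl_le eta n : 0 < eta ->
  (mu (~` good_set eta n) <= ((n%:R + 1) * (6 * C * eta))%:E)%E.
Proof.
move=> eta0; set G := good_set _ _.
have mG : measurable G by exact: measurable_good_set.
have mB j : measurable (iter j T @^-1` ~` core a eta).
  apply: measurable_preimT; first exact: measurable_iter.
  by apply: measurableC; exact: measurable_core.
apply: (@le_trans _ _ (mu (\big[setU/set0]_(j < n.+1) (iter j T @^-1` ~` core a eta)))).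
  apply: le_measure; rewrite ?inE; [exact: measurableC|exact: bigsetU_measurable|].
  move=> x nG; rewrite -(bigcup_mkord n.+1 (fun j => iter j T @^-1` ~` core a eta)).
  apply: contrapT => H; apply: nG => j jn.
  by apply: contrapT => nc; apply: H; exists j.
apply: (le_trans (Boole_inequality mu (fun j _ => mB j))).
apply: (@le_trans _ _ (\sum_(j < n.+1) (6 * C * eta)%:E)%E).
  have mC : measurable (~` core a eta : set X) by apply: measurableC; exact: measurable_core.
  by apply: lee_sum => j _; apply: le_trans (core_compl_le eta0); rewrite -[leRHS](inv_iter mT inv j mC).
by rewrite sumEFin sumr_const card_ord lee_fin -[_ *+ n.+1]mulr_natl natr1.
Qed.

Lemma core_norm eta z : 0 < eta -> core a eta z -> 0 < `|z| <= 1.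
Proof.
move=> eta0 /andP[/andP[h1 h2] h3]; apply/andP; split; first exact: lt_le_trans h3.
by rewrite ler_norml; case/andP: a01 => h4 h5; apply/andP; split; lra.
Qed.

(** The product is [1 / |(T^n)' x|], so up to the other factors this is the length over which [n]
    steps of the orbit of [x] can be followed. *)
Definition radius eta kap n (x : X) : R :=
  kap * eta * (1 - kap) ^+ n * \prod_(j < n) `|iter j T x| ^+ 2.

Lemma radius_bnd eta kap n x : 0 < eta -> 0 < kap < 1 -> good_set eta n x ->
  0 < radius eta kap n x <= 1.
Proof.
move=> eta0 /andP[kap0 kap1] Gx.
have b j : (j < n)%N -> 0 < `|iter j T x| <= 1.
  by move=> jn; apply: (core_norm eta0); apply: Gx; exact: ltnW.
have p0 : 0 < \prod_(j < n) `|iter j T x| ^+ 2.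
  by apply: prodr_gt0 => j _; rewrite exprn_gt0//; have /andP[] := b j (ltn_ord j).
have p1 : \prod_(j < n) `|iter j T x| ^+ 2 <= 1.
  apply: prodr_ile1 => j _; rewrite exprn_ge0// exprn_ile1//.
  by have /andP[] := b j (ltn_ord j).
have q0 : 0 < (1 - kap) ^+ n by rewrite exprn_gt0// subr_gt0.
have q1 : (1 - kap) ^+ n <= 1 by rewrite exprn_ile1//; lra.
have eta1 : eta <= 1.
  have G0 := Gx 0%N isT; have /andP[_ /le_trans] := G0; apply.
  by have /andP[] := core_norm eta0 G0.
rewrite /radius; apply/andP; split; first by rewrite !mulr_gt0.
apply: mulr_ile1 => //; [by rewrite !mulr_ge0// ltW|exact: ltW|].
apply: mulr_ile1 => //; [by rewrite !mulr_ge0// ltW|exact: ltW|].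
by apply: mulr_ile1 => //; exact: ltW.
Qed.

(** A guaranteed probability for the letter of [z] in the code: [1 - e] on the separated sets,
    [e / k] on the exceptional set [U]. *)
Definition code_weight (k : nat) (U : set X) e (z : X) : R :=
  if z \in U then e / k%:R else 1 - e.

(* [N w] averages, over a Lebesgue-random point [y], the product law that codes
   the [j]-th symbol by the set [E i] closest to the [j]-th iterate of [y]; the
   term [k^-n / 2] keeps it positive. *)
Lemma code_exists (e d eta kap : R) (E : 'I_k -> set X) (n : nat) :
  0 < e < 1 -> 0 < eta -> 0 < kap < 1 -> kap * eta < d ->
  (forall i, measurable (E i)) -> (forall i, E i `<=` Q i) ->
  (forall i l x y, i != l -> E i x -> E l y -> 2 * d <= `|x - y|) ->
  exists N : {ffun 'I_n -> 'I_k} -> R, [/\ \sum_w N w <= 1,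
    forall w, N w <= 1, forall w, 0 < N w, forall w, k%:R^-1 ^+ n / 2 <= N w &
    forall w x, good_set eta n x -> @iterated_join _ X T _ Q n w x ->
      radius eta kap n x * \prod_(j < n) code_weight k (~` \bigcup_i E i) e (iter j T x) / 4 <= N w].
Proof.
move=> e01 eta0 kap01 ked mE EQ sepE.
have [mQ tQ cQ] := pQ.
have k0 : 0 < k%:R :> R.
  rewrite ltr0n lt0n; apply/eqP => k0; move: (Q) cQ; rewrite k0 => Q' cQ'.
  by have : setT (0 : X) by []; rewrite -cQ' => -[[]].
have /andP[e0 e1] := e01.
have d0 : 0 < d by apply: lt_trans ked; rewrite mulr_gt0//; lra.
(* The [d]-neighbourhoods of the [E i] are pairwise disjoint, these sets being [2 * d]-separated; a
   point [y] close to [E i] thus designates the letter [i]. *)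
pose O i : set X := [set y | exists2 z, E i z & `|z - y| < d].
have oO i : open (O i : set R).
  rewrite (_ : O i = \bigcup_(z in E i) ball (z : R) d).
    by apply: bigcup_open => z _; exact: ball_open.
  by apply/seteqP; split => [y [z Ez zy]|y [z Ez zy]]; exists z.
have mO i : measurable (O i) by exact: open_measurable.
have O_disj i l y : O i y -> O l y -> i = l.
  move=> [z Ez zy] [z' Ez' z'y]; apply/eqP/negPn/negP => il.
  have := sepE _ _ _ _ il Ez Ez'.
  have := ler_distD (y : R) (z : R) (z' : R); rewrite (distrC (y : R) z') => h1 h2.
  have h3 := lt_le_trans (ltrD zy z'y) (_ : d + d <= 2 * d).
  have : `|z - z'| < 2 * d by apply: (le_lt_trans h1); apply: h3; lra.
  by rewrite ltNge h2.
pose p i (y : X) : R := (1 - e) * \1_(O i) y + e / k%:R.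
have p0 i y : 0 < p i y.
  by rewrite ltr_wpDl ?divr_gt0// mulr_ge0// subr_ge0 ltW.
have mp i : measurable_fun [set: X] (p i).
  by apply: measurable_funD => //; apply: measurable_funM => //; exact: measurable_indic.
have sump y : \sum_i p i y <= 1.
  rewrite big_split/= sumr_const card_ord -[X in _ + X]mulr_natr divfK ?gt_eqF//.
  rewrite -mulr_sumr.
  have [[i Oi]|nO] := pselect (exists i, O i y).
    rewrite (bigD1 i)//= indicE mem_set// big1 ?addr0 ?mulr1 ?subrK// => l li.
    by rewrite indicE memNset// => Ol; move/eqP: li; apply; exact: O_disj Oi.
  rewrite big1 ?mulr0 ?add0r ?ltW// => l _.
  by rewrite indicE memNset// => Ol; apply: nO; exists l.
pose W := {ffun 'I_n -> 'I_k}.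
pose J w := @iterated_join _ X T _ Q n w.
pose D : set X := `[-1, 1]%classic.
have mD : measurable D by exact: measurable_itv.
have lebD : leb D = 2%:E.
  by rewrite lebesgue_measure_itv/= lte_fin ifT; [rewrite -EFinB; congr EFin; ring|lra].
pose F (w : W) (y : X) : R := \prod_(j < n) p (w j) (iter j T y).
have F0 w y : 0 < F w y by apply: prodr_gt0.
have mF w : measurable_fun D (fun y => (F w y)%:E).
  apply/measurable_EFinP; apply: measurable_funTS; apply: measurable_prod => j _.
  by apply: (measurableT_comp (mp _)); exact: measurable_iter.
have F1 y : \sum_w F w y <= 1.
  rewrite /F -(bigA_distr_bigA (fun (j : 'I_n) (i : 'I_k) => p i (iter j T y)))/=.
  apply: (@le_trans _ _ (\prod_(j < n) 1)); last by rewrite big1.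
  by apply: ler_prod => j _; rewrite sump sumr_ge0// => i _; exact: ltW.
pose nu w : \bar R := (\int[leb]_(y in D) (F w y)%:E)%E.
have nu0 w : (0 <= nu w)%E by apply: integral_ge0 => y _; rewrite lee_fin ltW.
have sumnu : (\sum_w nu w <= 2%:E)%E.
  rewrite -ge0_integral_sum//; last by move=> w y _; rewrite lee_fin ltW.
  rewrite -lebD -[leRHS]mul1e -(integral_cst leb mD).
  apply: ge0_le_integral => //.
  - by move=> y _; apply: sume_ge0 => w _; rewrite lee_fin ltW.
  - exact: emeasurable_sum.
  - by move=> y _; rewrite sumEFin lee_fin.
have nufin w : nu w \is a fin_num.
  rewrite ge0_fin_numE//; apply: (le_lt_trans _ (ltry 2)); apply: le_trans sumnu.
  by rewrite (bigD1 w)//= leeDl// sume_ge0.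
pose N (w : W) : R := k%:R^-1 ^+ n / 2 + fine (nu w) / 4.
have Nge1 w : k%:R^-1 ^+ n / 2 <= N w by rewrite lerDl divr_ge0// fine_ge0.
have Nge2 w : fine (nu w) / 4 <= N w.
  by rewrite lerDr divr_ge0// exprn_ge0// invr_ge0 ltW.
have kn0 : 0 < k%:R^-1 ^+ n / 2 :> R by rewrite divr_gt0// exprn_gt0// invr_gt0.
have N0 w : 0 < N w by exact: lt_le_trans (Nge1 w).
have sumN : \sum_w N w <= 1.
  rewrite big_split/= sumr_const card_ffun !card_ord -mulr_suml.
  have : \sum_w fine (nu w) <= 2.
    by rewrite -lee_fin -sumEFin; under eq_bigr do rewrite fineK//.
  have -> : (k%:R^-1 ^+ n / 2) *+ (k ^ n) = 2^-1 :> R.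
    rewrite -mulr_natr natrX mulrAC -exprMn mulVf ?gt_eqF// expr1n mul1r//.
  by lra.
have N1 w : N w <= 1.
  by apply: le_trans sumN; rewrite (bigD1 w)//= lerDl sumr_ge0// => ? _; exact: ltW.
pose c := code_weight k (~` \bigcup_i E i) e.
have c0 z : 0 < c z by rewrite /c /code_weight; case: ifP => _; [exact: divr_gt0 | lra].
pose r := radius eta kap n.
have nuge w x : good_set eta n x -> J w x -> ((r x * \prod_(j < n) c (iter j T x))%:E <= nu w)%E.
  move=> Gx Jx.
  have /andP[r0 r1] := radius_bnd eta0 kap01 Gx.
  have xP y : `|x - y| <= r x -> \prod_(j < n) c (iter j T x) <= F w y.
    move=> xy; apply: ler_prod => j _; rewrite (ltW (c0 _))/=.
    have jn := ltnW (ltn_ord j).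
    have cl : `|iter j T x - iter j T y| <= kap * eta.
      apply: (orbit_close _ eta0 kap01 Gx xy jn).
      by case/andP: a01 => h1 ->; rewrite ltW.
    rewrite /c /code_weight; case: ifPn => [_|].
      by rewrite lerDr mulr_ge0// subr_ge0 ltW.
    rewrite notin_setE /setC/= => /contrapT[i _ Ei].
    have wi : w j = i.
      apply/eqP/negPn/negP => ne; have : (Q (w j) `&` Q i) (iter j T x).
        by split; [exact: Jx | exact: EQ].
      by rewrite (trivIset_disj tQ ne).
    rewrite /p indicE mem_set ?mulr1 ?lerDl ?divr_ge0 ?ltW//.
    rewrite wi; exists (iter j T x) => //; exact: le_lt_trans ked.
  have /andP[_ x1] := core_norm eta0 (Gx 0%N isT); rewrite /= ler_norml in x1.
  (* Only a one-sided neighbourhood of [x], taken on the side of 0, is sure to stay in [[-1, 1]]. *)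
  have [u [v [uv uvD uvx]]] : exists u v : R, [/\ v - u = r x, -1 <= u /\ v <= 1 &
      forall y, u <= y <= v -> `|x - y| <= r x].
    case/andP: x1 => x1 x2; have [x0|x0] := leP (x : R) 0.
      exists x, (x + r x); split; [rewrite -/(r x); ring|rewrite -/(r x) in r1; split; lra|].
      by move=> y /andP[h1 h2]; rewrite ler_norml; apply/andP; split; lra.
    exists (x - r x), x; split; [rewrite -/(r x); ring|rewrite -/(r x) in r1; split; lra|].
    by move=> y /andP[h1 h2]; rewrite ler_norml; apply/andP; split; lra.
  pose S : set X := `[u, v]%classic.
  have mS : measurable S by exact: measurable_itv.
  have SD : S `<=` D.
    by case: uvD => h1 h2 y; rewrite /S /D/= !in_itv/= => /andP[h3 h4]; apply/andP; split; lra.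
  have -> : ((r x * \prod_(j < n) c (iter j T x))%:E =
      \int[leb]_(y in S) (cst (\prod_(j < n) c (iter j T x))%:E) y)%E.
    have lebS : leb S = (r x)%:E.
      rewrite /S lebesgue_measure_itv/= lte_fin ifT -?EFinB ?uv//.
      by rewrite -subr_gt0 uv.
    by rewrite integral_cst// mulrC EFinM; congr (_ * _)%E; exact/esym.
  apply: (@le_trans _ _ (\int[leb]_(y in S) (F w y)%:E)%E).
    apply: ge0_le_integral => //.
    - by move=> y _; rewrite /cst lee_fin prodr_ge0// => j _; exact: ltW.
    - exact: measurable_funS (mF w).
    - by move=> y Sy; rewrite /cst lee_fin; apply: xP; apply: uvx; move: Sy; rewrite /S/= in_itv.
  by apply: ge0_subset_integral => //; move=> y _; rewrite lee_fin ltW.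
exists N; split => // w x Gx Jx; apply: le_trans (Nge2 w); rewrite ler_pM2r ?invr_gt0//.
by rewrite -lee_fin fineK//; exact: nuge.
Qed.

(** Mean length of the code of [code_exists]. On [good_set] the main term is [- ln radius], whose
    variable part is the Birkhoff sum of [2 * neglog]; each letter adds [- ln (1 - e)], each visit
    to the exceptional set [ln (k / e)]. Off [good_set] the length is at most [ln 2 + n * ln k].
    Invariance integrates the Birkhoff sums. *)
Lemma entropy_bound_at (e e2 d eta kap : R) (E : 'I_k -> set X) (n : nat) (I : R) :
  0 < e < 1 -> 0 < eta <= 1 -> 0 < kap < 1 -> kap * eta < d ->
  (\int[mu]_x (neglog x)%:E <= I%:E)%E ->
  (forall i, measurable (E i)) -> (forall i, E i `<=` Q i) ->
  (forall i l x y, i != l -> E i x -> E l y -> 2 * d <= `|x - y|) ->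
  (mu (~` \bigcup_i E i) <= e2%:E)%E ->
  partition_entropy mu (@iterated_join _ X T _ Q n) <=
    ln 4 + n%:R * ln k%:R * ((n%:R + 1) * (6 * C * eta))
    + (- ln kap - ln eta - n%:R * ln (1 - kap)) + n%:R * (2 * I)
    - n%:R * ln (1 - e) + n%:R * (ln (k%:R / e) * e2).
Proof.
move=> e01 /andP[eta0 eta1] kap01 ked intI mE EQ sepE muE.
have [N [sumN N1 N0 NB NG]] := @code_exists e d eta kap E n e01 eta0 kap01 ked mE EQ sepE.
have [mQ tQ cQ] := pQ.
have k0 : 0 < k%:R :> R.
  rewrite ltr0n lt0n; apply/eqP => k0; move: (Q) cQ; rewrite k0 => Q' cQ'.
  by have : setT (0 : X) by []; rewrite -cQ' => -[[]].
have /andP[e0 e1] := e01; have /andP[kap0 kap1] := kap01.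
have k1 : 1 <= k%:R :> R by rewrite ler1n -(ltr0n R).
have lnk : 0 <= ln k%:R :> R by exact: ln_ge0.
have ke1 : 1 <= k%:R / e by rewrite ler_pdivlMr//; lra.
have lnke : 0 <= ln (k%:R / e) by exact: ln_ge0.
have ln1e : ln (1 - e) <= 0 by apply: ln_le0; lra.
have ln1k : ln (1 - kap) <= 0 by apply: ln_le0; lra.
have n0' : 0 <= n%:R :> R by [].
pose G := good_set eta n.
have mG : measurable G by exact: measurable_good_set.
have mGC : measurable (~` G) by exact: measurableC.
have muG : (mu (~` G) <= ((n%:R + 1) * (6 * C * eta))%:E)%E by exact: good_set_compl_le.
pose U : set X := ~` \bigcup_i E i.
have mU : measurable U.
  by apply: measurableC; apply: fin_bigcup_measurable => //; exact: finite_finset.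
have c0 z : 0 < code_weight k U e z.
  by rewrite /code_weight; case: ifP => _; [exact: divr_gt0 | lra].
have clog z : - ln (code_weight k U e z) <= - ln (1 - e) + ln (k%:R / e) * \1_U z.
  rewrite /code_weight indicE; case: ifP => _; rewrite ?mulr1 ?mulr0 ?addr0//.
  by rewrite -lnV ?posrE ?divr_gt0// invf_div; lra.
pose g (z : X) : \bar R := (2 * neglog z + ln (k%:R / e) * \1_U z)%:E.
have g0 z : (0 <= g z)%E by rewrite lee_fin addr_ge0// mulr_ge0// neglog_ge0.
have mg : measurable_fun [set: X] g.
  apply/measurable_EFinP; apply: measurable_funD; apply: measurable_funM => //.
  exact: measurable_neglog.
have intg : (\int[mu]_x g x <= (2 * I + ln (k%:R / e) * e2)%:E)%E.
  have mnl : measurable_fun [set: X] (fun x : X => (neglog x)%:E).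
    by apply/measurable_EFinP; exact: measurable_neglog.
  have mi : measurable_fun [set: X] (fun x : X => (\1_U x : R)%:E).
    by apply/measurable_EFinP; exact: measurable_indic.
  under eq_integral do rewrite /g EFinD !EFinM.
  have m1 : measurable_fun [set: X] (fun x : X => 2%:E * (neglog x)%:E)%E.
    exact: measurable_funeM.
  have m2 : measurable_fun [set: X] (fun x : X => (ln (k%:R / e))%:E * (\1_U x : R)%:E)%E.
    exact: measurable_funeM.
  have nn1 x : (0 <= 2%:E * (neglog x)%:E)%E by rewrite -EFinM lee_fin mulr_ge0// neglog_ge0.
  have nn2 (x : X) : (0 <= (ln (k%:R / e))%:E * (\1_U x : R)%:E)%E by rewrite -EFinM lee_fin mulr_ge0.
  rewrite ge0_integralD// ge0_integralZl//; last by move=> x _; rewrite lee_fin neglog_ge0.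
  rewrite ge0_integralZl// integral_indic// setIT.
  rewrite (_ : (2 * I + _)%:E = 2%:E * I%:E + (ln (k%:R / e))%:E * e2%:E)%E//.
  by apply: leeD; apply: lee_wpmul2l => //; rewrite lee_fin.
pose K : R := - ln kap - ln eta - n%:R * ln (1 - kap).
have nk0 : 0 <= n%:R * ln k%:R :> R by exact: mulr_ge0.
have lnkap : ln kap <= 0 by apply: ln_le0; exact: ltW.
have lneta : ln eta <= 0 by exact: ln_le0.
have K0 : 0 <= K by have := mulr_ge0_le0 n0' ln1k; rewrite /K; lra.
have ln4 : 0 <= ln 4 :> R by apply: ln_ge0; lra.
have A0 : 0 <= ln 4 + K - n%:R * ln (1 - e) by have := mulr_ge0_le0 n0' ln1e; lra.
pose h (x : X) : \bar R := ((ln 4 + K - n%:R * ln (1 - e))%:E +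
  ((n%:R * ln k%:R : R) * \1_(~` G) x)%:E + \sum_(j < n) g (iter j T x))%E.
have mgj j : measurable_fun [set: X] (fun x => g (iter j T x)).
  by apply: (measurableT_comp mg); exact: measurable_iter.
have m1 : measurable_fun [set: X] (fun x : X => ((n%:R * ln k%:R : R) * \1_(~` G) x)%:E).
  by apply/measurable_EFinP; apply: measurable_funM => //; exact: measurable_indic.
have s0 x : (0 <= \sum_(j < n) g (iter j T x))%E by exact: sume_ge0.
have h1 x : (0 <= ((n%:R * ln k%:R : R) * \1_(~` G) x)%:E)%E.
  by rewrite lee_fin mulr_ge0.
have mh : measurable_fun [set: X] h.
  apply: emeasurable_funD; first exact: emeasurable_funD.
  exact: emeasurable_sum.
have h0 x : (0 <= h x)%E by rewrite !adde_ge0.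
have inth : (\int[mu]_x h x <= (ln 4 + n%:R * ln k%:R * ((n%:R + 1) * (6 * C * eta)) + K
    + n%:R * (2 * I) - n%:R * ln (1 - e) + n%:R * (ln (k%:R / e) * e2))%:E)%E.
  rewrite ge0_integralD//; last 3 first.
  - by move=> x _; rewrite adde_ge0.
  - exact: emeasurable_funD.
  - exact: emeasurable_sum.
  rewrite ge0_integralD// integral_cst//= probability_setT mule1.
  rewrite (_ : _ + _ + K + _ - _ + _ = (ln 4 + K - n%:R * ln (1 - e)) +
     (n%:R * ln k%:R * ((n%:R + 1) * (6 * C * eta))) +
     n%:R * (2 * I + ln (k%:R / e) * e2)); last by ring.
  rewrite [leRHS]EFinD [X in (_ <= X + _)%E]EFinD.
  apply: leeD; first apply: leeD => //.
    under eq_integral do rewrite EFinM.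
    rewrite ge0_integralZl//; last by apply/measurable_EFinP; exact: measurable_indic.
    rewrite integral_indic// setIT [leRHS]EFinM; apply: lee_wpmul2l => //.
  rewrite ge0_integral_sum//.
  apply: (@le_trans _ _ (\sum_(j < n) (2 * I + ln (k%:R / e) * e2)%:E)%E).
    by apply: lee_sum => j _; rewrite (integral_iter j mT inv mg g0).
  by rewrite sumEFin sumr_const card_ord lee_fin -[_ *+ n]mulr_natl.
have main w x : iterated_join T Q w x -> ((- ln (N w))%:E <= h x)%E.
  move=> Jx; have [Gx|nGx] := pselect (G x); last first.
    apply: (@le_trans _ _ ((ln 4 + K - n%:R * ln (1 - e)) + n%:R * ln k%:R)%:E); last first.
      by rewrite /h indicE mem_set// mulr1 -EFinD leeDl.
    rewrite lee_fin.
    have H : k%:R^-1 ^+ n / 2 <= N w by exact: NB.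
    have kn0 : 0 < k%:R^-1 ^+ n / 2 :> R by rewrite divr_gt0// exprn_gt0// invr_gt0.
    have := H; rewrite -ler_ln ?posrE// lnM ?posrE ?invr_gt0 ?exprn_gt0 ?invr_gt0//.
    rewrite lnXn ?invr_gt0// !lnV ?posrE// mulNrn -mulr_natl.
    have : ln 2 <= ln 4 :> R by rewrite ler_ln ?posrE//; lra.
    by have := mulr_ge0_le0 n0' ln1e; lra.
  have rP := @radius_bnd eta kap n x eta0 kap01 Gx; have /andP[r0 r1] := rP.
  have core0 (j : 'I_n) : 0 < `|iter j T x| <= 1.
    by apply: (core_norm eta0); apply: Gx; exact: ltnW.
  have := NG w x Gx Jx.
  rewrite -/U; set P := \prod_(j < n) _ => H.
  have P0 : 0 < P by apply: prodr_gt0 => j _; exact: c0.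
  have lnP : - ln P <= - (n%:R * ln (1 - e)) + \sum_(j < n) ln (k%:R / e) * \1_U (iter j T x).
    rewrite /P ln_prodr; last by move=> j; exact: c0.
    rewrite -sumrN; apply: (@le_trans _ _ (\sum_(j < n) (- ln (1 - e) + ln (k%:R / e) * \1_U (iter j T x)))).
      by apply: ler_sum => j _; exact: clog.
    by rewrite big_split/= sumr_const card_ord lerD2r mulNrn -[_ *+ n]mulr_natl.
  have lnr : - ln (radius eta kap n x) = K + \sum_(j < n) 2 * neglog (iter j T x).
    have q0 : 0 < (1 - kap) ^+ n by rewrite exprn_gt0// subr_gt0.
    have p0 (j : 'I_n) : 0 < `|iter j T x| ^+ 2.
      by rewrite exprn_gt0//; have /andP[] := core0 j.
    rewrite /radius lnM ?posrE ?mulr_gt0//; last exact: prodr_gt0.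
    rewrite lnM ?posrE ?mulr_gt0// lnM ?posrE// lnXn ?subr_gt0// ln_prodr//.
    rewrite /K (_ : \sum_(j < n) ln _ = - \sum_(j < n) 2 * neglog (iter j T x)).
      by rewrite -[_ *+ n]mulr_natl; ring.
    rewrite -sumrN; apply: eq_bigr => j _; have /andP[j0 j1] := core0 j.
    by rewrite lnXn// neglogE// mulrN opprK mulr_natl.
  have {}H : ln (radius eta kap n x) + ln P - ln 4 <= ln (N w).
    move: r0 P0 H; move: (radius eta kap n x) (P) => r p r0 p0 H.
    by rewrite -lnM ?posrE// -ln_div ?posrE ?mulr_gt0// ler_ln ?posrE ?divr_gt0 ?mulr_gt0.
  rewrite /h indicE memNset ?mulr0 ?adde0; last by move=> /(_ Gx).
  rewrite sumEFin -EFinD lee_fin big_split/=.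
  by move: H lnP lnr; lra.
rewrite -lee_fin.
apply: le_trans inth.
apply: (@le_trans _ _ (\sum_w Pr (iterated_join T Q w) * - ln (N w))%:E).
  rewrite lee_fin; apply: gibbs_join => //; first by move=> w; exact: ltW.
apply: le_sum_integral => //.
- by move=> w; exact: measurable_join.
- exact: trivIset_join.
- exact: cover_join.
- by move=> w; rewrite oppr_ge0 ln_le0.
Qed.

Lemma ln_1sub_ge (e : R) : 0 <= e <= 2^-1 -> - (2 * e) <= ln (1 - e).
Proof.
move=> /andP[e0 e1]; have e2 : 0 < 1 - e by lra.
have := @le_ln1Dx R (e / (1 - e)).
have -> : 1 + e / (1 - e) = (1 - e)^-1 by field; rewrite gt_eqF.
rewrite lnV ?posrE// => H.
have h : e / (1 - e) <= 2 * e.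
  by rewrite ler_pdivrMr// -subr_ge0 (_ : _ - _ = e * (1 - 2 * e)); [apply: mulr_ge0; lra | ring].
have : - ln (1 - e) <= e / (1 - e) by apply: H; apply: (@lt_le_trans _ _ 0); [lra|rewrite divr_ge0//; lra].
by lra.
Qed.

Lemma expR_decay (e : R) (n : nat) : 0 < e -> (0 < n)%N ->
  (n%:R + 1) * expR (- (e * n%:R)) <= 8 / (e ^+ 2) / n%:R.
Proof.
move=> e0 n0; have n0' : 1 <= n%:R :> R by rewrite ler1n.
have t0 : 0 < e * n%:R / 2 by rewrite divr_gt0// mulr_gt0//; lra.
have h : (e * n%:R / 2) ^+ 2 <= expR (e * n%:R).
  have -> : expR (e * n%:R) = expR (e * n%:R / 2) ^+ 2 by rewrite -expRM_natl; congr expR; field.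
  apply: lerXn2r; rewrite ?nnegrE ?expR_ge0 ?(ltW t0)//.
  by apply: le_trans (expR_ge1Dx _); lra.
have h2 : expR (- (e * n%:R)) <= ((e * n%:R / 2) ^+ 2)^-1.
  by rewrite expRN lef_pV2 ?posrE ?expR_gt0 ?exprn_gt0.
apply: (@le_trans _ _ ((2 * n%:R) * ((e * n%:R / 2) ^+ 2)^-1)).
  by apply: ler_pM; [lra | exact: expR_ge0 | lra | exact: h2].
rewrite le_eqVlt; apply/orP; left; apply/eqP; field.
by rewrite !gt_eqF//; lra.
Qed.

Lemma entropy_of_partition_le (I : R) : (\int[mu]_x (neglog x)%:E <= I%:E)%E ->
  entropy_of_partition mu T Q <= 2 * I.
Proof.
move=> intI; apply/ler_addgt0Pr => dl dl0.
have [mQ tQ cQ] := pQ.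
have k0 : 0 < k%:R :> R.
  rewrite ltr0n lt0n; apply/eqP => k0; move: (Q) cQ; rewrite k0 => Q' cQ'.
  by have : setT (0 : X) by []; rewrite -cQ' => -[[]].
have k1 : 1 <= k%:R :> R by rewrite ler1n -(ltr0n R).
have lnk : 0 <= ln k%:R :> R by exact: ln_ge0.
(* With [kap = e], seven errors of size [e * n] will occur: one from [ln 4 - ln kap], one from
   [- ln eta], two from each of the terms in [ln (1 - kap)] and [ln (1 - e)], one from [good_set].
   They use [dl / 2]; the visits to the exceptional set use the other half. *)
pose e : R := Num.min 2^-1 (dl / 14).
have e0 : 0 < e by rewrite lt_min; apply/andP; split; lra.
have e12 : e <= 2^-1 by rewrite ge_min lexx.
have e14 : e <= dl / 14 by rewrite ge_min lexx orbT.
have e1 : e < 1 by lra.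
have ke1 : 1 <= k%:R / e by rewrite ler_pdivlMr//; lra.
have lnke : 0 <= ln (k%:R / e) by exact: ln_ge0.
pose e2 : R := dl / 2 / (ln (k%:R / e) + 1).
have e20 : 0 < e2 by rewrite !divr_gt0//; lra.
have e2P : ln (k%:R / e) * e2 <= dl / 2.
  rewrite /e2 mulrA ler_pdivrMr; last by lra.
  by rewrite mulrC ler_pM2l; lra.
have [d' [E [d'0 mE EQ sepE muE]]] := separated_approximation C0 e20 acip_itv11 muC pQ.
pose d := d' / 2.
have d0 : 0 < d by rewrite divr_gt0.
have sep2 i l x y : i != l -> E i x -> E l y -> 2 * d <= `|x - y|.
  by move=> il Ex Ey; rewrite /d mulrCA divff// mulr1; exact: sepE il Ex Ey.
apply: limr_le; first exact: is_cvg_entropy.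
have ln1 := @ln_1sub_ge e ltac:(by rewrite (ltW e0) e12).
pose D8 := 8 / e ^+ 2.
have D80 : 0 < D8 by rewrite divr_gt0// exprn_gt0.
near=> n.
have n0 : (0 < n)%N by near: n; exact: nbhs_infty_gt.
have n0' : 0 < n%:R :> R by rewrite ltr0n.
have nA : (ln 4 - ln e) / e <= n%:R by near: n; exact: nbhs_infty_ger.
have nB : D8 / d < n%:R by near: n; exact: nbhs_infty_gtr.
have nC : ln k%:R * (6 * C) * D8 / e <= n%:R by near: n; exact: nbhs_infty_ger.
(* This [eta] is small enough to beat the union bound over [n + 1] times, multiplied by the code
   length [n * ln k], while [- ln eta = e * n] stays a small fraction of [n]. *)
pose eta := expR (- (e * n%:R)).
have eta0 : 0 < eta by exact: expR_gt0.
have en0 : 0 < e * n%:R by exact: mulr_gt0.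
have eta1 : eta <= 1 by rewrite /eta -[leRHS]expR0 ler_expR; lra.
have dec := expR_decay e0 n0; rewrite -/eta -/D8 in dec.
have etad : e * eta < d.
  have h1 : D8 / n%:R < d by rewrite ltr_pdivrMr// mulrC -ltr_pdivrMr.
  have h2 : 0 <= n%:R * eta by rewrite mulr_ge0// ltW.
  have h3 : e * eta <= eta by rewrite ger_pMl// ltW.
  by apply: le_lt_trans h1; lra.
have := @entropy_bound_at e e2 d eta e E n I ltac:(by rewrite e0 e1)
  ltac:(by rewrite eta0 eta1) ltac:(by rewrite e0 e1) etad intI mE EQ sep2 muE.
rewrite /eta expRK -/eta => H.
rewrite ler_pdivrMr//; apply: (le_trans H).
have hA : ln 4 - ln e <= e * n%:R by move: nA; rewrite ler_pdivrMr// mulrC.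
have hC : n%:R * ln k%:R * ((n%:R + 1) * (6 * C * eta)) <= e * n%:R.
  have h1 : ln k%:R * (6 * C) * D8 <= e * n%:R by move: nC; rewrite ler_pdivrMr// [n%:R * e]mulrC.
  apply: le_trans h1.
  rewrite (_ : _ * _ = (n%:R * (ln k%:R * (6 * C))) * ((n%:R + 1) * eta)); last by ring.
  apply: (@le_trans _ _ (n%:R * (ln k%:R * (6 * C)) * (D8 / n%:R))).
    by apply: ler_wpM2l => //; rewrite !mulr_ge0// ltW.
  by rewrite le_eqVlt; apply/orP; left; apply/eqP; field; rewrite gt_eqF.
have hL : - (n%:R * ln (1 - e)) <= 2 * e * n%:R.
  by rewrite -mulrN mulrC ler_pM2r//; lra.
have hE : n%:R * (ln (k%:R / e) * e2) <= dl / 2 * n%:R by rewrite mulrC ler_pM2r.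
have h14 : e * n%:R <= dl / 14 * n%:R by rewrite ler_pM2r.
rewrite !opprK.
rewrite (_ : (2 * I + dl) * n%:R = n%:R * (2 * I) + 7 * (dl / 14 * n%:R) + dl / 2 * n%:R); last by field.
move: hA hC hL hE h14.
set A := n%:R * ln k%:R * _; set B := n%:R * ln (1 - e); set C' := n%:R * (ln _ * _).
by lra.
Unshelve. all: by end_near. Qed.

End UpperBound.

(** * Rokhlin's formula, lower bound *)

Lemma pow2_decay (R : realType) (m : nat) : 2^-1 ^+ m * (m%:R + 2) <= 8 / (m%:R + 2) :> R.
Proof.
have m0 : 0 < m%:R + 2 :> R by rewrite ltr_wpDl.
rewrite ler_pdivlMr// exprVn -mulrA ler_pdivrMl ?exprn_gt0// -expr2.
have -> : m%:R + 2 = (m + 2)%N%:R :> R by rewrite natrD.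
rewrite -!natrX -natrM ler_nat mulnC.
elim: m {m0} => [//|[//|m] IH].
by move: IH; rewrite !expnS; lia.
Qed.

(** Telescoping: [1 / t ^ 2 <= 1 / (t ^ 2 - 1/4) = 1 / (t - 1/2) - 1 / (t + 1/2)]. *)
Lemma sum_inv_sq (R : realType) (n : nat) :
  \sum_(0 <= m < n) (m.+1%:R ^+ 2)^-1 <= 2 - (n%:R + 2^-1)^-1 :> R.
Proof.
elim: n => [|n IH]; first by rewrite big_geq// add0r invrK; lra.
rewrite big_nat_recr//= -natr1; set t : R := n%:R + 1.
have t1 : 1 <= t by rewrite lerDr.
have E1 : (t - 2^-1)^-1 - (t + 2^-1)^-1 = (t ^+ 2 - 4^-1)^-1.
  by field; rewrite !gt_eqF//; nra.
have : (t ^+ 2)^-1 <= (t ^+ 2 - 4^-1)^-1.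
  by rewrite lef_pV2 ?posrE; nra.
move: IH; rewrite (_ : n%:R + 2^-1 = t - 2^-1); last by rewrite /t; field.
by rewrite -E1; lra.
Qed.

Lemma small_tail (R : realType) (C c e : R) : 0 < C -> 0 <= c -> 0 < e ->
  exists2 m : nat, 2 * (2 * C * 2^-1 ^+ m * (m%:R + 2)) + c * (2 * C * 2^-1 ^+ m) <= e / 2 & (2 <= m)%N.
Proof.
move=> C0 c0 e0; have h1 : (0 <= 2^-1 :> R) by rewrite invr_ge0.
pose K := (4 * C + 2 * C * c) * 16 / e.
have Cl : 0 <= C * c by apply: mulr_ge0 => //; exact: ltW.
have K0 : 0 <= K by rewrite /K divr_ge0 ?(ltW e0)// mulr_ge0//; lra.
exists (Num.truncn K).+2 => //; set m := (Num.truncn K).+2.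
have mK : K <= m%:R + 2.
  have /andP[_ h] := truncn_itv K0; apply: ltW; apply: (lt_le_trans h).
  by rewrite -(natrD _ _ 2) ler_nat /m addn2; lia.
have m0 : 0 < m%:R + 2 :> R by rewrite ltr_wpDl.
pose p : R := 2^-1 ^+ m * (m%:R + 2).
have pd : p <= 8 / (m%:R + 2) by exact: pow2_decay.
have pp : 2^-1 ^+ m <= p.
  by rewrite /p ler_peMr ?exprn_ge0//; have : 0 <= m%:R :> R by []; lra.
have p8 : (4 * C + 2 * C * c) * (8 / (m%:R + 2)) <= e / 2.
  move: mK; rewrite /K ler_pdivrMr// => mK.
  by rewrite mulrA ler_pdivrMr//; lra.
apply: le_trans p8.
apply: (@le_trans _ _ ((4 * C + 2 * C * c) * p)).
  have : (C * c) * 2^-1 ^+ m <= (C * c) * p by exact: ler_wpM2l.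
  by rewrite /p; lra.
by apply: ler_wpM2l => //; lra.
Qed.

Lemma expR_small (R : realType) (m : nat) (ep : R) : 0 < ep ->
  exists M : nat, expR (- (M%:R * ep)) < 2^-1 ^+ m.
Proof.
move=> ep0; exists (Num.truncn (m%:R / ep)).+1.
apply: (@lt_le_trans _ _ (expR (- m%:R))).
  rewrite ltr_expR ltrN2 -ltr_pdivrMr//.
  by have /andP[] := @truncn_itv R (m%:R / ep) (divr_ge0 (ler0n _ _) (ltW ep0)).
rewrite expRN exprVn lef_pV2 ?posrE ?expR_gt0 ?exprn_gt0//.
rewrite -[m%:R]mulr1 expRM_natl; apply: lerXn2r; rewrite ?nnegrE ?expR_ge0//.
by apply: le_trans (expR_ge1Dx 1).
Qed.

Lemma integral_le_sum d (X : measurableType d) (R : realType) (P : probability X R)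
    (I : finType) (F : I -> set X) (g : I -> R) (h : X -> \bar R) :
  (forall i, measurable (F i)) ->
  (forall i, 0 <= g i) -> (forall x, 0 <= h x)%E -> measurable_fun setT h ->
  (forall x, h x <= \sum_i (g i * \1_(F i) x)%:E)%E ->
  (\int[P]_x h x <= (\sum_i fine (P (F i)) * g i)%:E)%E.
Proof.
move=> mF g0 h0 mh hg.
have -> : ((\sum_i fine (P (F i)) * g i)%:E
    = \int[P]_x (\sum_i (g i * \1_(F i) x)%:E)%E)%E.
  rewrite ge0_integral_sum//; last 2 first.
  - move=> i; apply/measurable_EFinP; apply: measurable_funM => //.
  - by move=> i x _; rewrite lee_fin mulr_ge0.
  rewrite -sumEFin; apply: eq_bigr => i _.
  under eq_integral do rewrite EFinM.
  rewrite ge0_integralZl//; last 2 first.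
  - by apply/measurable_EFinP.
  - by rewrite lee_fin.
  by rewrite integral_indic// setIT EFinM muleC; congr (_ * _)%E; rewrite fineK// fin_num_measure.
apply: ge0_le_integral => //.
apply: emeasurable_sum => i; apply/measurable_EFinP.
by apply: measurable_funM.
Qed.

Section LowerBound.
Context {R : realType}.
Let X := measurableTypeR R.
Local Notation leb := (@lebesgue_measure R).
Variables (a C : R) (mu : probability X R).
Hypotheses (a01 : 0 < a <= 1) (C0 : 0 < C).
Hypothesis mua : is_acip a mu.
Hypothesis muC : forall A, measurable A -> (mu A <= C%:E * leb A)%E.
Let T : X -> X := Talpha a.
Let Pr (A : set X) : R := fine (mu A).
Let D : set X := `[-1, 1]%classic.

Let inv A : measurable A -> mu (T @^-1` A) = mu A.
Proof. by case: mua => _ + _; apply. Qed.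

Let mT : measurable_fun setT T. Proof. exact: measurable_Talpha. Qed.

Let mD : measurable D. Proof. exact: measurable_itv. Qed.

Let TD x : D (T x).
Proof.
have /andP[h1 h2] := Talpha_itv a x; case/andP: a01 => h3 h4.
by rewrite /D/= in_itv/=; apply/andP; split; rewrite /T; lra.
Qed.

Let muDC : mu (~` D) = 0%E.
Proof. by rewrite probability_setC// (acip_itv11 a01 mua) subee. Qed.

Lemma pr_le_leb A : measurable A -> (mu A <= C%:E * leb (D `&` A))%E.
Proof.
move=> mA; have mDA : measurable (D `&` A) by exact: measurableI.
apply: le_trans (muC mDA).
have mDC : measurable (~` D) by exact: measurableC.
rewrite -(measureU0 mDA mDC muDC).
apply: le_measure; rewrite ?inE//; first exact: measurableU.
by move=> x Ax; have [Dx|Dx] := pselect (D x); [left|right].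
Qed.

(** A letter [i] contracts Lebesgue measure by [s i], so a cylinder has Lebesgue measure at most
    [2 * \prod s], where 2 is the length of [D], and [mu]-measure at most [C] times that. After
    taking [- ln] and averaging, the constant [ln (2 * C)] disappears on division by [n]. *)
Lemma entropy_ge_of_weights (k : nat) (Q : 'I_k -> set X) (s : 'I_k -> R) :
  is_partition Q -> (forall i, 0 < s i) ->
  (forall i E, measurable E -> (leb (D `&` Q i `&` T @^-1` E) <= (s i)%:E * leb E)%E) ->
  \sum_i Pr (Q i) * - ln (s i) <= entropy_of_partition mu T Q.
Proof.
move=> pQ s0 sQ; have [mQ tQ cQ] := pQ.
pose J n w := @iterated_join _ X T _ Q n w.
have mJ n w : measurable (J n w) by exact: measurable_join.
have lebJ n (w : {ffun 'I_n -> 'I_k}) : (leb (D `&` J n w) <= (2 * \prod_(j < n) s (w j))%:E)%E.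
  elim: n w => [|n IH] w.
    rewrite big_ord0 mulr1; apply: (@le_trans _ _ (leb D)); first exact: measureIl.
    rewrite /D lebesgue_measure_itv/= lte_fin ifT; last by lra.
    by rewrite -EFinB lee_fin; lra.
  pose v : {ffun 'I_n -> 'I_k} := [ffun j => w (lift ord0 j)].
  have mDJ : measurable (D `&` J n v) by exact: measurableI.
  apply: (@le_trans _ _ (leb (D `&` Q (w ord0) `&` T @^-1` (D `&` J n v)))).
    apply: le_measure; rewrite ?inE; first exact: measurableI.
      apply: measurableI; first exact: measurableI.
      by apply: (measurable_preimT mT).
    move=> x [Dx Jx]; split; first by split => //; exact: (Jx ord0).
    split; first exact: TD.
    by move=> j; rewrite ffunE -iterSr; exact: (Jx (lift ord0 j)).
  apply: (le_trans (sQ _ _ mDJ)).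
  apply: (le_trans (lee_wpmul2l _ (IH v))); first by rewrite lee_fin ltW.
  rewrite -EFinM lee_fin big_ord_recl mulrCA.
  by under eq_bigr do rewrite ffunE.
have HJ n : - ln (2 * C) + n%:R * (\sum_i Pr (Q i) * - ln (s i)) <=
    partition_entropy mu (@iterated_join _ X T _ Q n).
  have sumP : \sum_(w : {ffun 'I_n -> 'I_k}) Pr (J n w) = 1.
    have := pr_cover mu (fun w : {ffun 'I_n -> 'I_k} => measurable_join mT pQ w) (@trivIset_join _ X T _ Q pQ n) (@cover_join _ X T _ Q pQ n) measurableT.
    under eq_bigr do rewrite setIT.
    by move=> ->; rewrite probability_setT.
  have -> : - ln (2 * C) + n%:R * (\sum_i Pr (Q i) * - ln (s i)) =
      \sum_(w : {ffun 'I_n -> 'I_k}) Pr (J n w) * (- ln (2 * C) - \sum_(j < n) ln (s (w j))).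
    under [RHS]eq_bigr do rewrite mulrDr.
    rewrite big_split/= -mulr_suml sumP mul1r; congr (_ + _).
    under [RHS]eq_bigr do rewrite -sumrN mulr_sumr.
    rewrite exchange_big/=.
    under [RHS]eq_bigr => j _ do rewrite (sum_join_marginal mT inv pQ (fun i => - ln (s i)) j).
    by rewrite sumr_const card_ord mulr_natl.
  apply: ler_sum => w _; rewrite -mulrN.
  have [p0|] := ltP 0 (Pr (J n w)); last first.
    move=> pj; have z0 : Pr (J n w) = 0 by apply/eqP; rewrite eq_le pj fine_ge0.
    by rewrite -[fine (mu _)]/(Pr (J n w)) z0 !mul0r.
  rewrite ler_pM2l// lerNr opprB opprK addrC.
  have P0 : 0 < \prod_(j < n) s (w j) by exact: prodr_gt0.
  have : Pr (J n w) <= (2 * C) * \prod_(j < n) s (w j).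
    rewrite -lee_fin /Pr fineK ?fin_num_measure//.
    apply: (le_trans (pr_le_leb (mJ n w))).
    apply: (le_trans (lee_wpmul2l _ (lebJ n w))); first by rewrite lee_fin ltW.
    by rewrite -EFinM lee_fin mulrCA mulrA.
  rewrite -ler_ln ?posrE ?mulr_gt0// lnM ?posrE ?mulr_gt0// ln_prodr//.
apply/ler_addgt0Pr => e e0; rewrite -lerBlDr.
apply: limr_ge; first exact: is_cvg_entropy.
near=> n.
have n0 : 0 < n%:R :> R by rewrite ltr0n; near: n; exact: nbhs_infty_gt.
have nC : ln (2 * C) / e <= n%:R by near: n; exact: nbhs_infty_ger.
rewrite ler_pdivlMr//; apply: le_trans (HJ n).
have : ln (2 * C) <= n%:R * e by rewrite -ler_pdivrMr.
by rewrite mulrBl mulrC; lra.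
Unshelve. all: by end_near. Qed.

Definition branch (sg : bool) (b : int) : set X :=
  [set x : X | [&& x != 0, (0 < x) == sg & Num.floor (`|x^-1| + 1 - a) == b]].

Lemma measurable_branch sg b : measurable (branch sg b).
Proof.
have m2 : measurable [set x : X | (0 < x) == sg].
  case: sg; [rewrite (_ : [set _ | _] = `]0, +oo[%classic)|rewrite (_ : [set _ | _] = `]-oo, 0]%classic)]; try exact: measurable_itv.
    by apply/seteqP; split => x; rewrite /= in_itv/= andbT; [move/eqP|move=> ->].
  by apply/seteqP; split => x; rewrite /= in_itv/= leNgt; [move/eqP => ->|move/negbTE ->].
have m3 : measurable [set x : X | Num.floor (`|x^-1| + 1 - a) == b].
  pose g (x : X) : X := (Num.floor (`|x^-1| + 1 - a))%:~R.
  have mg : measurable_fun [set: X] g.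
    apply: (measurableT_comp measurable_floor).
    apply: measurable_funB => //; apply: measurable_funD => //.
    by apply: (measurableT_comp (@normr_measurable R setT)); exact: measurable_inv.
  rewrite (_ : [set _ | _] = g @^-1` [set b%:~R]).
    by apply: (measurable_preimT mg); exact: measurable_set1.
  apply/seteqP; split => x /=; first by move=> /eqP; rewrite /g => ->.
  by rewrite /g => /eqP; rewrite eqr_int.
have m4 : measurable [set x : X | x != 0].
  rewrite (_ : [set _ | _] = ~` [set 0] :> set X); first by apply: measurableC; exact: measurable_set1.
  by apply/seteqP; split => x /= /eqP.
rewrite (_ : branch sg b = [set x : X | x != 0] `&`
   [set x : X | (0 < x) == sg] `&` [set x : X | Num.floor (`|x^-1| + 1 - a) == b]).
  by do 2 (apply: measurableI => //).
apply/seteqP; split => x; rewrite /branch /=; first by move=> /and3P[].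
by move=> [[-> ->] ->].
Qed.

(** On a branch [T] is [|1/x|] minus a constant, and [x], [y] have the same sign. *)
Lemma branch_dist sg b (x y : X) : branch sg b x -> branch sg b y ->
  `|x - y| = `|x| * `|y| * `|T x - T y|.
Proof.
move=> /and3P[x0 /eqP sx /eqP fx] /and3P[y0 /eqP sy /eqP fy].
have {}x0 : 0 < `|x| by rewrite normr_gt0.
have {}y0 : 0 < `|y| by rewrite normr_gt0.
have -> : T x - T y = `|x^-1| - `|y^-1|.
  by rewrite /T /Talpha fx fy; ring.
have -> : `|x^-1| - `|y^-1| = (`|y| - `|x|) / (`|x| * `|y|).
  by rewrite !normfV; field; rewrite !gt_eqF.
have -> : `|x - y| = `| `|y| - `|x| |.
  rewrite distrC; case: (sg) sx sy => sx sy.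
    by rewrite (gtr0_norm sx) (gtr0_norm sy).
  have {}sx : x <= 0 by rewrite leNgt sx.
  have {}sy : y <= 0 by rewrite leNgt sy.
  by rewrite (ler0_norm sx) (ler0_norm sy) -opprD normrN.
by rewrite normrM normfV (gtr0_norm (mulr_gt0 x0 y0)) mulrCA divff ?mulr1// gt_eqF// mulr_gt0.
Qed.

(** Here [1 / |x| = m + 2 + T x] with [T x >= a - 1 > -1]. *)
Lemma branch_bound sg (m : nat) (x : X) : branch sg m.+2%:Z x -> 0 < `|x| <= m.+1%:R^-1.
Proof.
move=> /and3P[x0 _ /eqP fl]; have n0 : 0 < `|x| by rewrite normr_gt0.
rewrite n0/= -[leLHS]invrK lef_pV2 ?posrE ?invr_gt0//.
have := @Talpha_int R a x; rewrite fl => TE.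
have /andP[h1 _] := Talpha_itv a x; rewrite normfV in TE.
rewrite -natr1; case/andP: a01 => h3 h4.
move: TE; rewrite (_ : m.+2%:Z%:~R = m%:R + 2 :> R); first by lra.
by rewrite -pmulrn -!natr1; ring.
Qed.

(** This allows the infinitely many branches near 0 to form a single atom: the branch of digit
    [m + 2] contracts by [1 / (m + 1) ^ 2], and these numbers, over both signs, add up to at most
    4. *)
Lemma leb_small_branches (r : R) (E : set X) : r <= 3^-1 -> measurable E ->
  (leb ([set x : X | (`|x| <= r)%R] `&` T @^-1` E) <= 4%:E * leb E)%E.
Proof.
move=> r3 mE.
pose B (m : nat) (sg : bool) : set X := branch sg m.+2%:Z.
have mB m sg : measurable (B m sg) by exact: measurable_branch.
have lebB m sg : (leb (B m sg `&` T @^-1` E) <= ((m.+1%:R ^+ 2)^-1)%:E * leb E)%E.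
  apply: (lebesgue_contraction (mB m sg) mT) => //.
  move=> x y Bx By; rewrite (branch_dist Bx By) ler_wpM2r// -exprVn expr2.
  have /andP[_ xm] := branch_bound Bx; have /andP[_ ym] := branch_bound By.
  exact: ler_pM.
have cover : [set x : X | `|x| <= r] `&` T @^-1` E `<=`
    [set 0] `|` \bigcup_m ((B m true `&` T @^-1` E) `|` (B m false `&` T @^-1` E)).
  move=> x [/= xr Ex]; have [->|x0] := eqVneq x 0; first by left.
  right.
  have n0 : 0 < `|x| by rewrite normr_gt0.
  have x3 : 3 <= `|x^-1| by rewrite normfV -[leLHS]invrK lef_pV2 ?posrE ?invr_gt0// (le_trans xr).
  have fl2 : 2 <= Num.floor (`|x^-1| + 1 - a).
    by rewrite floor_ge_int (_ : 2%:~R = 2 :> R)//; case/andP: a01 => h3 h4; lra.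
  have [m flm] : exists m : nat, Num.floor (`|x^-1| + 1 - a) = m.+2%:Z.
    by case: (Num.floor _) fl2 => // -[|[|m]]// _; exists m.
  exists m => //; case: (ltP 0 (x : R)) => x00; [left|right]; split => //.
    by rewrite /B /branch/= x0 x00 flm !eqxx.
  by rewrite /B /branch/= x0 flm ltNge x00 !eqxx.
have mBT m sg : measurable (B m sg `&` T @^-1` E).
  by apply: measurableI => //; exact: measurable_preimT.
have mBB m : measurable ((B m true `&` T @^-1` E) `|` (B m false `&` T @^-1` E)).
  exact: measurableU.
have mcup : measurable (\bigcup_m ((B m true `&` T @^-1` E) `|` (B m false `&` T @^-1` E))).
  exact: bigcup_measurable.
have mL : measurable ([set x : X | `|x| <= r] `&` T @^-1` E).
  apply: measurableI; last exact: measurable_preimT.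
  rewrite (_ : [set _ | _] = `[- r, r]%classic); first exact: measurable_itv.
  by apply/seteqP; split => x; rewrite /= in_itv/= ler_norml.
apply: (@le_trans _ _ (leb (\bigcup_m ((B m true `&` T @^-1` E) `|` (B m false `&` T @^-1` E))))).
  have m01 : measurable ([set 0] : set X) by exact: measurable_set1.
  have leb0 : leb ([set 0] : set X) = 0%E by exact: lebesgue_measure_set1.
  rewrite -(measureU0 mcup m01 leb0) setUC.
  by apply: le_measure; rewrite ?inE//; exact: measurableU.
apply: (@le_trans _ _ (\sum_(0 <= m <oo) leb ((B m true `&` T @^-1` E) `|` (B m false `&` T @^-1` E)))%E).
  exact: measure_sigma_subadditive.
apply: lime_le; first exact: is_cvg_nneseries.
near=> n.
apply: (@le_trans _ _ (\sum_(0 <= m < n) (2 * (m.+1%:R ^+ 2)^-1)%:E * leb E)%E).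
  apply: lee_sum => m _; apply: (le_trans (measureU2 _ (mBT m true) (mBT m false))).
  rewrite (_ : 2 * _ = (m.+1%:R ^+ 2)^-1 + (m.+1%:R ^+ 2)^-1); last by ring.
  rewrite EFinD ge0_muleDl ?lee_fin ?invr_ge0 ?exprn_ge0//.
  by apply: leeD; exact: lebB.
rewrite -ge0_sume_distrl//.
apply: lee_wpmul2r => //; rewrite sumEFin lee_fin -mulr_sumr.
have : 0 <= (n%:R + 2^-1)^-1 :> R by rewrite invr_ge0 addr_ge0.
by have := sum_inv_sq R n; lra.
Unshelve. all: by end_near. Qed.

Lemma partition_of_symbols (J : finType) (sym : X -> J) :
  (forall v, measurable [set x | sym x = v]) ->
  is_partition (fun i : 'I_#|J| => [set x | sym x = enum_val i]).
Proof.
move=> ms; split => //.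
  apply/trivIsetP => i j _ _ /eqP ij; apply/seteqP; split => // x [/= -> /enum_val_inj].
  exact: ij.
apply/seteqP; split => // x _; exists (enum_rank (sym x)) => //=.
by rewrite enum_rankK.
Qed.

(** The symbol [v0] collects the points too close to 0 for finitely many branches and levels;
    elsewhere the weight is [exp (- 2 lv)], with [lv] below [neglog] by at most [e / 4]. The mesh
    costs [e / 2], the neighbourhood of 0 the other [e / 2]. *)
Lemma entropy_ge_of_symbols (J : finType) (sym : X -> J) (v0 : J) (lv : J -> R)
    (I e : R) (m : nat) :
  (\int[mu]_x (neglog x)%:E = I%:E)%E ->
  2 * (2 * C * 2^-1 ^+ m * (m%:R + 2)) + ln 4 * (2 * C * 2^-1 ^+ m) <= e / 2 ->
  0 < e -> (forall v, 0 <= lv v) ->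
  (forall v, measurable [set x | sym x = v]) ->
  (forall v E, v != v0 -> measurable E ->
    (leb ([set x | sym x = v] `&` T @^-1` E) <= (expR (- (2 * lv v)))%:E * leb E)%E) ->
  (forall E, measurable E -> (leb (D `&` [set x | sym x = v0] `&` T @^-1` E) <= 4%:E * leb E)%E) ->
  (forall x, ~ nball m x -> neglog x <= if sym x == v0 then 0 else lv (sym x) + e / 4) ->
  (D `&` [set x | sym x = v0] `<=` nball m) ->
  exists (k : nat) (Q : 'I_k -> set X), is_partition Q /\
    2 * I - e <= entropy_of_partition mu T Q.
Proof.
move=> intI mP e0 lv0 msym sSome sNone nlE subN.
pose Q (i : 'I_#|J|) := [set x | sym x = enum_val i].
have pQ : is_partition Q by exact: partition_of_symbols.
exists #|J|, Q; split => //.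
have ln4 : 0 <= ln 4 :> R by apply: ln_ge0; lra.
pose s (i : 'I_#|J|) : R := if enum_val i == v0 then 4 else expR (- (2 * lv (enum_val i))).
pose phi (i : 'I_#|J|) : R := if enum_val i == v0 then 0 else lv (enum_val i) + e / 4.
have s0 i : 0 < s i by rewrite /s; case: ifP => _ //; exact: expR_gt0.
have mQ i : measurable (Q i) by exact: msym.
have sQ i E : measurable E -> (leb (D `&` Q i `&` T @^-1` E) <= (s i)%:E * leb E)%E.
  move=> mE; have mTE : measurable (T @^-1` E) by exact: measurable_preimT.
  have mDQ : measurable (D `&` Q i `&` T @^-1` E) by apply: measurableI => //; exact: measurableI.
  rewrite /s; case: ifPn => [/eqP Ev|vn0].
    by rewrite /Q Ev; exact: sNone.
  apply: le_trans (sSome _ _ vn0 mE).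
  apply: le_measure; rewrite ?inE//; first by apply: measurableI => //; exact: msym.
  by move=> x [[_ Qx] Tx].
apply: (le_trans _ (entropy_ge_of_weights pQ s0 sQ)).
have mB : measurable (nball m : set X) by exact: measurable_nball.
have pi0 i : 0 <= phi i.
  by rewrite /phi; case: ifP => _//; rewrite addr_ge0// divr_ge0// ltW.
pose S := \sum_i Pr (Q i) * phi i.
have muB j : (mu (nball j) <= (2 * C * 2^-1 ^+ j)%:E)%E.
  apply: (le_trans (muC (measurable_nball j))).
  have -> : nball j = `](- 2^-1 ^+ j)%R, (2^-1 ^+ j)%R[%classic :> set X.
    by apply/seteqP; split => x; rewrite /nball/= in_itv/= ltr_norml.
  have p0 : 0 < 2^-1 ^+ j :> R by rewrite exprn_gt0// invr_gt0.
  rewrite lebesgue_measure_itv/= lte_fin ifT; last by lra.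
  by rewrite -EFinB -EFinM lee_fin; lra.
have C20 : 0 <= 2 * C by rewrite mulr_ge0// ltW.
have tail := @neglog_tail R mu (2 * C) m C20 (fun j _ => muB j).
have IS : I <= S + 2 * C * 2^-1 ^+ m * (m%:R + 2).
  have mnl : measurable_fun [set: X] (fun x : X => (neglog x)%:E).
    by apply/measurable_EFinP; exact: measurable_neglog.
  have mBC : measurable (~` nball m : set X) by exact: measurableC.
  have mr : measurable_fun [set: X] ((fun x : X => (neglog x)%:E) \_ (~` nball m)).
    by apply/(measurable_restrictT _ mBC)/measurable_funTS.
  have intC : (\int[mu]_(x in ~` nball m) (neglog x)%:E <= S%:E)%E.
    rewrite integral_mkcond; apply: integral_le_sum => //.
      by move=> x; apply: erestrict_ge0 => ? _; rewrite lee_fin neglog_ge0.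
    move=> x; rewrite patchE sumEFin.
    have t0 i : 0 <= phi i * \1_(Q i) x by rewrite mulr_ge0// pi0.
    case: ifPn => [|_]; last by rewrite lee_fin; exact: sumr_ge0.
    rewrite inE => xB; rewrite lee_fin (bigD1 (enum_rank (sym x)))//=.
    apply: (@le_trans _ _ (phi (enum_rank (sym x)) * \1_(Q (enum_rank (sym x))) x)).
      rewrite indicE mem_set; last by rewrite /Q/= enum_rankK.
      by rewrite mulr1 /phi enum_rankK; exact: nlE.
    by rewrite lerDl; apply: sumr_ge0 => i _; exact: t0.
  rewrite -lee_fin -intI EFinD -(setUv (nball m)) ge0_integral_setU//; last 3 first.
  - by rewrite setUv.
  - by move=> x _; rewrite lee_fin neglog_ge0.
  - by apply/disj_set2P; rewrite setICr.
  by rewrite addeC; exact: leeD.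
pose i0 : 'I_#|J| := enum_rank v0.
have PN : Pr (Q i0) <= 2 * C * 2^-1 ^+ m.
  rewrite -lee_fin /Pr fineK ?fin_num_measure//; apply: le_trans (muB m).
  have mDC : measurable (~` D) by exact: measurableC.
  rewrite -(measureU0 mB mDC muDC).
  apply: le_measure; rewrite ?inE//; first exact: measurableU.
  move=> x; rewrite /Q /i0/= enum_rankK => xv.
  by have [Dx|Dx] := pselect (D x); [left; exact: subN|right].
have [_ tQ cQ] := pQ.
have sum1 : \sum_i Pr (Q i) = 1.
  have := pr_cover mu mQ tQ cQ measurableT.
  under eq_bigr do rewrite setIT.
  by move=> ->; rewrite probability_setT.
have Pr0 i : 0 <= Pr (Q i) by rewrite fine_ge0.
have key : 2 * S - 2 * (e / 4) - ln 4 * Pr (Q i0) <= \sum_i Pr (Q i) * - ln (s i).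
  have D1 : \sum_i Pr (Q i) * (ln 4 * (i == i0)%:R) = ln 4 * Pr (Q i0).
    rewrite (bigD1 i0)//= [X in _ + X]big1 ?addr0; first by rewrite eqxx mulr1 mulrC.
    by move=> i /negbTE ->; rewrite !mulr0.
  have D2 : \sum_i Pr (Q i) * (2 * phi i) = 2 * S.
    by rewrite mulr_sumr; apply: eq_bigr => i _; ring.
  have D3 : \sum_i Pr (Q i) * (2 * (e / 4)) = 2 * (e / 4) by rewrite -mulr_suml sum1 mul1r.
  rewrite -D1 -D2 -D3 -!sumrB; apply: ler_sum => i _.
  rewrite -!mulrBr; apply: ler_wpM2l => //.
  rewrite /s /phi /i0; have [Ev|vn0] := eqVneq (enum_val i) v0.
    by rewrite -Ev enum_valK eqxx mulr1; lra.
  rewrite expRK; have -> : (i == enum_rank v0) = false.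
    by apply: contraNF vn0 => /eqP ->; rewrite enum_rankK.
  by rewrite mulr0; lra.
apply: le_trans key.
have : ln 4 * Pr (Q i0) <= ln 4 * (2 * C * 2^-1 ^+ m) by exact: ler_wpM2l.
move: IS mP; set u := 2 * C * _ * _; set v := ln 4 * _; set w := ln 4 * _.
by lra.
Qed.

Lemma entropy_of_partition_ge (I e : R) : (\int[mu]_x (neglog x)%:E = I%:E)%E -> 0 < e ->
  exists (k : nat) (Q : 'I_k -> set X), is_partition Q /\
    2 * I - e <= entropy_of_partition mu T Q.
Proof.
move=> intI e0.
pose ep := e / 4.
have ep0 : 0 < ep by rewrite divr_gt0.
have h1 : (0 <= 2^-1 :> R) by rewrite invr_ge0.
have ln4 : 0 <= ln 4 :> R by apply: ln_ge0; lra.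
have [m mP m2] := small_tail C0 ln4 e0.
have [M MP] := expR_small m ep0.
have Mep0 : 0 < M%:R * ep.
  rewrite ltNge; apply/negP => h; move: MP; rewrite ltNge => /negP; apply.
  apply: (@le_trans _ _ 1); last by rewrite -[leLHS]expR0 ler_expR oppr_ge0.
  by rewrite exprn_ile1// invf_le1// ler1n.
(* On [reg] one has [1 / |x| <= exp (M * ep)], so [B] bounds the digits and [inord] is faithful. *)
pose B := Num.truncn (expR (M%:R * ep) + 2).
pose lev (x : R) := Num.truncn (neglog x / ep).
pose reg (x : R) := [&& x != 0, `|x| <= 1 & neglog x < M%:R * ep].
pose bra (x : R) := `|Num.floor (`|x^-1| + 1 - a)|%N.
pose J : finType := option (bool * 'I_B.+1 * 'I_M.+1).
pose sym (x : X) : J := if reg x then Some (0 < x, inord (bra x), inord (lev x)) else None.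
have levP (x : R) : (lev x)%:R * ep <= neglog x < (lev x).+1%:R * ep.
  have /andP[l1 l2] := @truncn_itv R (neglog x / ep) (divr_ge0 (neglog_ge0 x) (ltW ep0)).
  by rewrite -ler_pdivlMr// l1 -ltr_pdivrMr.
have levM x : reg x -> (lev x < M.+1)%N.
  move=> /and3P[_ _ xM]; rewrite ltnS -(ler_nat R) -(ler_pM2r ep0); apply: ltW.
  by have /andP[l1 _] := levP x; exact: le_lt_trans xM.
have braP x : reg x -> Num.floor (`|x^-1| + 1 - a) = (bra x)%:Z /\ (bra x < B.+1)%N.
  move=> /and3P[x0 x1 xM].
  have n0 : 0 < `|x| by rewrite normr_gt0.
  have f0 : 0 <= Num.floor (`|x^-1| + 1 - a).
    rewrite floor_ge_int (_ : 0%:~R = 0 :> R)//.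
    have : 1 <= `|x^-1| by rewrite normfV invf_ge1.
    by case/andP: a01 => h3 h4; lra.
  have E : Num.floor (`|x^-1| + 1 - a) = (bra x)%:Z by rewrite /bra gez0_abs.
  split => //; rewrite ltnS /B truncn_ge_nat; last by rewrite addr_ge0// expR_ge0.
  rewrite -[(bra x)%:R]/((bra x)%:Z%:~R) -E.
  apply: (le_trans (floor_le _)).
  have : `|x^-1| <= expR (M%:R * ep).
    rewrite neglogE// in xM; rewrite normfV -[leRHS]invrK lef_pV2 ?posrE ?invr_gt0 ?expR_gt0//.
    by rewrite -expRN -[leRHS]lnK ?posrE// ler_expR lerNl ltW.
  by case/andP: a01 => h3 h4; lra.
have mlev i : measurable [set x : X | i%:R * ep <= neglog x < i.+1%:R * ep].
  rewrite (_ : [set _ | _] = nlevel (i%:R * ep) `\` nlevel (i.+1%:R * ep)).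
    by apply: measurableD; exact: measurable_nlevel.
  apply/seteqP; split => x; rewrite /nlevel/=.
    by move=> /andP[l1 l2]; split => //; apply/negP; rewrite -ltNge.
  by move=> [-> /negP]; rewrite -ltNge.
have mreg : measurable [set x : X | reg x].
  rewrite (_ : [set _ | _] = (~` [set 0] : set X) `&` D `&` ~` nlevel (M%:R * ep)).
    apply: measurableI; last by apply: measurableC; exact: measurable_nlevel.
    by apply: measurableI => //; apply: measurableC; exact: measurable_set1.
  apply/seteqP; split => x; rewrite /reg /nlevel /D/= in_itv/= -ler_norml.
    by move=> /and3P[/eqP x0 -> xM]; split => //; apply/negP; rewrite -ltNge.
  by move=> [[/eqP -> ->] /negP]; rewrite -ltNge.
have symE (sg : bool) (b : 'I_B.+1) (i : 'I_M.+1) x : sym x = Some (sg, b, i) <->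
    [/\ reg x, branch sg (b : nat)%:Z x & i%:R * ep <= neglog x < i.+1%:R * ep].
  rewrite /sym; case: ifPn => rx; last by split => // -[].
  have [fl bB] := braP _ rx; have lM := levM _ rx.
  have x0 : x != 0 by case/and3P: rx.
  split.
    move=> [<- <- <-]; rewrite /branch/= !inordK// x0 eqxx fl eqxx; split => //.
  move=> [_ /and3P[_ /eqP <- /eqP]]; rewrite fl => -[bE] /andP[l1 l2].
  congr (Some (_, _, _)); apply: val_inj; rewrite /= inordK//.
  have /andP[l3 l4] := levP x.
  apply/eqP; rewrite eqn_leq; apply/andP; split; rewrite -ltnS -(ltr_nat R) -(ltr_pM2r ep0).
    exact: le_lt_trans l2.
  exact: le_lt_trans l4.
have mReg x : sym x = None <-> ~ reg x.
  by rewrite /sym; case: ifPn => _; split => // /(_ isT).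
have msym v : measurable [set x | sym x = v].
  case: v => [[[sg b] i]|].
    rewrite (_ : [set _ | _] = [set x : X | reg x] `&` branch sg (b : nat)%:Z `&`
       [set x : X | i%:R * ep <= neglog x < i.+1%:R * ep]).
      by apply: measurableI => //; apply: measurableI => //; exact: measurable_branch.
    by apply/seteqP; split => x /=; [move=> /symE[]|move=> [[? ?] ?]; apply/symE].
  rewrite (_ : [set _ | _] = ~` [set x : X | reg x]); first exact: measurableC.
  by apply/seteqP; split => x /= /mReg.
pose lv (v : J) : R := if v is Some (_, _, i) then i%:R * ep else 0.
have symN x : (sym x == None) = ~~ reg x by rewrite /sym; case: ifP.
apply: (@entropy_ge_of_symbols J sym None lv I e m) => //.
- by case=> [[[? ?] ?]|]//=; rewrite mulr_ge0// ltW.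
- case=> [[[sg b] l]|//] E _ mE.
  apply: (lebesgue_contraction (msym _) mT) => //; first exact: expR_gt0.
  have bnd x : sym x = Some (sg, b, l) -> `|x| <= expR (- (l%:R * ep)).
    move=> /symE[/and3P[x0 x1 _] _ /andP[l1 _]].
    have [l0|l0] := ltP 0 (l%:R * ep); first exact: neglog_lt.
    by apply: (le_trans x1); rewrite -[leLHS]expR0 ler_expR oppr_ge0.
  move=> x y Qx Qy; have bx := bnd _ Qx; have by_ := bnd _ Qy.
  move: Qx Qy => /symE[_ Bx _] /symE[_ By _].
  rewrite (branch_dist Bx By) ler_wpM2r//= (_ : - (2 * _) = - (l%:R * ep) + - (l%:R * ep)); last by ring.
  by rewrite expRD; apply: ler_pM.
- move=> E mE; have mTE : measurable (T @^-1` E) by exact: measurable_preimT.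
  apply: (@le_trans _ _ (leb ([set x : X | (`|x| <= expR (- (M%:R * ep)))%R] `&` T @^-1` E))).
    apply: le_measure; rewrite ?inE//.
    + by apply: measurableI => //; apply: measurableI => //; exact: msym.
    + apply: measurableI => //.
      rewrite (_ : [set _ | _] = `[- expR (- (M%:R * ep)), expR (- (M%:R * ep))]%classic); first exact: measurable_itv.
      by apply/seteqP; split => x; rewrite /= in_itv/= ler_norml.
    move=> x [[Dx /mReg nreg] Tx]; split => //=.
    have [->|x0] := eqVneq x 0; first by rewrite normr0 expR_ge0.
    have x1 : `|x| <= 1 by rewrite ler_norml; move: Dx; rewrite /D/= in_itv.
    apply: neglog_lt => //; rewrite leNgt; apply/negP => h; apply: nreg.
    by rewrite /reg x0 x1.
  apply: leb_small_branches => //; apply: ltW; apply: (lt_le_trans MP).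
  apply: (@le_trans _ _ (2^-1 ^+ 2)).
    by apply: ler_wiXn2l => //; rewrite invf_le1// ler1n.
  by rewrite expr2; lra.
- move=> x; rewrite /nball/= => xB; rewrite symN; case: ifPn => [nreg|]; last first.
    rewrite negbK => rx; rewrite /lv /sym rx inordK; last exact: levM.
    by have /andP[_ /ltW] := levP x; rewrite -natr1 mulrDl mul1r.
  have [x1|x1] := ltP 1 `|x|.
    by rewrite (_ : neglog x = 0)//; apply/max_idPl; rewrite oppr_le0 ln_ge0// ltW.
  have x0 : x != 0 by apply/eqP => x0; apply: xB; rewrite x0 normr0 exprn_gt0// invr_gt0.
  move/negP: nreg; case; rewrite /reg x0 x1/= ltNge; apply/negP => h; apply: xB.
  by apply: le_lt_trans MP; exact: neglog_lt.
- move=> x [Dx /mReg nreg].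
  have [->|x0] := eqVneq x 0; first by rewrite /nball/= normr0 exprn_gt0// invr_gt0.
  have x1 : `|x| <= 1 by rewrite ler_norml; move: Dx; rewrite /D/= in_itv.
  rewrite /nball/=; apply: le_lt_trans MP; apply: neglog_lt => //.
  by rewrite leNgt; apply/negP => h; apply: nreg; rewrite /reg x0 x1.
Qed.

End LowerBound.

(** * A density bound uniform in the parameter *)

Lemma denom_step_pos (q' q B : nat) : (q' <= q)%N -> (0 < q)%N -> (0 < B)%N ->
  (q <= B * q + q')%N && (0 < B * q + q')%N /\ ((q < B * q + q')%N \/ B = 1%N).
Proof. by case: B => [//|[|B]] ? ? _; rewrite ?mulSn; split; lia. Qed.

Lemma denom_step_neg (q' q B : nat) : (q' < q)%N -> (1 < B)%N ->
  (q < B * q - q')%N && (q' <= B * q)%N.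
Proof. by case: B => [//|[//|B]] ? _; rewrite ?mulSn; lia. Qed.

Section Denominators.
Context {R : realType}.
Let X := measurableTypeR R.
Variable a : R.
Hypothesis a01 : 0 < a <= 1.
Let T : X -> X := Talpha a.

(** The successive denominators [(q_(k-1), q_k)], with [q_(k+1) = b * q_k + s * q_(k-1)]: the digit
    is [b = |1/x| - T x], and [s = x * |1/x|] is the sign of the current iterate. Being real-valued
    they are visibly measurable in [y]; [convergent] records their integrality. *)
Fixpoint denom (y : X) (k : nat) : R * R :=
  if k is j.+1 then
    let x : R := iter j T y in
    ((denom y j).2, (`|x^-1| - T x) * (denom y j).2 + x * `|x^-1| * (denom y j).1)
  else (0, 1).

Definition regular : set X :=
  [set y | a - 1 <= y < a /\ forall k, iter k T y != 0 :> R].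

Lemma regular_itv y k : regular y -> a - 1 <= (iter k T y : R) < a.
Proof. by case=> ya _; case: k => [//|k]; exact: Talpha_itv. Qed.

Lemma regular_norm y k : regular y -> 0 < `|iter k T y : R| <= 1.
Proof.
move=> ry; rewrite normr_gt0; case: (ry) => _ -> /=.
have /andP[h1 h2] := regular_itv k ry; case/andP: a01 => h3 h4.
by rewrite ler_norml; apply/andP; split; lra.
Qed.

(* In terms of the successive numerators and denominators, [y] is recovered from
   its [k]-th iterate by a Moebius map of determinant [+-1]. *)
Definition convergent (y : X) (k : nat) : Prop :=
  exists (p' p : int) (q' q : nat) (s : bool),
    [/\ denom y k = (q'%:R, q%:R), (q' <= q)%N && (0 < q)%N,
        (q' < q)%N \/ 0 <= (iter k T y : R),
        p' * q%:Z - p * q'%:Z = (-1) ^+ s &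
        (y : R) * (q%:R + q'%:R * iter k T y) = p%:~R + p'%:~R * iter k T y].

(** The clause [q' < q] or [0 <= x] carries the induction. Equality [q' = q] arises only from a
    positive iterate of digit 1, and then the next iterate [1/x - 1] is nonnegative. At a negative
    iterate [|x| <= 1 - a], so [1 / |x| >= 1 + a] and the digit is at least 2; subtracting [q'] then
    still leaves a larger denominator. *)
Lemma denom_convergent y k : regular y -> convergent y k.
Proof.
move=> ry; elim: k => [|k [p' [p [q' [q [s [dk /andP[q'q q0] hx det eqy]]]]]]].
  exists 1, 0, 0%N, 1%N, false; split => //; last by rewrite mul0r addr0 mulr1 add0r mul1r.
  by left.
case/andP: a01 => a0 a1.
have /andP[x0 x1] := regular_norm k ry.
have /andP[x2 x3] := regular_itv k ry.
have /andP[Tx2 Tx3] := Talpha_itv a (iter k T y : R).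
set x : R := iter k T y in dk hx eqy x0 x1 x2 x3 Tx2 Tx3 *.
have xn0 : x != 0 by rewrite -normr_gt0.
set b : int := Num.floor (`|x^-1| + 1 - a).
have bE : `|x^-1| - T x = b%:~R by exact: Talpha_int.
have [B bB] : exists B : nat, b = B%:Z.
  have : 0 <= b by rewrite /b floor_ge_int/=; have := normr_ge0 (x^-1); lra.
  by case: (b) => // n _; exists n.
have step (sg : R) : x * `|x^-1| = sg ->
    (y : R) * (sg * q'%:R + q%:R * `|x^-1|) = sg * p'%:~R + p%:~R * `|x^-1|.
  by move=> <-; have := congr1 ( *%R^~ `|x^-1|) eqy => /=; lra.
have iv : `|x^-1| * `|x| = 1 by rewrite normrV ?unitfE// mulVf// normr_eq0.
have iv1 : 1 <= `|x^-1| by nra.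
have B1 : (0 < B)%N by rewrite -ltz_nat -bB /b -lez1D addr0 floor_ge_int//=; lra.
have [xpos|xneg] := ltP 0 x.
  have sE : x * `|x^-1| = 1 by rewrite mulrC -[X in _ * X]gtr0_norm.
  exists p, (b * p + p'), q, (B * q + q')%N, (~~ s); split.
  - by rewrite /= -/x dk /= bE sE bB mul1r natrD natrM.
  - by have [] := denom_step_pos q'q q0 B1.
  - have [_ [|B1']] := denom_step_pos q'q q0 B1; first by left.
    right; rewrite iterS -/x.
    have -> : T x = `|x^-1| - 1 by apply/eqP; rewrite eq_sym subr_eq addrC -subr_eq bE bB B1'.
    by lra.
  - have -> : (-1) ^+ (~~ s) = - (-1) ^+ s :> int by case: (s).
    by rewrite -det bB PoszD PoszM; ring.
  - have := step _ sE; rewrite iterS -/x (_ : T x = `|x^-1| - b%:~R); last by rewrite -bE; ring.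
    by rewrite bB natrD natrM intrD intrM -/x; lra.
have xlt : x < 0 by rewrite lt_neqAle xn0.
have sE : x * `|x^-1| = -1 by rewrite -iv (ltr0_norm xlt); ring.
have q'ltq : (q' < q)%N by case: hx => //; rewrite leNgt xlt.
have B2 : (1 < B)%N.
  rewrite -ltz_nat -bB /b -lez1D floor_ge_int//=.
  have : `|x| <= 1 - a by rewrite ltr0_norm//; lra.
  rewrite (_ : (1 + 1)%:~R = 2 :> R)// => xa.
  have : 1 + a <= `|x^-1|; last by lra.
  by clear -iv iv1 xa a0 a1; move: (`|x|) (`|x^-1|) iv iv1 xa => u v iv iv1 xa; nra.
have /andP[qB q'B] := denom_step_neg q'ltq B2.
exists p, (b * p - p'), q, (B * q - q')%N, s; split.
- by rewrite /= -/x dk /= bE sE bB mulN1r natrB ?natrM.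
- by rewrite (ltnW qB) (leq_ltn_trans _ qB).
- by left.
- by rewrite -det bB -subzn// ?PoszM; ring.
- have := step _ sE; rewrite iterS -/x (_ : T x = `|x^-1| - b%:~R); last by rewrite -bE; ring.
  by rewrite bB natrB// ?natrM ?intrB ?intrM; lra.
Qed.

Lemma denom_le y k : regular y -> (denom y k).2 <= (denom y k.+1).2.
Proof.
move=> ry; have [_ [_ [q' [q [_ [dk /andP[q'q _] _ _ _]]]]]] := denom_convergent k.+1 ry.
have -> : (denom y k).2 = (denom y k.+1).1 by [].
by rewrite dk ler_nat.
Qed.

(** Denominators can stagnate for one step, but not for two in a row. *)
Lemma denom_lt y k : regular y -> (denom y k).1 < (denom y k.+1).2.
Proof.
move=> ry; have [_ [_ [q' [q [_ [dk /andP[q'q q0] hx _ _]]]]]] := denom_convergent k ry.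
case: hx => [lt|x0].
  by apply: (lt_le_trans _ (denom_le k ry)); rewrite dk ltr_nat.
rewrite /= dk /=; have /andP[xn0 x1] := regular_norm k ry.
have Ta := Talpha_itv a (iter k T y : R); rewrite -/T in Ta.
move: x0 xn0 x1 Ta; set x : R := iter k T y => x0 xn0 x1 /andP[_ Ta].
have xp : 0 < x by rewrite -(ger0_norm x0).
have iv1 : 1 <= `|x^-1| by rewrite normrV ?unitfE ?gt_eqF// invf_ge1.
have -> : x * `|x^-1| = 1 by rewrite gtr0_norm ?invr_gt0// divff ?gt_eqF.
case/andP: a01 => a0 a1; rewrite mul1r.
have : 0 < (`|x^-1| - T x) * q%:R by apply: mulr_gt0; rewrite ?ltr0n//; lra.
by lra.
Qed.

(** Strict growth of the sum makes a pair of denominators occur at most once along an orbit and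
    gives the linear growth [denom_ge]. *)
Lemma denom_sum_ge y k : regular y ->
  (denom y k).1 + (denom y k).2 + 1 <= (denom y k.+1).1 + (denom y k.+1).2.
Proof.
move=> ry; have := denom_lt k ry.
have [_ [_ [q' [q [_ [dk _ _ _ _]]]]]] := denom_convergent k ry.
have [_ [_ [r' [r [_ [ek _ _ _ _]]]]]] := denom_convergent k.+1 ry.
have : (denom y k).2 = (denom y k.+1).1 by [].
rewrite ek dk /= => ->; rewrite ltr_nat -addn1 -(ler_nat R) natrD; lra.
Qed.

Lemma denom_sum_lt y j k : regular y -> (j < k)%N ->
  (denom y j).1 + (denom y j).2 < (denom y k).1 + (denom y k).2.
Proof.
move=> ry; elim: k => [//|k IH]; rewrite ltnS leq_eqVlt.
have := denom_sum_ge k ry; move=> h /orP[/eqP -> |/IH]; lra.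
Qed.

Lemma denom_inj y j k : regular y -> denom y j = denom y k -> j = k.
Proof.
move=> ry jk; case: (ltngtP j k) => // /(denom_sum_lt ry); rewrite jk ltxx //.
Qed.

Lemma denom_ge y k : regular y -> k.+1%:R <= 2 * (denom y k).2.
Proof.
move=> ry; have [_ [_ [q' [q [_ [dk /andP[q'q _] _ _ _]]]]]] := denom_convergent k ry.
have : k.+1%:R <= (denom y k).1 + (denom y k).2.
  elim: (k) => [|j IH]; first by rewrite /= add0r.
  by have := denom_sum_ge j ry; rewrite -natr1; lra.
by rewrite dk /=; move: q'q; rewrite -(ler_nat R); lra.
Qed.

(** The quantity [q + q' x] is multiplied at each step by [|1/x|], hence it is the reciprocal of the
    product of the [|T^j y|] for [j < k]. *)
Lemma ln_denom y k : regular y ->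
  1 <= (denom y k).2 + (denom y k).1 * iter k T y /\
  ln ((denom y k).2 + (denom y k).1 * iter k T y) = \sum_(j < k) neglog (iter j T y : R).
Proof.
move=> ry; elim: k => [|k [IH1 IH2]]; first by rewrite /= mul0r addr0 ln1 big_ord0.
rewrite big_ord_recr/= -IH2; have /andP[xn0 x1] := regular_norm k ry.
rewrite neglogE//; move: xn0 x1 IH1 {IH2}; set x : R := iter k T y; move: (denom y k) => [q' q] /=.
move=> xn0 x1 D1.
have iv1 : 1 <= `|x^-1| by rewrite normrV ?unitfE -?normr_gt0// invf_ge1.
have -> : (`|x^-1| - T x) * q + x * `|x^-1| * q' + q * T x = (q + q' * x) * `|x^-1| by ring.
split; first by rewrite mulr_ege1.
rewrite lnM ?posrE; [|lra|lra].
by rewrite normrV ?unitfE -?normr_gt0// lnV ?posrE.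
Qed.

End Denominators.

Lemma measure_bigcup_fin d (X : measurableType d) (R : realType)
    (m : {measure set X -> \bar R}) (I : finType) (F : I -> set X) :
  (forall i, measurable (F i)) -> trivIset setT F ->
  (m (\bigcup_i F i) = \sum_i m (F i))%E.
Proof.
move=> mF tF; rewrite measure_fin_bigcup//; last exact: finite_finset.
rewrite fsbig_finite/=; last exact: finite_finset.
apply: perm_big; apply: uniq_perm; rewrite ?finmap.fset_uniq ?index_enum_uniq// => i.
by rewrite mem_index_enum in_fset_set ?in_setT//; exact: finite_finset.
Qed.

Lemma measure_bigsetU_le d (X : measurableType d) (R : realType)
    (m : {measure set X -> \bar R}) (I : finType) (F : I -> set X) :
  (forall i, measurable (F i)) ->
  (m (\big[setU/set0]_i F i) <= \sum_i m (F i))%E.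
Proof.
move=> mF; pose K (A : set X) (x : \bar R) := measurable A /\ (m A <= x)%E.
suff : K (\big[setU/set0]_i F i) (\sum_i m (F i))%E by case.
apply: (big_ind2 K) => //; first by split; rewrite ?measure0.
move=> A x B y [mA Ax] [mB By]; split; first exact: measurableU.
by apply: (le_trans (measureU2 _ mA mB)); exact: leeD.
Qed.

(** The classes [F j] are arbitrary sets, so each is first enclosed in an interval of length
    [2 * r]. *)
Lemma lebesgue_classes (R : realType) (J : finType) (F : J -> set (measurableTypeR R))
    (r : R) (S : set (measurableTypeR R)) :
  0 <= r -> measurable S -> S `<=` \bigcup_j F j ->
  (forall j x y, F j x -> F j y -> `|x - y| <= r) ->
  (@lebesgue_measure R S <= (#|J|%:R * (2 * r))%:E)%E.
Proof.
move=> r0 mS SF Fr.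
have /choice[c cP] : forall j, exists c : R, F j `<=` `[c - r, c + r]%classic.
  move=> j; have [->|/set0P[x Fx]] := eqVneq (F j) set0; first by exists 0.
  by exists x => y Fy; have := Fr _ _ _ Fx Fy; rewrite /= in_itv/= ler_norml; lra.
pose G j : set (measurableTypeR R) := `[(c j - r)%R, (c j + r)%R]%classic.
have mG j : measurable (G j) by exact: measurable_itv.
apply: (@le_trans _ _ (\sum_j @lebesgue_measure R (G j))%E).
  apply: (le_trans _ (measure_bigsetU_le _ mG)); apply: le_measure; rewrite ?inE//.
    exact: bigsetU_measurable.
  by move=> x /SF[j _ /cP Gj]; rewrite -bigcup_seq; exists j; rewrite //= mem_index_enum.
apply: (@le_trans _ _ (\sum_(j : J) (2 * r)%:E)%E).
  apply: lee_sum => j _; rewrite /G; apply: lebesgue_diam => //; first by lra.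
  by move=> x y /=; rewrite !in_itv/= ler_norml; lra.
by rewrite sumEFin sumr_const lee_fin [#|J|%:R * _]mulr_natl.
Qed.

(** * Points sharing a pair of denominators *)

Section ClassBound.
Context {R : realType}.
Let X := measurableTypeR R.
Variable a : R.
Hypothesis a01 : 0 < a <= 1.
Let T : X -> X := Talpha a.

(** The error [y * q - p] equals [+- x / (q + q' * x)], of absolute value at most 1. *)
Lemma convergent_num_le (p p' q q' x y : R) (e : bool) : 1 <= q ->
  `|x| <= 1 -> `|y| <= 1 -> p' * q - p * q' = (-1) ^+ e ->
  1 <= q + q' * x -> y * (q + q' * x) = p + p' * x -> `|p| <= q + 1.
Proof.
move=> q1 x1 y1 det D1 yE.
have : `|(y * q - p) * (q + q' * x)| <= 1.
  have -> : (y * q - p) * (q + q' * x) = x * (p' * q - p * q').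
    by rewrite mulrBl mulrAC yE; ring.
  by rewrite det normrM normrX normrN1 expr1n mulr1.
rewrite normrM (ger0_norm (_ : 0 <= q + q' * x)); last by lra.
have h : `|y * q| <= q by rewrite normrM (ger0_norm (_ : 0 <= q)) ?ler_piMl//; lra.
move=> k; have : `|y * q - p| <= 1 by apply: le_trans k; rewrite ler_peMr.
by move: h; rewrite !ler_norml; lra.
Qed.

(** Modulo [q] the product [p * q'] is [- e], and [q'] is invertible, so the remainder of [p] is
    determined; the quotient does the rest. *)
Lemma numerator_unique (p p' r r' q q' : int) (e : int) : 0 < q -> e = 1 \/ e = -1 ->
  p' * q - p * q' = e -> r' * q - r * q' = e ->
  ((p + q + 1) %/ q)%Z = ((r + q + 1) %/ q)%Z -> p = r /\ p' = r'.
Proof.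
move=> q0 e1 dp dr h.
have cop : coprimez q q'.
  apply/coprimezP; case: e1 => ?; subst e.
    by exists (p', - p) => /=; lia.
  by exists (- p', p) => /=; lia.
have : (q %| (p - r) * q')%Z.
  by apply/dvdzP; exists (p' - r'); move: dp dr; lia.
rewrite Gauss_dvdzl// => dv.
have pr : p = r.
  have : (p + q + 1)%Z = (r + q + 1)%Z.
    rewrite (divz_eq (p + q + 1) q) (divz_eq (r + q + 1) q) h; congr (_ + _).
    apply/eqP; rewrite eqz_mod_dvd (_ : _ - _ = p - r)//; by ring.
  by move=> /addIr /addIr.
split=> //; subst r; have : p' * q = r' * q by move: dp dr; lia.
by move/mulIf; apply; rewrite gt_eqF.
Qed.

(* A numerator is determined modulo the denominator [q] by the sign [j.1] of the
   determinant, and then by the quotient [j.2]. *)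
Definition denom_class (E : set R) (q' q : nat) (j : bool * 'I_5) : set X :=
  [set y | regular a y /\ exists (k : nat) (p' p : int),
    [/\ denom a y k = (q'%:R, q%:R), E (iter k T y),
        p' * q%:Z - p * q'%:Z = (-1) ^+ j.1,
        (y : R) * (q%:R + q'%:R * iter k T y) = p%:~R + p'%:~R * iter k T y &
        ((p + q%:Z + 1) %/ q%:Z)%Z = j.2%:Z]].

(** Since [|p| <= q + 1], the number [p + q + 1] lies between 0 and [2 * q + 2]; its quotient by [q]
    is at most 4, the worst case being [q = 1]. *)
Lemma denom_class_cover (E : set R) (q' q : nat) y k :
  regular a y -> denom a y k = (q'%:R, q%:R) -> E (iter k T y) ->
  exists j, denom_class E q' q j y.
Proof.
move=> ry dk Ek.
have [p' [p [r' [r [s [ek /andP[rr r0] _ det eqy]]]]]] := denom_convergent a01 k ry.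
have [/eqP e1 /eqP e2] : (q'%:R = r'%:R :> R) /\ (q%:R = r%:R :> R).
  by move: ek; rewrite dk => -[-> ->].
rewrite !eqr_nat in e1 e2; move/eqP: e1 => e1; move/eqP: e2 => e2; subst r' r.
have [D1 _] := ln_denom a01 k ry; rewrite dk /= in D1.
have ya : `|y : R| <= 1.
  by have /andP[_] := regular_norm a01 0%N ry.
have /andP[_ x1] := regular_norm a01 k ry.
have : `|p%:~R : R| <= q%:R + 1.
  apply: (@convergent_num_le _ p'%:~R _ q'%:R (iter k T y : R) y s) => //.
    by rewrite ler1n.
  have := congr1 (fun z : int => z%:~R : R) det.
  by rewrite intrB !intrM intr_sign.
rewrite -[q%:R]/(q%:Z%:~R) -(intrD _ _ 1) -intr_norm ler_int => pq.
have t0 : (0 <= (p + q%:Z + 1) %/ q%:Z)%Z by rewrite divz_ge0//; lia.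
have t5 : ((p + q%:Z + 1) %/ q%:Z < 5)%Z by rewrite ltz_divLR//; lia.
have [t tE] : exists t : nat, ((p + q%:Z + 1) %/ q%:Z)%Z = t%:Z.
  by move: t0; case: (_ %/ _)%Z => // n _; exists n.
have t5' : (t < 5)%N by rewrite -ltz_nat -tE.
by exists (s, Ordinal t5'); split => //; exists k, p', p.
Qed.

(** Two points of one class are images of iterates under the same Moebius map, so
    [y - z = +- (x1 - x2) / (d1 * d2)]; the times [k] and [m] of these iterates may differ. *)
Lemma denom_class_diam (E : set R) (q' q : nat) j (D l : R) : 0 < D -> (0 < q)%N ->
  (forall x, E x -> D <= q%:R + q'%:R * x) -> (forall x y, E x -> E y -> `|x - y| <= l) ->
  forall y z, denom_class E q' q j y -> denom_class E q' q j z -> `|y - z : R| <= l / D ^+ 2.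
Proof.
move=> D0 q0 ED El y z [ry [k [p' [p [dk Ek det eqy pj]]]]] [rz [m [r' [r [dm Em det' eqz rj]]]]].
have [? ?] : p = r /\ p' = r'.
  apply: (@numerator_unique p p' r r' q%:Z q'%:Z ((-1) ^+ j.1)) => //; last by rewrite pj rj.
  by case: (j.1); [right|left].
subst r r'.
have h1 := ED _ Ek; have h2 := ED _ Em; have h3 := El _ _ Ek Em.
have detR : p'%:~R * q%:R - p%:~R * q'%:R = (-1) ^+ j.1 :> R.
  by have := congr1 (fun z : int => z%:~R : R) det; rewrite intrB !intrM intr_sign.
move: eqy eqz h1 h2 h3; set x1 : R := iter k T y; set x2 : R := iter m T z.
set d1 := q%:R + _ * x1; set d2 := q%:R + _ * x2 => eqy eqz h1 h2 h3.
have E1 : (y - z : R) * (d1 * d2) = (x1 - x2) * (-1) ^+ j.1.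
  have -> : (y - z : R) * (d1 * d2) = (y * d1) * d2 - (z * d2) * d1 by ring.
  by rewrite eqy eqz -detR /d1 /d2; ring.
have : `|(y - z : R) * (d1 * d2)| <= l.
  by rewrite E1 normrM normrX normrN1 expr1n mulr1.
rewrite normrM (ger0_norm (_ : 0 <= d1 * d2)); last by apply: mulr_ge0; lra.
move=> h; rewrite ler_pdivlMr ?exprn_gt0//; apply: le_trans h.
by apply: ler_wpM2l => //; rewrite expr2; apply: ler_pM => //; lra.
Qed.

(** The constant 20 stands for ten classes, each enclosed in an interval of twice its diameter
    bound. *)
Lemma lebesgue_denom_class (E : set R) (q' q : nat) (D l : R) (S : set X) :
  0 < D -> 0 <= l -> (0 < q)%N -> measurable S ->
  (forall x, E x -> D <= q%:R + q'%:R * x) -> (forall x y, E x -> E y -> `|x - y| <= l) ->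
  (forall y, S y -> regular a y /\ exists2 k, denom a y k = (q'%:R, q%:R) & E (iter k T y)) ->
  (@lebesgue_measure R S <= (20 * l / D ^+ 2)%:E)%E.
Proof.
move=> D0 l0 q0 mS ED El SE.
have lD : 0 <= l / D ^+ 2 by rewrite divr_ge0// exprn_ge0// ltW.
have -> : 20 * l / D ^+ 2 = #|{: bool * 'I_5}|%:R * (2 * (l / D ^+ 2)).
  by rewrite card_prod card_bool card_ord mulrA (_ : (2 * 5)%:R * 2 = 20 :> R) ?mulrA// -natrM.
apply: (@lebesgue_classes _ _ (denom_class E q' q)) => //.
  by move=> y /SE[ry [k dk Ek]]; have [j] := denom_class_cover ry dk Ek; exists j.
by move=> j y z; exact: denom_class_diam.
Qed.

End ClassBound.

(** * Sums over pairs of denominators *)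

Lemma sum_inv_sq_affine (R : realType) (q c : R) (n : nat) :
  0 < q -> 0 <= c -> n%:R * c < q ->
  \sum_(i < n) ((q - i%:R * c) ^+ 2)^-1 <= n%:R / (q * (q - n%:R * c)).
Proof.
move=> q0 c0; elim: n => [|n IH] nc; first by rewrite big_ord0 mul0r.
have nc' : n%:R * c < q by move: nc; rewrite -natr1; lra.
have d0 : 0 < q - n%:R * c - c by move: nc; rewrite -natr1; lra.
rewrite big_ord_recr/=; apply: (le_trans (lerD (IH nc') (lexx _))).
rewrite -natr1 (_ : q - (n%:R + 1) * c = q - n%:R * c - c); last by ring.
have n0 : 0 <= n%:R :> R by [].
have E1 : n%:R * (q - n%:R * c) = n%:R * q - n%:R * (n%:R * c) by ring.
move: d0 nc'; set d := q - n%:R * c => d0 nc'.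
have dp : 0 < d by lra.
have -> : n%:R / (q * d) + (d ^+ 2)^-1 = (n%:R * d + q) / (q * d ^+ 2).
  by field; rewrite !gt_eqF.
rewrite ler_pdivrMr ?mulr_gt0 ?exprn_gt0//.
rewrite mulrAC ler_pdivlMr ?mulr_gt0//.
have -> : (n%:R * d + q) * (q * (d - c)) = q * ((n%:R * d + q) * (d - c)) by ring.
have -> : (n%:R + 1) * (q * d ^+ 2) = q * ((n%:R + 1) * d ^+ 2) by ring.
rewrite ler_pM2l//.
have -> : (n%:R * d + q) * (d - c) = (n%:R + 1) * d ^+ 2 - q * c + d * (q - n%:R * c - d) by ring.
have := mulr_ge0 (ltW q0) c0; have : q - n%:R * c - d = 0 by rewrite /d; ring.
move=> ->; lra.
Qed.

Lemma sum_inv_denom (R : realType) (q : nat) (dl : R) : (0 < q)%N -> 0 < dl <= 1 ->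
  \sum_(i < q.+1) ((q%:R - i%:R * (1 - dl)) ^+ 2)^-1 <=
    (dl^-1 * q%:R^-1 + dl^-1 ^+ 2 * (q%:R ^+ 2)^-1 : R).
Proof.
move=> q0 /andP[d0 d1]; rewrite big_ord_recr/=.
have qp : 0 < q%:R :> R by rewrite ltr0n.
have E : q%:R - q%:R * (1 - dl) = q%:R * dl by ring.
apply: lerD; last by rewrite E exprMn invfM exprVn mulrC.
apply: (le_trans (sum_inv_sq_affine qp _ _)); first by lra.
  by rewrite -subr_gt0 E mulr_gt0.
by rewrite E invfM mulrA divff ?gt_eqF// mul1r invfM mulrC.
Qed.

Lemma harmonic_le (R : realType) (n : nat) : (0 < n)%N ->
  \sum_(i < n) i.+1%:R^-1 <= 1 + ln n%:R :> R.
Proof.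
elim: n => [//|[|n] IH] _; first by rewrite big_ord1 ln1 invr1 addr0.
rewrite big_ord_recr/=; apply: (le_trans (lerD (IH isT) (lexx _))).
have np : 0 < n.+1%:R :> R by [].
have mp : 0 < n.+2%:R :> R by [].
have : ln (n.+1%:R / n.+2%:R) <= - n.+2%:R^-1 :> R.
  have -> : n.+1%:R / n.+2%:R = 1 - n.+2%:R^-1 :> R.
    by rewrite -[X in _ / X]natr1 -[n.+2%:R]natr1; field; rewrite gt_eqF// natr1.
  apply: le_ln1Dx; rewrite ltrN2 invf_lt1 ?ltr1n//.
rewrite ln_div ?posrE//.
move: (ln n.+1%:R) (ln n.+2%:R) (n.+2%:R^-1 : R) => u v w; lra.
Qed.

Lemma sum_inv_sq_le (R : realType) (n : nat) :
  \sum_(i < n) (i.+1%:R ^+ 2)^-1 <= 2 :> R.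
Proof.
have := sum_inv_sq R n; rewrite big_mkord => h; apply: (le_trans h).
by rewrite gerBl invr_ge0 addr_ge0// invr_ge0.
Qed.

Lemma sum_denom_weights (R : realType) (N : nat) (dl : R) : (0 < N)%N -> 0 < dl <= 1 ->
  \sum_(q < N.+1) \sum_(i < N.+1)
     (if (i <= q)%N && (0 < q)%N then ((q%:R - i%:R * (1 - dl)) ^+ 2)^-1 else 0)
   <= (1 + ln N%:R) / dl + 2 / dl ^+ 2 :> R.
Proof.
move=> N0 d01; rewrite big_ord_recl/=.
rewrite [X in X + _]big1 ?add0r; last by move=> i _; rewrite andbF.
have dp : 0 < dl by case/andP: d01.
apply: (@le_trans _ _ (\sum_(q < N) (dl^-1 * q.+1%:R^-1 + dl^-1 ^+ 2 * (q.+1%:R ^+ 2)^-1))).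
  apply: ler_sum => q _; apply: le_trans (sum_inv_denom (ltn0Sn q) d01).
  rewrite (big_ord_widen N.+1 (fun i => ((q.+1%:R - i%:R * (1 - dl)) ^+ 2)^-1)); last first.
    by rewrite ltnS.
  by rewrite [leRHS]big_mkcond/=; apply: ler_sum => i _; rewrite andbT ltnS.
rewrite big_split/= -!mulr_sumr; apply: lerD.
  by rewrite mulrC ler_pM2r ?invr_gt0//; exact: harmonic_le.
rewrite exprVn mulrC ler_pM2r ?invr_gt0 ?exprn_gt0//; exact: sum_inv_sq_le.
Qed.

Section Regular.
Context {R : realType}.
Let X := measurableTypeR R.
Local Notation leb := (@lebesgue_measure R).
Variable a : R.
Hypothesis a01 : 0 < a <= 1.
Let T : X -> X := Talpha a.

Let mT : measurable_fun setT T. Proof. exact: measurable_Talpha. Qed.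

Lemma lebesgue_unit_probability : exists P0 : probability X R,
  forall A, P0 A = leb (`[a - 1, a[%classic `&` A).
Proof.
have mI : measurable (`[a - 1, a[%classic : set X) by exact: measurable_itv.
have mid : measurable_fun setT (@id X) by [].
have [m mE] := pushforward_restrP leb mI mid.
have [||||P0 P0E] := @probability_of_funP _ X R m.
- by rewrite measure0.
- by move=> A; exact: measure_ge0.
- by move=> ?; exact: measure_semi_sigma_additive.
- rewrite mE preimage_setT setIT.
  have : leb `[a - 1, a[%classic = 1%E.
    rewrite lebesgue_measure_itv/= lte_fin ltrBlDr ltrDl ltr01 -EFinB.
    by congr EFin; lra.
  exact.
- by exists P0 => A; rewrite P0E mE preimage_id.
Qed.

(** A point is recovered from its digit, its sign and its image. *)
Lemma countable_preimage_Talpha (S : set X) : countable S -> countable (T @^-1` S).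
Proof.
move=> cS.
pose F (n : int * bool) := (fun c : X => (-1) ^+ n.2 * (n.1%:~R + c)^-1 : X) @` S.
apply: (@sub_countable _ _ _ (\bigcup_n F n)).
  apply: subset_card_le => x /= Sx.
  have e : `|(x : R)^-1| = (Num.floor (`|(x:R)^-1| + 1 - a))%:~R + T x.
    by rewrite -Talpha_int subrK.
  exists (Num.floor (`|(x:R)^-1| + 1 - a), (x : R) < 0) => //; exists (T x) => //=; rewrite -e.
  case: (ltrP (x : R) 0) => hx; first by rewrite ltr0_norm ?invr_lt0// invrN invrK mulN1r opprK.
  by rewrite mul1r ger0_norm ?invr_ge0// invrK.
apply: bigcup_countable => // n _.
by apply: (@sub_countable _ _ _ S) => //; exact: card_image_le.
Qed.

Lemma countable_preimage_iter k (S : set X) : countable S -> countable (iter k T @^-1` S).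
Proof.
move=> cS; elim: k => [//|k IH].
by rewrite preim_iterS; exact: countable_preimage_Talpha.
Qed.

Let Z : set X := \bigcup_k (iter k T @^-1` [set 0]).

Let cZ : countable Z.
Proof. by apply: bigcup_countable => // k _; apply: countable_preimage_iter; exact: countable1. Qed.

Lemma regularE : regular a = (`[a - 1, a[%classic : set X) `\` Z.
Proof.
apply/seteqP; split=> y [].
  by move=> ya nz; split; rewrite /= ?in_itv//= => -[k _ /= yk]; move: (nz k); rewrite yk eqxx.
rewrite /= in_itv/= => ya nz; split => // k; apply/eqP => yk; apply: nz.
by exists k.
Qed.

Lemma measurable_regular : measurable (regular a : set X).
Proof.
rewrite regularE; apply: measurableD; first exact: measurable_itv.
exact: countable_measurable.
Qed.

Lemma measurable_denom k : measurable_fun setT (fun y : X => (denom a y k).1 : X) /\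
  measurable_fun setT (fun y : X => (denom a y k).2 : X).
Proof.
elim: k => [|k [m1 m2]]; first by split; exact: measurable_cst.
split; first exact: m2.
have mk : measurable_fun setT (iter k T) by exact: measurable_iter.
have mv : measurable_fun setT (fun y : X => `|(iter k T y : R)^-1| : X).
  by apply: measurableT_comp => //; apply: (measurableT_comp measurable_inv).
apply: measurable_funD; apply: measurable_funM => //.
  apply: measurable_funB => //; exact: (measurableT_comp mT).
by apply: measurable_funM.
Qed.

End Regular.

Section OccupationMass.
Context {R : realType}.
Let X := measurableTypeR R.
Variables (m : {measure set X -> \bar R}) (K : nat) (Q : nat -> set X) (S : nat -> X -> X).
Hypotheses (mQ : forall k, measurable (Q k)) (mS : forall k, measurable_fun setT (S k)).

Lemma occupation_exists : exists nu : {measure set X -> \bar R},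
  forall A, (nu A = \sum_(k < K) m (Q k `&` S k @^-1` A))%E.
Proof.
have /choice[n nE] := fun k => pushforward_restrP m (mQ k) (mS k).
exists (msum n K) => A; rewrite /= /msum; apply: eq_bigr => k _; exact: nE.
Qed.

(** Integrates the pointwise bound over [G], [neglog] being replaced by the indicators of dyadic
    balls, so that only visits to these balls are counted. *)
Lemma occupation_mass (c : R) (G : set X) : 0 <= c -> measurable G ->
  (forall y, G y -> c <= \sum_(k < K) (\1_(Q k) y * neglog (S k y))) ->
  (c%:E * m G <= \sum_(0 <= i <oo) \sum_(k < K) m (Q k `&` S k @^-1` (nball i)))%E.
Proof.
move=> c0 mG cG.
have mB k i : measurable (Q k `&` S k @^-1` (nball i)).
  by apply: measurableI => //; apply: measurable_preimT => //; exact: measurable_nball.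
pose g i (y : X) := (\sum_(k < K) (\1_(Q k `&` S k @^-1` (nball i)) y : R)%:E)%E.
have g0 i y : (0 <= g i y)%E by apply: sume_ge0 => k _; rewrite lee_fin.
have mg i : measurable_fun G (g i).
  apply: emeasurable_sum => k; apply/measurable_EFinP; apply: measurable_funTS.
  exact: measurable_indic.
rewrite -integral_cst//.
apply: (@le_trans _ _ (\int[m]_(y in G) (\sum_(0 <= i <oo) g i y))%E).
  apply: ge0_le_integral => //.
  - exact: ge0_emeasurable_sum.
  move=> y Gy; apply: (@le_trans _ _ (\sum_(k < K) ((\1_(Q k) y * neglog (S k y))%:E)))%E.
    by rewrite sumEFin lee_fin cG.
  rewrite /g nneseries_sum; last by move=> k i _; rewrite lee_fin.
  apply: lee_sum => k _.
  have [Qy|nQy] := boolP (y \in Q k); last first.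
    rewrite indicE (negbTE nQy) mul0r; apply: nneseries_ge0 => i _ _; by rewrite lee_fin.
  rewrite indicE Qy mul1r; apply: (le_trans (neglog_le_nball _)).
  apply: lee_nneseries => i _; first by rewrite lee_fin.
  by rewrite !indicE in_setI Qy.
rewrite integral_nneseries//; apply: lee_nneseries => i _; first by move=> _; exact: integral_ge0.
rewrite ge0_integral_sum//; last first.
  - by move=> k; apply/measurable_EFinP; apply: measurable_funTS; exact: measurable_indic.
apply: lee_sum => k _; rewrite integral_indic//; exact: measureIl.
Qed.

End OccupationMass.

(** * The occupation measure *)

Section Occupation.
Context {R : realType}.
Let X := measurableTypeR R.
Local Notation leb := (@lebesgue_measure R).
Variables (a : R) (N : nat) (P0 : probability X R).
Hypotheses (a01 : 0 < a <= 1) (N0 : (0 < N)%N).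
Hypothesis P0E : forall A, P0 A = leb (`[a - 1, a[%classic `&` A).
Let T : X -> X := Talpha a.
Let mT : measurable_fun setT T. Proof. exact: measurable_Talpha. Qed.

Definition early k : set X := [set y | regular a y /\ (denom a y k).2 <= N%:R].

(* Lebesgue-expected number of visits to [A] before the denominators exceed [N];
   the cutoff [2 N] is harmless since the [k]-th denominator is at least [(k + 1) / 2]. *)
Definition occupation (A : set X) : \bar R :=
  (\sum_(k < N.*2) P0 (early k `&` iter k T @^-1` A))%E.

Let mi k : measurable_fun setT (iter k T). Proof. exact: measurable_iter. Qed.

Lemma measurable_early k : measurable (early k).
Proof.
rewrite (_ : early k = regular a `&` (fun y : X => (denom a y k).2 : X) @^-1` (`]-oo, N%:R]%classic : set X)); last first.
  by apply/seteqP; split=> y [ry /=]; rewrite ?in_itv/=.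
apply: measurableI; first exact: measurable_regular.
have [_ h] := measurable_denom a k.
rewrite -[X in measurable X]setTI; apply: h => //; exact: measurable_itv.
Qed.

Lemma measurable_early_iter k j A : measurable A -> measurable (early k `&` iter j T @^-1` A).
Proof.
by move=> mA; apply: measurableI; [exact: measurable_early|exact: measurable_preimT].
Qed.

Lemma P0_regular : P0 (regular a) = 1%E.
Proof.
have mr := measurable_regular a.
have h : P0 (~` regular a) = 0%E.
  rewrite P0E; apply: countable_lebesgue_measure0.
  apply: (@sub_countable _ _ _ (\bigcup_k (iter k T @^-1` [set 0 : X]))); last first.
    by apply: bigcup_countable => // k _; apply: countable_preimage_iter; exact: countable1.
  apply: subset_card_le; rewrite regularE => y [yI ny]; apply: contrapT => nZ.
  by apply: ny; split.
have := @probability_setC _ _ _ P0 _ mr; rewrite h => /esym.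
by rewrite prE//; move=> -[]; move/eqP; rewrite subr_eq0 => /eqP <-.
Qed.

Lemma early_anti k : early k.+1 `<=` early k.
Proof. by move=> y [ry h]; split=> //; apply: le_trans h; exact: denom_le. Qed.

Lemma early_max : early N.*2 = set0.
Proof.
apply/seteqP; split=> // y [ry h]; have := denom_ge a01 N.*2 ry.
have : N.*2.+1%:R = 2 * N%:R + 1 :> R by rewrite -natr1 -muln2 natrM mulrC.
by lra.
Qed.

Let Pr A : R := fine (P0 A).

Lemma occupationE A : measurable A ->
  occupation A = (\sum_(k < N.*2) Pr (early k `&` iter k T @^-1` A))%:E.
Proof.
move=> mA; rewrite -sumEFin; apply: eq_bigr => k _.
by rewrite prE//; exact: measurable_early_iter.
Qed.

(** Passing from [E] to [T^-1 E] shifts the time by one. The two sums differ by the initial term and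
    by the telescoping masses of the points leaving [early], each at most 1 in total. *)
Lemma occupation_invariant E : measurable E ->
  `|fine (occupation (T @^-1` E)) - fine (occupation E)| <= 1.
Proof.
move=> mE; rewrite !occupationE//; last exact: measurable_preimT.
rewrite /=.
pose A k := Pr (early k `&` iter k T @^-1` E).
pose B k := Pr (early k).
have step k : A k.+1 <= Pr (early k `&` iter k T @^-1` (T @^-1` E)) <= A k.+1 + (B k - B k.+1).
  have -> : iter k T @^-1` (T @^-1` E) = iter k.+1 T @^-1` E by [].
  have m1 := measurable_early_iter k k.+1 mE.
  have m2 := measurable_early_iter k.+1 k.+1 mE.
  apply/andP; split; first by apply: le_pr => // y [/early_anti ? ?]; split.
  have mk := measurable_early k; have mk1 := measurable_early k.+1.
  have : B k = B k.+1 + Pr (early k `\` early k.+1).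
    rewrite /B /Pr -fineD ?fin_num_measure//; [|exact: measurableD..].
    rewrite -measureU//; [|exact: measurableD|by rewrite setDE setICA setICr setI0].
    by rewrite setDUK//; exact: early_anti.
  move=> hB; have -> : B k - B k.+1 = Pr (early k `\` early k.+1) by rewrite hB addrC addKr.
  rewrite /A.
  apply: (@le_trans _ _ (Pr ((early k.+1 `&` iter k.+1 T @^-1` E) `|` (early k `\` early k.+1)))).
    apply: le_pr => //; first by apply: measurableU => //; exact: measurableD.
    by move=> y [ek Ey]; have [e1|ne1] := pselect (early k.+1 y); [left|right].
  rewrite /Pr -fineD ?fin_num_measure//; [|exact: measurableD..].
  apply: fine_le; rewrite ?fin_num_measure//; last by apply: measureU2 => //; exact: measurableD.
    by apply: measurableU => //; exact: measurableD.
  by rewrite fin_numD !fin_num_measure//; exact: measurableD.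
have A0 : 0 <= A 0%N <= 1 by rewrite pr_ge0 pr_le1//; exact: measurable_early_iter.
have B0 : B 0%N <= 1 by rewrite pr_le1//; exact: measurable_early.
have AK : A N.*2 = 0 by rewrite /A early_max set0I /Pr measure0.
have BK : B N.*2 = 0 by rewrite /B early_max /Pr measure0.
have S1 : \sum_(k < N.*2) A k.+1 = \sum_(k < N.*2) A k - A 0%N.
  suff h n : \sum_(k < n) A k.+1 = \sum_(k < n) A k - A 0%N + A n by rewrite h AK addr0.
  elim: n => [|n IH]; first by rewrite !big_ord0 add0r addNr.
  by rewrite !big_ord_recr/= IH; ring.
have S2 : \sum_(k < N.*2) (B k - B k.+1) = B 0%N.
  suff h n : \sum_(k < n) (B k - B k.+1) = B 0%N - B n by rewrite h BK subr0.
  elim: n => [|n IH]; first by rewrite !big_ord0 subrr.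
  by rewrite !big_ord_recr/= IH; ring.
have L1 : \sum_(k < N.*2) A k - A 0%N <= \sum_(k < N.*2) Pr (early k `&` iter k T @^-1` (T @^-1` E)).
  by rewrite -S1; apply: ler_sum => k _; have /andP[] := step k.
have L2 : \sum_(k < N.*2) Pr (early k `&` iter k T @^-1` (T @^-1` E)) <= \sum_(k < N.*2) A k - A 0%N + B 0%N.
  by rewrite -S1 -S2 -big_split/=; apply: ler_sum => k _; have /andP[] := step k.
have -> : \sum_(k < N.*2) Pr (early k `&` iter k T @^-1` E) = \sum_(k < N.*2) A k by [].
case/andP: A0; move: L1 L2 B0; move: (A 0%N) (B 0%N) (\sum_(k < N.*2) A k) => u v w L1 L2 B0 ? ?.
by rewrite ler_norml; apply/andP; split; lra.
Qed.

Definition denom_cell k (E : set X) (p : 'I_N.+1 * 'I_N.+1) : set X :=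
  [set y | [/\ regular a y, denom a y k = (p.2%:R, p.1%:R) & E (iter k T y)]].

Lemma measurable_denom_cell k E p : measurable E -> measurable (denom_cell k E p).
Proof.
move=> mE; have [m1 m2] := measurable_denom a k.
have -> : denom_cell k E p = regular a `&` ((fun y : X => (denom a y k).1 : X) @^-1` [set p.2%:R : X]
    `&` (fun y : X => (denom a y k).2 : X) @^-1` [set p.1%:R : X]) `&` iter k T @^-1` E.
  apply/seteqP; split=> y; first by case=> ry dk Ey; split=> //; split=> //=; rewrite dk.
  by case=> [[ry [/= d1 d2]] Ey]; split=> //; rewrite -d1 -d2; case: (denom a y k).
apply: measurableI; last exact: measurable_preimT.
apply: measurableI; first exact: measurable_regular.
apply: measurableI; rewrite -[X in measurable X]setTI.
  by apply: m1 => //; exact: measurable_set1.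
by apply: m2 => //; exact: measurable_set1.
Qed.

(** The union over all times is estimated at once, because the class bound for a pair [(q', q)] does
    not see the time; [D = q - q' * (1 - dl)] bounds [q + q' * x] from below on [E]. *)
Lemma P0_denom_cells (dl l : R) (E : set X) (p : 'I_N.+1 * 'I_N.+1) :
  0 < dl <= 1 -> 0 <= l -> measurable E ->
  (forall x, E x -> dl <= 1 + (x : R)) -> (forall x y, E x -> E y -> `|x - y : R| <= l) ->
  (P0 (\bigcup_(k : 'I_N.*2) denom_cell k E p) <= (20 * l *
    (if (p.2 <= p.1)%N && (0 < p.1)%N then ((p.1%:R - p.2%:R * (1 - dl)) ^+ 2)^-1 else 0))%:E)%E.
Proof.
move=> /andP[d0 d1] l0 mE Ed El.
have mU : measurable (\bigcup_(k : 'I_N.*2) denom_cell k E p).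
  by apply: fin_bigcup_measurable => [|k _]; [exact: finite_finset|exact: measurable_denom_cell].
case: ifPn => [/andP[p21 p0]|np]; last first.
  rewrite mulr0 (_ : \bigcup_(k : 'I_N.*2) denom_cell k E p = set0) ?measure0//.
  apply/seteqP; split=> // y [k _ [ry dk Ey]].
  have [_ [_ [q' [q [_ [ek qq _ _ _]]]]]] := denom_convergent a01 k ry.
  move: ek qq np; rewrite dk => -[/eqP + /eqP]; rewrite !eqr_nat => /eqP -> /eqP -> ->//.
have q0 : 0 < p.1%:R :> R by rewrite ltr0n.
have q21 : p.2%:R <= p.1%:R :> R by rewrite ler_nat.
have D0 : 0 < p.1%:R - p.2%:R * (1 - dl).
  have : p.2%:R * (1 - dl) <= p.1%:R * (1 - dl) by apply: ler_wpM2r => //; lra.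
  have : 0 < p.1%:R * dl by rewrite mulr_gt0.
  lra.
rewrite P0E; apply: (@lebesgue_denom_class _ a a01 E p.2 p.1) => //.
- by apply: measurableI => //; exact: measurable_itv.
- move=> x /Ed hx; have : p.2%:R * (dl - 1) <= p.2%:R * x by apply: ler_wpM2l => //; lra.
  lra.
by move=> y [_ [k _ [ry dk Ey]]]; split=> //; exists k.
Qed.

(** Visits are sorted by the pair of denominators. A pair occurs at most once along an orbit, so for
    a fixed pair the cells at different times are disjoint and their measures add up to that of the
    union. *)
Lemma occupation_interval_le (dl l : R) (E : set X) :
  0 < dl <= 1 -> 0 <= l -> measurable E ->
  (forall x, E x -> dl <= 1 + (x : R)) -> (forall x y, E x -> E y -> `|x - y : R| <= l) ->
  (occupation E <= (20 * ((1 + ln N%:R) / dl + 2 / dl ^+ 2) * l)%:E)%E.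
Proof.
move=> d01 l0 mE Ed El.
apply: (@le_trans _ _ (\sum_(k < N.*2) \sum_p P0 (denom_cell k E p))%E).
  apply: lee_sum => k _.
  apply: (le_trans _ (measure_bigsetU_le P0 (fun p => measurable_denom_cell k p mE))).
  apply: le_measure; rewrite ?inE.
  - exact: measurable_early_iter.
  - by apply: bigsetU_measurable => p _; exact: measurable_denom_cell.
  move=> y [[ry yN] Ey]; rewrite -bigcup_seq.
  have [_ [_ [q' [q [_ [ek /andP[q'q q0] _ _ _]]]]]] := denom_convergent a01 k ry.
  move: yN; rewrite ek/= ler_nat => qN.
  have q1 : (q < N.+1)%N by rewrite ltnS.
  have q2 : (q' < N.+1)%N by rewrite ltnS (leq_trans q'q).
  by exists (Ordinal q1, Ordinal q2) => //=; rewrite mem_index_enum.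
rewrite exchange_big/=.
apply: (@le_trans _ _ (\sum_(p : 'I_N.+1 * 'I_N.+1) (20 * l *
    (if (p.2 <= p.1)%N && (0 < p.1)%N then ((p.1%:R - p.2%:R * (1 - dl)) ^+ 2)^-1 else 0))%:E)%E).
  apply: lee_sum => p _; rewrite -measure_bigcup_fin; first exact: P0_denom_cells.
    by move=> k; exact: measurable_denom_cell.
  apply/trivIsetP => j k _ _ jk; apply/seteqP; split=> // y [[ry dj _] [_ dk _]].
  by move/eqP: jk; apply; apply/val_inj/(denom_inj a01 ry); rewrite dj dk.
rewrite sumEFin lee_fin -mulr_sumr [leRHS]mulrAC; apply: ler_wpM2l; first by rewrite mulr_ge0.
rewrite -(pair_bigA _ (fun q i : 'I_N.+1 =>
  if (i <= q)%N && (0 < q)%N then ((q%:R - i%:R * (1 - dl)) ^+ 2)^-1 else 0))/=.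
exact: sum_denom_weights.
Qed.

(** The interval bound is applied to the occupation measure restricted to [E], so that the pieces
    keep [dl <= 1 + x]. *)
Lemma occupation_le (dl : R) (E : set X) : 0 < dl <= 1 -> measurable E ->
  (forall x, E x -> dl <= 1 + (x : R)) ->
  (occupation E <= (20 * ((1 + ln N%:R) / dl + 2 / dl ^+ 2))%:E * leb E)%E.
Proof.
move=> d01 mE Ed; have /andP[d0 d1] := d01.
have [nu nuE] := occupation_exists P0 (N.*2) measurable_early mi.
have mid : measurable_fun setT (@id X) by [].
have [m mE'] := pushforward_restrP nu mE mid.
have -> : occupation E = m setT by rewrite mE' setIT nuE.
have -> : m setT = m E by rewrite !mE' preimage_setT setIT preimage_id setIid.
apply: le_lebesgue_of_intervals => //.
  have : 0 <= ln N%:R :> R by rewrite ln_ge0// ler1n.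
  by move=> h; rewrite mulr_gt0// addr_gt0 ?divr_gt0 ?exprn_gt0//; lra.
move=> u v uv; rewrite mE' nuE; apply: occupation_interval_le => //.
- by lra.
- by apply: measurableI => //; exact: measurable_itv.
- by move=> x [/Ed].
by move=> x y [_ /=] + [_ /=]; rewrite !in_itv/= ler_norml; lra.
Qed.

(** At the first time [n] with [q_n > N], the inequalities [x_n >= a - 1] and [q_(n-1) <= q_n] give
    [q_n + q_(n-1) * x_n >= a * q_n > a * N]. By [ln_denom] the logarithms of the iterates before
    [n], all of them at early times, add up to at least [ln (a * N)]. *)
Lemma occupation_mass_ge : 1 <= a * N%:R ->
  ((ln (a * N%:R))%:E <= \sum_(0 <= i <oo) occupation (nball i))%E.
Proof.
move=> aN; have lN : 0 <= ln (a * N%:R) by exact: ln_ge0.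
have H := @occupation_mass _ P0 N.*2 _ _ measurable_early mi _ _ lN (measurable_regular a).
have P1 := P0_regular.
suff key : forall y, regular a y ->
    ln (a * N%:R) <= \sum_(k < N.*2) (\1_(early k) y * neglog (iter k T y)).
  by have := H key; rewrite [X in (_ * X)%E]P1 mule1.
move=> y ry.
have [n [nN nK nlt]] : exists n, [/\ (denom a y n).2 > N%:R, (n <= N.*2)%N & forall k, (k < n)%N -> (denom a y k).2 <= N%:R].
  have ex : exists n, N%:R < (denom a y n).2.
    by exists N.*2; rewrite ltNge; apply/negP => h; have : early N.*2 y by []; rewrite early_max.
  exists (ex_minn ex); case: ex_minnP => n nN nmin; split=> //.
    by apply: nmin; rewrite ltNge; apply/negP => h; have : early N.*2 y by []; rewrite early_max.
  by move=> k kn; rewrite leNgt; apply/negP => /nmin; rewrite leqNgt kn.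
have [D1 lnD] := ln_denom a01 n ry.
apply: (@le_trans _ _ (\sum_(j < n) neglog (iter j T y : R))).
  rewrite -lnD ler_ln ?posrE//; [|lra|lra].
  have /andP[x1 _] := regular_itv n ry.
  have [_ [_ [q' [q [_ [dk /andP[q'q _] _ _ _]]]]]] := denom_convergent a01 n ry.
  move: nN D1; rewrite dk/= => nN _; case/andP: a01 => a0 a1.
  have q'q' : q'%:R <= q%:R :> R by rewrite ler_nat.
  have q'0 : 0 <= q'%:R :> R by [].
  move: x1; set x : R := iter n _ y => x1.
  have : q'%:R * (a - 1) <= q'%:R * x by apply: ler_wpM2l.
  have : q%:R * (1 - a) >= q'%:R * (1 - a) by apply: ler_wpM2r => //; lra.
  have : a * N%:R <= a * q%:R by rewrite ler_pM2l// ltW.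
  lra.
rewrite (big_ord_widen N.*2 (fun j => neglog (iter j T y : R)) nK) big_mkcond/=.
apply: ler_sum => k _; case: ifP => kn; last by rewrite mulr_ge0// neglog_ge0.
by rewrite indicE mem_set ?mul1r//; split=> //; exact: nlt.
Qed.

End Occupation.

(** * Ultralimits of probability measures *)

Section Ultralimits.
Context {R : realType} {J : Type}.
Implicit Types (F : set_system J) (u : J -> R).

Lemma ultra_cvg F u lo hi : UltraFilter F -> (forall j, lo <= u j <= hi) ->
  exists l : R, u @ F --> l.
Proof.
move=> UF uB; have FF : ProperFilter F by exact: ultra_proper.
have [l [_ cl]] : `[lo, hi]%classic `&` cluster (u @ F) !=set0.
  have : F (u @^-1` `[lo, hi]%classic) by apply: filterE => j; rewrite /= in_itv/=; exact: uB.
  exact: segment_compact.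
exists l => U Ul; have [//|FU] := in_ultra_setVsetC (u @^-1` U) UF.
have [x [/= xU Ux]] := cl (~` U) U FU Ul.
by have : False by exact: xU.
Qed.

(** Convergence is reduced to identifying ultralimits: if [U] failed, [F] traced on the complement
    of the preimage of [U] would extend to an ultrafilter along which the limit is missed. *)
Lemma cvg_ultra F u (l : R) : ProperFilter F ->
  (forall G, UltraFilter G -> F `<=` G -> u @ G --> l) -> u @ F --> l.
Proof.
move=> FF h U Ul; apply: contrapT => nFU.
have PW : ProperFilter (within (~` (u @^-1` U)) F).
  split; last exact: within_filter.
  rewrite /within/= => F0; apply: nFU; apply: filterS F0 => j /= j0.
  by apply: contrapT => /j0.
have [G [UG WG]] := ultraFilterLemma PW.
have GF : F `<=` G by move=> A FA; apply: WG; apply: filterS FA => j ? _.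
have PG : ProperFilter G by exact: ultra_proper.
have G1 : G (u @^-1` U) by exact: h.
have G2 : G (~` (u @^-1` U)) by apply: WG; rewrite /within/=; exact: filterE.
by have [j []] := filter_ex (filterI G1 G2).
Qed.

End Ultralimits.

Section Contents.
Context d (X : measurableType d) (R : realType).

Definition is_content (lam : set X -> R) : Prop :=
  [/\ forall A, 0 <= lam A, lam setT = 1 &
      forall A B, measurable A -> measurable B -> A `&` B = set0 ->
        lam (A `|` B) = lam A + lam B].

(** Finite additivity passes to limits along the ultrafilter; countable additivity does not in
    general. *)
Lemma ultralimit_content J (F : set_system J) (P : J -> probability X R) :
  UltraFilter F -> exists2 lam : set X -> R, is_content lam &
    forall A, measurable A -> (fun j => fine (P j A)) @ F --> lam A.
Proof.
move=> UF; have FF : ProperFilter F by exact: ultra_proper.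
have /choice[lam lamP] : forall A : set X, exists l : R,
    0 <= l /\ (measurable A -> (fun j => fine (P j A)) @ F --> l).
  move=> A; have [mA|nA] := pselect (measurable A); last by exists 0.
  have [|l cl] := @ultra_cvg R J F (fun j => fine (P j A)) 0 1 UF.
    by move=> j; rewrite pr_ge0 pr_le1.
  exists l; split=> // ; have <- := cvg_lim (@Rhausdorff R) cl.
  apply: limr_ge; first by apply/cvg_ex; exists l.
  by apply: filterE => j; exact: pr_ge0.
exists lam; last by move=> A; have [] := lamP A.
split; first by move=> A; have [] := lamP A.
  have [_ /(_ measurableT) h] := lamP setT.
  have h1 : (fun j => fine (P j setT)) @ F --> (1 : R).
    by rewrite (_ : (fun j => _) = cst 1); [exact: cvg_cst|apply/funext => j; rewrite probability_setT].
  exact: (cvg_unique (@Rhausdorff R) h h1).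
move=> A B mA mB AB.
have [_ /(_ mA) hA] := lamP A; have [_ /(_ mB) hB] := lamP B.
have [_ /(_ (measurableU _ _ mA mB)) hAB] := lamP (A `|` B).
have h1 : (fun j => fine (P j (A `|` B))) @ F --> lam A + lam B.
  rewrite (_ : (fun j => _) = (fun j => fine (P j A) + fine (P j B))); first exact: cvgD.
  by apply/funext => j; rewrite measureU// fineD ?fin_num_measure.
exact: (cvg_unique (@Rhausdorff R) hAB h1).
Qed.

Section Content.
Variable lam : set X -> R.
Hypothesis cl : is_content lam.

Lemma content_le A B : measurable A -> measurable B -> A `<=` B -> lam A <= lam B.
Proof.
case: cl => l0 _ lU mA mB AB; rewrite -(setDUK AB) lU//; last 2 first.
  - exact: measurableD.
  - by rewrite setDE setICA setICr setI0.
by rewrite lerDl.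
Qed.

Lemma content0 : lam set0 = 0.
Proof.
case: cl => _ _ lU; have := lU set0 set0 measurable0 measurable0; rewrite set0I setU0 => /(_ erefl).
lra.
Qed.

Lemma content_le1 A : measurable A -> lam A <= 1.
Proof. by move=> mA; case: cl => _ <- _; exact: content_le. Qed.

Lemma content_setC A : measurable A -> lam (~` A) = 1 - lam A.
Proof.
move=> mA; case: cl => _ l1 lU; rewrite -l1 -(setUv A) lU ?setICr//; last exact: measurableC.
by rewrite addrC addKr.
Qed.

Lemma content_inside (I A : set X) :
  measurable I -> measurable A -> lam (~` I) = 0 -> lam A = lam (I `&` A).
Proof.
move=> mI mA l0; have mIA := measurableI _ _ mI mA.
have mCA := measurableI _ _ (measurableC mI) mA; case: (cl) => lge _ lU.
have z : lam (~` I `&` A) = 0.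
  apply/eqP; rewrite eq_le lge andbT -l0; apply: content_le => //; exact: measurableC.
rewrite -[in LHS](setTI A) -(setUv I) setIUl lU ?z ?addr0//.
by rewrite setIACA setICr set0I.
Qed.

Lemma content_bigU (G : nat -> set X) n : (forall i, measurable (G i)) -> trivIset setT G ->
  lam (\big[setU/set0]_(i < n) G i) = \sum_(i < n) lam (G i).
Proof.
move=> mG tG; elim: n => [|n IH]; first by rewrite !big_ord0 content0.
rewrite !big_ord_recr/= -IH; case: cl => _ _ ->//.
  exact: bigsetU_measurable.
rewrite -bigcup_mkord setI_bigcupl bigcup0// => i /= ni.
by apply: (trivIset_disj tG); rewrite neq_ltn ni.
Qed.

(* Countable additivity is inherited from the dominating measure. *)
Lemma content_probability (nu : {measure set X -> \bar R}) : (nu setT < +oo)%E ->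
  (forall A, measurable A -> lam A <= fine (nu A)) ->
  exists P : probability X R, forall A, measurable A -> P A = (lam A)%:E.
Proof.
move=> nuoo lnu; case: (cl) => l0 l1 lU.
have nufin A : measurable A -> nu A \is a fin_num.
  move=> mA; rewrite ge0_fin_numE//; apply: le_lt_trans nuoo.
  by apply: le_measure; rewrite ?inE.
have [||||P PE] := @probability_of_funP _ X R (fun A => (lam A)%:E).
- by rewrite content0.
- by move=> A; rewrite lee_fin.
- move=> G mG tG mU.
  have cvnu := @measure_semi_sigma_additive _ _ _ nu G mG tG mU.
  have -> : (fun n => \sum_(0 <= i < n) (lam (G i))%:E)%E = EFin \o (fun n => \sum_(i < n) lam (G i)).
    by apply/funext => n /=; rewrite sumEFin big_mkord.
  apply: cvg_EFin; first exact: filterE.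
  rewrite (_ : fine \o _ = (fun n => \sum_(i < n) lam (G i))); last by apply/funext.
  have mB n : measurable (\big[setU/set0]_(i < n) G i) by exact: bigsetU_measurable.
  have sB n : \big[setU/set0]_(i < n) G i `<=` \bigcup_n G n.
    by rewrite -bigcup_mkord; exact: bigcup_subset.
  have mD n : measurable (\bigcup_n G n `\` \big[setU/set0]_(i < n) G i) by exact: measurableD.
  have dis n : (\big[setU/set0]_(i < n) G i) `&` (\bigcup_n G n `\` \big[setU/set0]_(i < n) G i) = set0.
    by rewrite setDE setICA setICr setI0.
  (* What [lam] loses on the tail of the union is at most what [nu] loses there, and the latter
     tends to 0. *)
  apply: (@squeeze_cvgr _ _ _ _ (fun n => lam (\bigcup_n G n) -
      (fine (nu (\bigcup_n G n)) - fine (\sum_(0 <= i < n) nu (G i))%E)) (fun=> lam (\bigcup_n G n))).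
  + near=> n; rewrite -content_bigU//.
    have e1 : lam (\bigcup_n G n) = lam (\big[setU/set0]_(i < n) G i) + lam (\bigcup_n G n `\` \big[setU/set0]_(i < n) G i).
      by rewrite -lU// setDUK.
    have e2 : nu (\bigcup_n G n) = (nu (\big[setU/set0]_(i < n) G i) + nu (\bigcup_n G n `\` \big[setU/set0]_(i < n) G i))%E.
      by rewrite -measureU// setDUK.
    have e3 : (\sum_(0 <= i < n) nu (G i))%E = nu (\big[setU/set0]_(i < n) G i).
      by rewrite big_mkord; apply/esym; exact: measure_bigsetU.
    have e4 := lnu _ (mD n).
    rewrite content_le// andbT e3 e2 fineD ?nufin// [fine _ + _]addrC addrK.
    by rewrite e1 addrC; move: e4; lra.
  + rewrite -[X in _ --> X]subr0; apply: cvgB; first exact: cvg_cst.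
    rewrite -[X in _ --> X](subrr (fine (nu (\bigcup_n G n)))); apply: cvgB; first exact: cvg_cst.
    apply: fine_cvg; rewrite fineK ?nufin//.
  + exact: cvg_cst.
- by rewrite l1.
by exists P.
Unshelve. all: by end_near. Qed.

End Content.
End Contents.

Section AcipOfContent.
Context {R : realType}.
Let X := measurableTypeR R.
Local Notation leb := (@lebesgue_measure R).

(** Domination by a multiple of Lebesgue measure on [I_a] provides countable additivity, full mass
    on [I_a] and absolute continuity at once. *)
Lemma acip_of_content (a C : R) (lam : set X -> R) : is_content lam -> 0 <= C ->
  (forall A, measurable A -> lam A <= C * fine (leb (`[a - 1, a]%classic `&` A))) ->
  (forall A, measurable A -> lam (Talpha a @^-1` A) = lam A) ->
  exists P : probability X R, is_acip a P /\ forall A, measurable A -> P A = (lam A)%:E.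
Proof.
move=> cl C0 lC li; pose I : set X := `[a - 1, a]%classic.
have mI : measurable I by exact: measurable_itv.
have lI : leb I = 1%E.
  rewrite /I lebesgue_measure_itv/= lte_fin ltrBlDr ltrDl ltr01 -EFinB.
  by congr EFin; lra.
have mid : measurable_fun setT (@id X) by [].
have [m mE] := pushforward_restrP leb mI mid.
have [nu nuE] : exists nu : {measure set X -> \bar R}, forall A, nu A = (C%:E * leb (I `&` A))%E.
  by exists (mscale (NngNum C0) m) => A; exact: (congr1 (fun z => C%:E * z)%E (mE A)).
have [||P PE] := @content_probability _ X R lam cl nu.
- by rewrite nuE setIT [X in (_ * X)%E]lI mule1 ltry.
- move=> A mA; apply: (le_trans (lC _ mA)); rewrite nuE -/I.
  have fI : leb (I `&` A) \is a fin_num.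
    rewrite ge0_fin_numE//; apply: (@le_lt_trans _ _ (leb I)); last by rewrite lI ltry.
    by apply: le_measure; rewrite ?inE//; exact: measurableI.
  by rewrite fineM.
exists P; split=> //; split.
- rewrite PE//; congr EFin; have lIC : lam (~` I) = 0.
    apply/eqP; rewrite eq_le; case: (cl) => -> _ _; rewrite andbT.
    by apply: (le_trans (lC _ (measurableC mI))); rewrite setICr measure0 mulr0.
  by have := content_setC cl mI; rewrite lIC => /eqP; rewrite eq_sym subr_eq0 => /eqP <-.
- move=> A mA; rewrite !PE// ?li//; apply: measurable_preimT => //; exact: measurable_Talpha.
apply/null_content_dominatesP => A mA A0; rewrite PE//; congr EFin.
apply/eqP; rewrite eq_le; case: (cl) => -> _ _; rewrite andbT.
apply: (le_trans (lC _ mA)); rewrite (_ : leb _ = 0%E) ?mulr0//.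
apply/eqP; rewrite eq_le measure_ge0 andbT -A0.
by apply: le_measure; rewrite ?inE//; exact: measurableI.
Qed.

End AcipOfContent.

(** * Total mass of the occupation measure *)

Section OccupationTotal.
Context {R : realType}.
Let X := measurableTypeR R.
Local Notation leb := (@lebesgue_measure R).
Variables (a : R) (N : nat) (P0 : probability X R).
Hypotheses (a01 : 0 < a <= 1) (N0 : (0 < N)%N).
Hypothesis P0E : forall A, P0 A = leb (`[a - 1, a[%classic `&` A).
Let Occ A := occupation a N P0 A.

Lemma occupation_ge0 A : (0 <= Occ A)%E.
Proof. exact: sume_ge0. Qed.

Lemma occupation_mono A B : measurable A -> measurable B -> A `<=` B -> (Occ A <= Occ B)%E.
Proof.
move=> mA mB AB; apply: lee_sum => k _; apply: le_measure; rewrite ?inE.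
- exact: measurable_early_iter.
- exact: measurable_early_iter.
by apply: setIS => y; exact: AB.
Qed.

Lemma occupation_fin A : measurable A -> Occ A \is a fin_num.
Proof. by move=> mA; rewrite /Occ occupationE. Qed.

Lemma occupation_out A : (forall x, A x -> ~ (a - 1 <= (x : R) < a)) -> Occ A = 0%E.
Proof.
move=> hA; apply: big1 => k _; rewrite (_ : _ `&` _ = set0) ?measure0//.
by apply/seteqP; split=> // y [[ry _] /hA]; apply; exact: regular_itv.
Qed.

Lemma occupation_total_gt0 : 0 < fine (Occ setT).
Proof.
rewrite /Occ occupationE//= -(prednK (_ : 0 < N.*2)%N) ?double_gt0// big_ord_recl/=.
apply: ltr_pwDl; last by apply: sumr_ge0 => i _; exact: pr_ge0.
rewrite preimage_setT setIT.
suff -> : early a N 0 = regular a :> set X by rewrite (P0_regular P0E).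
apply/seteqP; split=> y; first by case.
by move=> ry; split=> //=; rewrite ler1n.
Qed.

(* The logarithms of the iterates visited add up to about [ln N], and by
   [occupation_le] few visits are close to 0. *)
Lemma occupation_total_ge : 1 <= a * N%:R -> 10 * (2 - ln a) <= ln N%:R ->
  ln N%:R / 18 <= fine (Occ setT).
Proof.
move=> aN aL; have [a0 a1] := andP a01.
have N1 : 0 < N%:R :> R by rewrite ltr0n.
have h0 : (0 <= 2^-1 :> R) by rewrite invr_ge0.
have L0 : 0 <= ln N%:R :> R by rewrite ln_ge0// ler1n.
have oT := fineK (occupation_fin (@measurableT _ X)).
have H := occupation_mass_ge a01 P0E aN.
(* The first nine balls are charged with the whole mass. From [i = 9] on, [dl = 1/2] applies and the
   balls contribute at most [(160 * ln N + 800) / 512], less than half of [ln N] up to a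
   constant. *)
have S : (\sum_(0 <= i <oo) Occ (nball i) <=
    (9%:R * fine (Occ setT) + 2 * (80 * ln N%:R + 400) * 2^-1 ^+ 9)%:E)%E.
  apply: sum_series_le.
  - by move=> i; exact: occupation_ge0.
  - by lra.
  - by move=> i; rewrite oT; apply: occupation_mono => //; exact: measurable_nball.
  move=> i i9; have mB : measurable (nball i : set X) by exact: measurable_nball.
  have i1 : 2^-1 ^+ i <= 2^-1 :> R.
    by rewrite -[leRHS]expr1; apply: ler_wiXn2l; [lra|lra|lia].
  apply: (le_trans (occupation_le a01 N0 P0E (dl := 2^-1) _ mB _)).
  - by apply/andP; split; lra.
  - by move=> x; rewrite /nball/= ltr_norml => /andP[? ?]; lra.
  have lB := @lebesgue_nball R i.
  set c : R := 20 * _.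
  have cE : c = 40 * ln N%:R + 200 by rewrite /c; field.
  have c0 : 0 <= c by rewrite cE; lra.
  apply: (le_trans (lee_wpmul2l _ lB)); first by rewrite lee_fin.
  by rewrite -EFinM lee_fin cE; lra.
have := le_trans H S; rewrite lee_fin lnM ?posrE//.
have -> : 2^-1 ^+ 9 = 512^-1 :> R by rewrite exprVn; congr (_^-1); rewrite -natrX.
lra.
Qed.

End OccupationTotal.

Section DensityBound.
Context {R : realType}.
Let X := measurableTypeR R.
Local Notation leb := (@lebesgue_measure R).
Variables (a : R) (mu : probability X R).
Hypotheses (a01 : 0 < a <= 1) (hmu : is_unique_acip a mu).
Let T : X -> X := Talpha a.
Let mT : measurable_fun setT T. Proof. exact: measurable_Talpha. Qed.

Lemma near_ln_ge (c : R) : \forall n \near \oo, c <= ln n.+1%:R.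
Proof.
near=> n; rewrite -(expRK c) ler_ln ?posrE ?expR_gt0//.
have : expR c <= n%:R by near: n; exact: nbhs_infty_ger.
by move=> h; apply: (le_trans h); rewrite ler_nat.
Unshelve. all: by end_near. Qed.

(** The origin of 720: [1 + L + 2 / e <= 2 * L <= 36 * Z], and [720 = 20 * 36]. *)
Lemma occupation_rate (e L Z : R) : 0 < e -> 1 + 2 / e <= L -> L / 18 <= Z ->
  20 * ((1 + L) / e + 2 / e ^+ 2) <= 720 / e * Z.
Proof.
move=> e0 L1 LZ.
have -> : 20 * ((1 + L) / e + 2 / e ^+ 2) = 20 / e * (1 + L + 2 / e).
  by field; rewrite gt_eqF.
have -> : 720 / e * Z = 20 / e * (36 * Z) by field; rewrite gt_eqF.
by rewrite ler_pM2l ?divr_gt0//; lra.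
Qed.

Lemma occupation_drift (e L Z : R) : 0 < e -> 18 / e <= L -> L / 18 <= Z -> 1 <= e * Z.
Proof.
move=> e0 L1 LZ; have : e * (L / 18) <= e * Z by rewrite ler_pM2l.
by move: L1; rewrite ler_pdivrMr//; lra.
Qed.

Lemma normalized_occupation (P0 : probability X R) :
  (forall A, P0 A = leb (`[a - 1, a[%classic `&` A)) ->
  exists P : nat -> probability X R, forall n A,
    P n A = ((fine (occupation a n.+1 P0 setT))^-1%:E * occupation a n.+1 P0 A)%E.
Proof.
move=> P0E.
suff : forall n, exists Q : probability X R, forall A,
    Q A = ((fine (occupation a n.+1 P0 setT))^-1%:E * occupation a n.+1 P0 A)%E.
  by move=> /choice[P PE]; exists P.
move=> n; have Z0 := occupation_total_gt0 (ltn0Sn n) P0E.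
have Zi : 0 <= (fine (occupation a n.+1 P0 setT))^-1 by rewrite invr_ge0 ltW.
have [nu nuE] := occupation_exists P0 (n.+1.*2) (measurable_early a n.+1) (fun k => measurable_iter mT k).
have [||||Q QE] := @probability_of_funP _ X R (mscale (NngNum Zi) nu).
- by rewrite measure0.
- by move=> A; exact: measure_ge0.
- exact: measure_semi_sigma_additive.
- rewrite /mscale/= nuE -/(occupation a n.+1 P0 setT).
  rewrite -[X in (_ * X)%E]fineK; last exact: occupation_fin.
  by rewrite -EFinM mulVf// gt_eqF.
by exists Q => A; rewrite QE /mscale/= nuE.
Qed.

Lemma acip_density_bound (dl : R) (E : set X) : 0 < dl <= 1 -> measurable E ->
  (forall x, E x -> dl <= 1 + (x : R)) -> (mu E <= (720 / dl)%:E * leb E)%E.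
Proof.
move=> d01 mE Ed.
have [P0 P0E] := lebesgue_unit_probability a.
have [P PE] := normalized_occupation P0E.
pose Z n := fine (occupation a n.+1 P0 setT).
have Z0 n : 0 < Z n by exact: occupation_total_gt0.
have PZ n A : measurable A -> fine (P n A) = (Z n)^-1 * fine (occupation a n.+1 P0 A).
  by move=> mA; rewrite PE fineM//; exact: occupation_fin.
have [G [UG ooG]] := @ultraFilterLemma nat \oo _.
have PG : ProperFilter G by exact: ultra_proper.
have [lam cl lamP] := ultralimit_content P UG.
have nearZ : \forall n \near \oo, ln n.+1%:R / 18 <= Z n.
  near=> n; apply: occupation_total_ge => //.
    rewrite -ler_pdivrMl; last by case/andP: a01.
    have : a^-1 * 1 <= n%:R by near: n; exact: nbhs_infty_ger.
    by move=> h; apply: (le_trans h); rewrite ler_nat.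
  by near: n; exact: near_ln_ge.
have star (e : R) (B : set X) : 0 < e <= 1 -> measurable B -> (forall x, B x -> e <= 1 + (x : R)) ->
    (leb B < +oo)%E -> lam B <= 720 / e * fine (leb B).
  move=> e01 mB Be Boo; have [e0 e1] := andP e01.
  have lB := cvg_lim (@Rhausdorff R) (lamP _ mB); rewrite -lB.
  apply: limr_le; first by apply/cvg_ex; exists (lam B); exact: lamP.
  apply: ooG; near=> n; rewrite PZ//.
  have L1 : 1 + 2 / e <= ln n.+1%:R by near: n; exact: near_ln_ge.
  have Zn : ln n.+1%:R / 18 <= Z n by near: n.
  have Bfin : leb B \is a fin_num by rewrite ge0_fin_numE.
  have h1 : fine (occupation a n.+1 P0 B) <=
      20 * ((1 + ln n.+1%:R) / e + 2 / e ^+ 2) * fine (leb B).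
    rewrite -lee_fin EFinM !fineK//; last exact: occupation_fin.
    exact: occupation_le.
  rewrite mulrC ler_pdivrMr//; apply: (le_trans h1).
  rewrite [leRHS]mulrAC; apply: ler_wpM2r; first by rewrite fine_ge0.
  exact: occupation_rate.
have inv A : measurable A -> lam (T @^-1` A) = lam A.
  move=> mA; have mTA : measurable (T @^-1` A) by exact: measurable_preimT.
  have h : (fun j => fine (P j (T @^-1` A)) - fine (P j A)) @ G --> lam (T @^-1` A) - lam A.
    by apply: cvgB; exact: lamP.
  apply/eqP; rewrite -subr_eq0; apply/eqP; apply: (cvg_unique (@Rhausdorff R) h).
  apply: cvg_trans; first exact: (cvg_app _ ooG).
  apply/cvgrPdist_le => e e0; near=> n.
  rewrite sub0r normrN /= !PZ// -mulrBr normrM ger0_norm ?invr_ge0 ?(ltW (Z0 n))//.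
  rewrite mulrC ler_pdivrMr//.
  have Zn : ln n.+1%:R / 18 <= Z n by near: n.
  have L1 : 18 / e <= ln n.+1%:R by near: n; exact: near_ln_ge.
  apply: (@le_trans _ _ 1); first exact: occupation_invariant.
  exact: (occupation_drift e0 L1 Zn).
have [a0 a1] := andP a01.
have mI : measurable (`[a - 1, a]%classic : set X) by exact: measurable_itv.
have lz : lam (~` `[a - 1, a]%classic) = 0.
  apply: (cvg_unique (@Rhausdorff R) (lamP _ (measurableC mI))).
  rewrite (_ : (fun j => _) = cst 0); first exact: cvg_cst.
  apply/funext => n; rewrite PZ; last exact: measurableC.
  rewrite occupation_out ?mulr0// => x /= nI /andP[? ?]; apply: nI.
  by rewrite in_itv/=; apply/andP; split; lra.
(* All of [I_a] satisfies [1 + x >= a], so [star] at [e = a] makes [lam] an acip. Uniqueness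
   identifies it with [mu], and [star] at [e = dl] then gives the claim. *)
have [||Q [Qa QE]] := @acip_of_content R a (720 / a) lam cl _ _ inv.
- by apply: divr_ge0; [exact: ler0n|exact: ltW].
- move=> A mA; rewrite (content_inside cl mI mA lz); apply: star => //.
  + by apply: measurableI => //; exact: measurable_itv.
  + by move=> x [/=]; rewrite in_itv/= => /andP[? ?] _; lra.
  + apply: (@le_lt_trans _ _ (leb `[a - 1, a]%classic)).
      by apply: le_measure; rewrite ?inE//; apply: measurableI => //; exact: measurable_itv.
    by rewrite lebesgue_measure_itv/= lte_fin ltrBlDr ltrDl ltr01 -EFinB ltry.
have [_ uniq] := hmu.
have [Eoo|] := ltP (leb E) +oo%E; last first.
  rewrite leye_eq => /eqP ->; rewrite gt0_muley; first exact: leey.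
  by rewrite lte_fin; apply: divr_gt0; [rewrite ltr0n|case/andP: d01].
rewrite -(uniq Q Qa)// QE// -[X in (_ * X)%E]fineK; last by rewrite ge0_fin_numE.
by rewrite -EFinM lee_fin; exact: star.
Unshelve. all: by end_near. Qed.

End DensityBound.

(** * Rokhlin's formula for bounded densities *)

Section Rokhlin.
Context {R : realType}.
Let X := measurableTypeR R.
Local Notation leb := (@lebesgue_measure R).

Lemma acip_inside (a : R) (mu : probability X R) (A : set X) : is_acip a mu -> measurable A ->
  mu A = mu (`[a - 1, a]%classic `&` A).
Proof.
move=> [m1 _ _] mA; have mI : measurable (`[a - 1, a]%classic : set X) by exact: measurable_itv.
have mIA := measurableI _ _ mI mA; have mCA := measurableI _ _ (measurableC mI) mA.
have z : mu (~` `[a - 1, a]%classic `&` A) = 0%E.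
  apply/eqP; rewrite eq_le measure_ge0 andbT.
  apply: (@le_trans _ _ (mu (~` `[a - 1, a]%classic))).
    by apply: le_measure; rewrite ?inE//; exact: measurableC.
  by rewrite probability_setC// [X in (1 - X)%E]m1 subee.
rewrite -[in LHS](setTI A) -(setUv `[a - 1, a]%classic) setIUl measureU//.
  by rewrite [X in (_ + X)%E]z adde0.
by rewrite setIACA setICr set0I.
Qed.

Section Bounded.
Variables (C : R) (mu : probability X R).
Hypotheses (C0 : 0 < C) (muC : forall A, measurable A -> (mu A <= C%:E * leb A)%E).

Lemma nball_le i : (mu (nball i) <= (2 * C * 2^-1 ^+ i)%:E)%E.
Proof.
have h0 : (0 <= 2^-1 :> R) by rewrite invr_ge0.
have mB : measurable (nball i : set X) by exact: measurable_nball.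
apply: (le_trans (muC mB)).
have lB := @lebesgue_nball R i.
apply: (le_trans (lee_wpmul2l _ lB)); first by rewrite lee_fin ltW.
by rewrite -EFinM lee_fin; lra.
Qed.

Lemma neglog_tail_le m :
  (\int[mu]_(x in nball m) (neglog x)%:E <= (2 * C * 2^-1 ^+ m * (m%:R + 2))%:E)%E.
Proof.
apply: neglog_tail; first by rewrite mulr_ge0// ltW.
by move=> i _; exact: nball_le.
Qed.

Lemma neglog_integral_fin : exists2 I : R, 0 <= I & (\int[mu]_x (neglog x)%:E)%E = I%:E.
Proof.
have g0 : (0 <= \int[mu]_x (neglog x)%:E)%E.
  by apply: integral_ge0 => x _; rewrite lee_fin neglog_ge0.
have [M hM] := @expR_small R 0 1 ltr01.
have h := neglog_integral_le mu (ltr01 : (0 : R) < 1) hM.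
have fin : (\int[mu]_x (neglog x)%:E)%E \is a fin_num.
  rewrite ge0_fin_numE//; apply: (le_lt_trans h).
  by apply: lte_add_pinfty; rewrite ?ltry//; apply: (le_lt_trans (neglog_tail_le 0)); rewrite ltry.
by exists (fine (\int[mu]_x (neglog x)%:E)%E); rewrite ?fine_ge0 ?fineK.
Qed.

Lemma ks_entropy_rokhlin (a I : R) : 0 < a <= 1 -> is_acip a mu ->
  (\int[mu]_x (neglog x)%:E)%E = I%:E -> ks_entropy mu (Talpha a) = (2 * I)%:E.
Proof.
move=> a01 mua hI; apply/eqP; rewrite eq_le; apply/andP; split.
  apply: ub_ereal_sup => _ [k [Q [pQ ->]]]; rewrite lee_fin.
  by apply: (entropy_of_partition_le a01 C0 mua muC pQ); rewrite hI.
apply/lee_addgt0Pr => e e0.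
have [k [Q [pQ h]]] := entropy_of_partition_ge a01 C0 mua muC hI e0.
apply: (@le_trans _ _ ((entropy_of_partition mu (Talpha a) Q)%:E + e%:E)%E).
  by rewrite -EFinD lee_fin; move: h; lra.
by apply: leeD => //; apply: ereal_sup_ubound; exists k, Q.
Qed.

End Bounded.
End Rokhlin.

(** * Dependence on the parameter *)

Section IntegralApprox.
Context {R : realType}.
Let X := measurableTypeR R.
Local Notation leb := (@lebesgue_measure R).

(** The mesh [e], the tolerance [eta] and the number [M] of levels depend on [D] and [ep] only, so
    measures with a common bound near 0 are compared on the same finitely many level sets. The ball
    [nball 0] is left out since it reaches -1, where no uniform bound holds. *)
Lemma neglog_integral_approx (D ep : R) : 0 <= D -> 0 < ep ->
  exists (e eta : R) (M : nat), [/\ 0 < e, 0 < eta &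
    forall P : probability X R,
    (forall i, (0 < i)%N -> (P (nball i) <= (D * 2^-1 ^+ i)%:E)%E) ->
    forall w : nat -> R, (forall i : nat, (i < M)%N -> fine (P (nlevel (i.+1%:R * e))) <= w i + eta) ->
    (\int[P]_x (neglog x)%:E <= (\sum_(i < M) e * w i + ep)%:E)%E].
Proof.
move=> D0 ep0; have D1 : 0 < D + 1 by lra.
have [m hm m2] := @small_tail R (D + 1) 0 ep D1 (lexx 0) ep0.
have e0 : 0 < ep / 4 by lra.
have [M hM] := @expR_small R m (ep / 4) e0.
have eta0 : 0 < (M.+1%:R : R)^-1 by rewrite invr_gt0.
exists (ep / 4), (M.+1%:R^-1), M; split=> // P Pn w Pw.
apply: (le_trans (neglog_integral_le P e0 hM)).
apply: (@le_trans _ _ ((ep / 4 + \sum_(i < M) (ep / 4) * (w i + M.+1%:R^-1))%:E +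
    (D * 2^-1 ^+ m * (m%:R + 2))%:E)%E).
  apply: leeD.
    rewrite lee_fin lerD2l; apply: ler_sum => i _.
    by rewrite ler_pM2l//; exact: Pw.
  apply: neglog_tail => // i mi; apply: Pn; exact: (leq_trans (ltnW m2) mi).
rewrite -EFinD lee_fin.
have -> : \sum_(i < M) ep / 4 * (w i + M.+1%:R^-1) =
    \sum_(i < M) ep / 4 * w i + ep / 4 * (M%:R * M.+1%:R^-1).
  rewrite [in RHS](_ : M%:R * M.+1%:R^-1 = \sum_(i < M) M.+1%:R^-1); last first.
    by rewrite sumr_const card_ord mulr_natl.
  by rewrite mulr_sumr -big_split/=; apply: eq_bigr => i _; rewrite mulrDr.
have h1 : M%:R * M.+1%:R^-1 <= 1 :> R by rewrite ler_pdivrMr// mul1r ler_nat.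
have h2 : ep / 4 * (M%:R * M.+1%:R^-1) <= ep / 4 by rewrite ger_pMr.
have h3 : 0 <= 2^-1 ^+ m * (m%:R + 2) :> R.
  by rewrite mulr_ge0 ?exprn_ge0 ?invr_ge0// addr_ge0.
move: hm h2 h3; move: (2^-1 ^+ m) (m%:R + 2) (ep / 4 * (M%:R * _)) => p q u hm h2 h3.
by lra.
Qed.

End IntegralApprox.

(** The two maps can differ only where [Talpha b] leaves [[a - 1, a[]; by invariance under
    [Talpha b], that set has the [nu]-mass of the complement of [[a - 1, a[]. *)
Lemma acip_preimage_diff (R : realType) (a b : R) (nu : probability (measurableTypeR R) R)
    (E : set (measurableTypeR R)) : is_acip b nu -> measurable E ->
  `|fine (nu (Talpha a @^-1` E)) - fine (nu E)| <= fine (nu (~` `[a - 1, a[%classic)).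
Proof.
move=> [_ inv _] mE; set X := measurableTypeR R in nu E inv mE *.
have mI : measurable (~` `[a - 1, a[%classic : set X) by apply: measurableC; exact: measurable_itv.
have mTb : measurable_fun setT (Talpha b : X -> X) by exact: measurable_Talpha.
have mTa : measurable_fun setT (Talpha a : X -> X) by exact: measurable_Talpha.
pose N : set X := Talpha b @^-1` (~` `[a - 1, a[%classic).
have mN : measurable N by exact: measurable_preimT.
have mA : measurable (Talpha a @^-1` E : set X) by exact: measurable_preimT.
have mB : measurable (Talpha b @^-1` E : set X) by exact: measurable_preimT.
have NE x : ~ N x -> Talpha a x = Talpha b x.
  rewrite /N /preimage/= => nN; apply: Talpha_eq; apply: contrapT => h; apply: nN => /=.
  by rewrite in_itv/=.
have -> : nu (~` `[a - 1, a[%classic) = nu N by rewrite -(inv _ mI).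
have le2 (A B : set X) : measurable A -> measurable B -> A `<=` B `|` N ->
    fine (nu A) <= fine (nu B) + fine (nu N).
  move=> mA' mB' AB; rewrite -fineD ?fin_num_measure//.
  apply: fine_le; rewrite ?fin_numD ?fin_num_measure//.
  apply: le_trans (measureU2 _ mB' mN); apply: le_measure; rewrite ?inE//; exact: measurableU.
rewrite -(inv _ mE).
have h1 := le2 _ _ mA mB; have h2 := le2 _ _ mB mA.
rewrite ler_norml lerNl opprB !lerBlDl h1 ?h2//.
- move=> x Ex; have [|nN] := pselect (N x); first by right.
  by left; rewrite /preimage/= NE.
- move=> x Ex; have [|nN] := pselect (N x); first by right.
  by left; rewrite /preimage/= -NE.
Qed.

Section SetwiseContinuity.
Context {R : realType}.
Let X := measurableTypeR R.
Local Notation leb := (@lebesgue_measure R).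
Variable mu : R -> probability X R.
Hypothesis hmu : forall a, 0 < a <= 1 -> is_unique_acip a (mu a).

Variable C : R.
Hypotheses (C0 : 0 < C)
  (hC : forall b, 0 < b <= 1 -> forall A, measurable A -> (mu b A <= (C / b)%:E * leb A)%E).

Lemma density_const_le (a b : R) : 0 < a -> 0 < b -> a <= 2 * b -> C / b <= 2 * C / a.
Proof.
move=> a0 b0 ab; rewrite ler_pdivrMr// mulrAC ler_pdivlMr//.
have : C * a <= C * (2 * b) by rewrite ler_pM2l.
lra.
Qed.

(** The part of [I_b] outside [[a - 1, a[] has diameter at most [|a - b|], and [a <= 2 * b] makes
    the density bound uniform in [b]. *)
Lemma acip_Talpha_diff (a b : R) (E : set X) : 0 < a <= 1 -> 0 < b <= 1 -> a <= 2 * b ->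
  measurable E ->
  fine (mu b (~` `[a - 1, a[%classic)) <= 2 * C / a * `|a - b| /\
  `|fine (mu b (Talpha a @^-1` E)) - fine (mu b E)| <= 2 * C / a * `|a - b|.
Proof.
move=> a01 b01 ab mE; have [mub _] := hmu b01.
have [[a0 a1] [b0 b1]] := (andP a01, andP b01).
have mI : measurable (~` `[a - 1, a[%classic : set X) by apply: measurableC; exact: measurable_itv.
have mJ : measurable (`[b - 1, b]%classic `&` ~` `[a - 1, a[%classic : set X).
  by apply: measurableI => //; exact: measurable_itv.
have bI : fine (mu b (~` `[a - 1, a[%classic)) <= 2 * C / a * `|a - b|.
  rewrite -lee_fin fineK ?fin_num_measure//; rewrite (acip_inside mub mI).
  apply: (le_trans (hC b01 mJ)).
  apply: (@le_trans _ _ ((C / b)%:E * `|a - b|%:E)%E).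
    apply: lee_wpmul2l; first by rewrite lee_fin; apply: divr_ge0; exact: ltW.
    apply: lebesgue_diam => // x y [/= + +] [/= + +]; rewrite !in_itv/=.
    move=> /andP[x1 x2] nx /andP[y1 y2] ny.
    have nx' : x < a - 1 \/ a <= x.
      by case: (ltP x (a - 1)) => h; [left|right; rewrite leNgt; apply/negP => h2; apply: nx; rewrite h].
    have ny' : y < a - 1 \/ a <= y.
      by case: (ltP y (a - 1)) => h; [left|right; rewrite leNgt; apply/negP => h2; apply: ny; rewrite h].
    clear nx ny; case: (lerP a b) => hab.
      by rewrite ler_norml; apply/andP; split; case: nx' => ?; case: ny' => ?; lra.
    by rewrite ler_norml; apply/andP; split; case: nx' => ?; case: ny' => ?; lra.
  rewrite -EFinM lee_fin; apply: ler_wpM2r => //.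
  exact: density_const_le.
split=> //; apply: le_trans bI.
exact: acip_preimage_diff mub mE.
Qed.

(** Convergence holds on every measurable set, beyond weak convergence, since the uniform domination
    passes to the ultralimit set by set. *)
Lemma acip_setwise_cvg (a : R) (A : set X) : 0 < a <= 1 -> measurable A ->
  (fun b => fine (mu b A)) @ (within [set b | 0 < b <= 1] (nbhs a)) --> fine (mu a A).
Proof.
move=> a01 mA; have [a0 a1] := andP a01.
apply: cvg_ultra.
  apply: within_nbhs_proper; apply: subset_closure; exact: a01.
move=> G UG FG.
have PG : ProperFilter G by exact: ultra_proper.
have [lam cl lamP] := ultralimit_content mu UG.
have nearG (e : R) : 0 < e -> G [set b | [/\ 0 < b <= 1, a <= 2 * b & 2 * C / a * `|a - b| <= e]].
  move=> e0; apply: FG; rewrite /within/=.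
  near=> b => b01; split=> //.
    have : `|a - b| < a / 2 by near: b; apply: cvgr_dist_lt => //; lra.
    by rewrite ltr_norml => /andP[? ?]; lra.
  have : `|a - b| < e * a / (2 * C).
    by near: b; apply: cvgr_dist_lt => //; rewrite divr_gt0// mulr_gt0.
  rewrite ltr_pdivlMr ?mulr_gt0//.
  by move=> h; rewrite mulrAC ler_pdivrMr// mulrC ltW.
have inv E : measurable E -> lam (Talpha a @^-1` E) = lam E.
  move=> mE; have mTE : measurable (Talpha a @^-1` E : set X).
    by apply: measurable_preimT => //; exact: measurable_Talpha.
  have h : (fun b => fine (mu b (Talpha a @^-1` E)) - fine (mu b E)) @ G --> lam (Talpha a @^-1` E) - lam E.
    by apply: cvgB; exact: lamP.
  apply/eqP; rewrite -subr_eq0; apply/eqP; apply: (cvg_unique (@Rhausdorff R) h).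
  apply/cvgrPdist_le => e e0; apply: filterS (nearG _ e0) => b [b01 ab be].
  by rewrite sub0r normrN; have [_] := acip_Talpha_diff a01 b01 ab mE; move=> h'; exact: le_trans be.
have mI : measurable (`[a - 1, a]%classic : set X) by exact: measurable_itv.
have mI' : measurable (`[a - 1, a[%classic : set X) by exact: measurable_itv.
have out : lam (~` `[a - 1, a]%classic) = 0.
  apply: (cvg_unique (@Rhausdorff R) (lamP _ (measurableC mI))).
  apply/cvgrPdist_le => e e0; apply: filterS (nearG _ e0) => b [b01 ab be].
  rewrite sub0r normrN ger0_norm ?fine_ge0//; apply: le_trans be.
  have [h _] := acip_Talpha_diff a01 b01 ab mI; apply: le_trans h.
  apply: fine_le; rewrite ?fin_num_measure//; try exact: measurableC.
  apply: le_measure; rewrite ?inE; try exact: measurableC.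
  by apply: subsetC => x /=; rewrite !in_itv/= => /andP[-> /ltW].
have [||Q [Qa QE]] := @acip_of_content R a (2 * C / a) lam cl _ _ inv.
- by apply: divr_ge0; rewrite ?ltW// mulr_gt0.
- move=> B mB; rewrite (content_inside cl mI mB out).
  have mIB := measurableI _ _ mI mB.
  have lB := cvg_lim (@Rhausdorff R) (lamP _ mIB); rewrite -lB.
  apply: limr_le; first by apply/cvg_ex; exists (lam (`[a - 1, a]%classic `&` B)); exact: lamP.
  apply: filterS (nearG _ ltr01) => b [b01 ab _].
  have [b0 b1] := andP b01.
  have fin : leb (`[a - 1, a]%classic `&` B) \is a fin_num.
    rewrite ge0_fin_numE//; apply: (@le_lt_trans _ _ (leb `[a - 1, a]%classic)).
      by apply: le_measure; rewrite ?inE.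
    by rewrite lebesgue_measure_itv/= lte_fin ltrBlDr ltrDl ltr01 -EFinB ltry.
  rewrite -lee_fin EFinM !fineK ?fin_num_measure//.
  apply: (le_trans (hC b01 mIB)); apply: lee_wpmul2r => //.
  by rewrite lee_fin; exact: density_const_le.
have [_ uniq] := hmu a01.
by rewrite -(uniq Q Qa)// QE//; exact: lamP.
Unshelve. all: by end_near. Qed.

End SetwiseContinuity.

(** * The limit map [Talpha 0] *)

Section FullBranches.
Context {R : realType}.
Let X := measurableTypeR R.
Local Notation T0 := (Talpha (0 : R)).
Implicit Types (w : seq nat) (u v y z : R).

(** On [[-1, 0[] the digits of [Talpha 0] are the integers from 2 on, and the letter [c] codes the
    digit [c + 2]; the head of [w] is the first digit. *)
Definition inv_branch w z : R := foldr (fun c x : _ => - (c%:R + 2 + x)^-1) z w.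

Lemma inv_branch_range w z : -1 <= z < 0 -> -1 <= inv_branch w z < 0.
Proof.
move=> zI; elim: w => [//|c w IH] /=; move: IH; set x := inv_branch w z => /andP[x1 x0].
have c0 : 0 <= c%:R :> R by [].
rewrite oppr_lt0 invr_gt0 lerN2 invf_le1; [|lra].
by apply/andP; split; lra.
Qed.

Lemma inv_branch_range0 w z : -1 <= z <= 0 -> -1 <= inv_branch w z <= 0.
Proof.
move=> zI; elim: w => [//|c w IH] /=; move: IH; set x := inv_branch w z => /andP[x1 x0].
have c0 : 0 <= c%:R :> R by [].
rewrite oppr_le0 invr_ge0 lerN2 invf_le1; [|lra].
by apply/andP; split; lra.
Qed.

Lemma Talpha0_branch (c : nat) (x : R) : -1 <= x < 0 -> T0 (- (c%:R + 2 + x)^-1) = x.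
Proof.
move=> /andP[x1 x0]; have c0 : 0 <= c%:R :> R by [].
rewrite /Talpha invrN invrK normrN ger0_norm; last by lra.
rewrite (_ : Num.floor _ = (c.+2)%:Z); first by rewrite -pmulrn -addn2 natrD; ring.
by apply: floor_def; rewrite intrD -!pmulrn -addn2 natrD; apply/andP; split; lra.
Qed.

Lemma iter_inv_branch w z : -1 <= z < 0 -> iter (size w) T0 (inv_branch w z) = z.
Proof.
move=> zI; elim: w => [//|c w IH]; rewrite [size _]/= iterSr /=.
by rewrite Talpha0_branch ?IH//; exact: inv_branch_range.
Qed.

Lemma Talpha0_eq y : -1 <= y < 0 -> exists c : nat, y = - (c%:R + 2 + T0 y)^-1.
Proof.
move=> /andP[y1 y0]; set b := Num.floor (`|y^-1| + 1 - 0).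
have bE : `|y^-1| - T0 y = b%:~R by exact: Talpha_int.
have yi : `|y^-1| = - y^-1 by rewrite ltr0_norm ?invr_lt0.
have y2 : 1 <= `|y^-1| by rewrite yi -invrN invf_ge1; lra.
have b2 : 2 <= b by rewrite floor_ge_int// subr0 (_ : 2%:~R = 2 :> R)//; lra.
have [c cE] : exists c : nat, b = c.+2%:Z.
  by case: (b) b2 => [[|[|n]]|]// _; exists n.
exists c; have -> : c%:R + 2 + T0 y = `|y^-1|.
  by rewrite -(natrD _ c 2) addn2 -[X in _ = X](subrK (T0 y)) bE cE.
by rewrite yi invrN invrK opprK.
Qed.

Lemma inv_branch_cover n y : -1 <= y < 0 ->
  exists w z, [/\ size w = n, -1 <= z < 0 & y = inv_branch w z].
Proof.
elim: n y => [|n IH] y yI; first by exists [::], y.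
have [c cE] := Talpha0_eq yI.
have TI : -1 <= T0 y < 0 by have := Talpha_itv (0 : R) y; rewrite sub0r.
have [w [z [sw zI Ty]]] := IH _ TI.
by exists (c :: w), z; split; rewrite /= ?sw// -Ty.
Qed.

Lemma inv_branch_inj w w' z z' : -1 <= z < 0 -> -1 <= z' < 0 -> size w = size w' ->
  inv_branch w z = inv_branch w' z' -> w = w' /\ z = z'.
Proof.
move=> zI zI'; elim: w w' => [|c w IH] [|c' w']// [sw] /=.
have xI := inv_branch_range w zI; have xI' := inv_branch_range w' zI'.
move=> e; have ex : inv_branch w z = inv_branch w' z'.
  by rewrite -(Talpha0_branch c xI) e Talpha0_branch.
have [-> ->] := IH _ sw ex; split=> //; congr (_ :: _).
move: e; rewrite ex => /oppr_inj /invr_inj /addIr /addIr /eqP; rewrite eqr_nat => /eqP //.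
Qed.

Lemma inv_branch_mono w u v : -1 <= u -> u < v -> v <= 0 -> inv_branch w u < inv_branch w v.
Proof.
move=> u1 uv v0; elim: w => [//|c w IH] /=.
have /andP[] : -1 <= inv_branch w u <= 0 by apply: inv_branch_range0; apply/andP; split; lra.
have /andP[] : -1 <= inv_branch w v <= 0 by apply: inv_branch_range0; apply/andP; split; lra.
have c0 : 0 <= c%:R :> R by [].
by move=> *; rewrite ltrN2 ltf_pV2 ?posrE; lra.
Qed.

Lemma inv_branch_itv w u v y : -1 <= u -> u < v -> v <= 0 ->
  inv_branch w u <= y < inv_branch w v -> exists2 z, u <= z < v & y = inv_branch w z.
Proof.
move=> u1 uv v0; elim: w y => [|c w IH] y; first by move=> /= yI; exists y.
move=> /=.
have /andP[] : -1 <= inv_branch w u <= 0 by apply: inv_branch_range0; apply/andP; split; lra.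
have /andP[] : -1 <= inv_branch w v <= 0 by apply: inv_branch_range0; apply/andP; split; lra.
have c0 : 0 <= c%:R :> R by [].
set xu := inv_branch w u; set xv := inv_branch w v => v1 v2 u2 u3 /andP[h1 h2].
have y0 : y < 0.
  by apply: (lt_le_trans h2); rewrite oppr_le0 invr_ge0; lra.
have [z zI zE] : exists2 z, u <= z < v & - y^-1 - (c%:R + 2) = inv_branch w z.
  apply: IH; rewrite -/xu -/xv.
  have p1 : 0 < - y by lra.
  apply/andP; split.
    rewrite lerBrDl -invrN -[leLHS]invrK lef_pV2 ?posrE ?invr_gt0//; lra.
  rewrite ltrBlDl -invrN -[ltRHS]invrK ltf_pV2 ?posrE ?invr_gt0//; lra.
by exists z => //; rewrite -zE addrC subrK invrN invrK opprK.
Qed.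

Lemma inv_branch_moebius w : exists p' p q' q : R,
  [/\ 0 <= q', q' + 1 <= q, (size w).+1%:R <= q,
      [/\ p' * q - p * q' = 1, - p + 1 <= q, - p' <= q' &
        p' - p <= q - q'] &
      forall z, -1 <= z <= 0 -> inv_branch w z * (q + q' * z) = p + p' * z].
Proof.
elim: w => [|c w [p' [p [q' [q [q'0 q'q sq [det pq pq' dd] eqM]]]]]].
  exists 1, 0, 0, 1; split=> /=; [lra|lra|lra|split; lra|move=> z _; lra].
have c0 : 0 <= c%:R :> R by [].
have cq : 0 <= c%:R * q by apply: mulr_ge0 => //; lra.
have cq' : 0 <= c%:R * q' by exact: mulr_ge0.
have cd : 0 <= c%:R * (q - q') by apply: mulr_ge0 => //; lra.
exists (- q'), (- q), ((c%:R + 2) * q' + p'), ((c%:R + 2) * q + p); split.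
- by lra.
- by lra.
- by rewrite [size _]/= -natr1; lra.
- by split; lra.
move=> z zI; have := inv_branch_range0 w zI; have := eqM z zI => /=.
set x := inv_branch w z => eqx /andP[x1 x0].
have cx : c%:R + 2 + x != 0 by rewrite gt_eqF//; lra.
have -> : (c%:R + 2) * q + p + ((c%:R + 2) * q' + p') * z = (c%:R + 2 + x) * (q + q' * z).
  by rewrite [RHS]mulrDl eqx; ring.
by rewrite mulNr mulrA mulVf//; ring.
Qed.

Lemma inv_branch_dist w : exists q' q : R,
  [/\ 0 <= q', q' + 1 <= q, (size w).+1%:R <= q &
      forall u v, -1 <= u <= 0 -> -1 <= v <= 0 ->
        inv_branch w v - inv_branch w u = (v - u) / ((q + q' * u) * (q + q' * v))].
Proof.
have [p' [p [q' [q [q'0 q'q sq [det _ _ _] eqM]]]]] := inv_branch_moebius w.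
exists q', q; split=> // u v uI vI.
have dpos z : -1 <= z <= 0 -> 0 < q + q' * z.
  move=> /andP[z1 _]; have : q' * (-1) <= q' * z by apply: ler_wpM2l.
  by lra.
have du := dpos _ uI; have dv := dpos _ vI.
have hu := eqM _ uI; have hv := eqM _ vI.
apply: (mulIf (_ : (q + q' * u) * (q + q' * v) != 0)); first by rewrite gt_eqF// mulr_gt0.
rewrite divfK; last by rewrite gt_eqF// mulr_gt0.
have -> : (inv_branch w v - inv_branch w u) * ((q + q' * u) * (q + q' * v)) =
   (inv_branch w v * (q + q' * v)) * (q + q' * u) - (inv_branch w u * (q + q' * u)) * (q + q' * v) by ring.
by rewrite hu hv -[RHS]mulr1 -det; ring.
Qed.

(** Words of length [n] are enumerated by their codes, all other indices giving the empty set, so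
    that sums over cells are series over [nat]. *)
Definition full_cell (n : nat) (u v : R) (i : nat) : set X :=
  if pickle_inv i is Some w then
    if size (w : seq nat) == n then `[inv_branch w u, inv_branch w v[%classic else set0
  else set0.

Lemma measurable_full_cell n u v i : measurable (full_cell n u v i).
Proof.
rewrite /full_cell; case: pickle_inv => [w|]; last exact: measurable0.
by case: ifP => _; [exact: measurable_itv|exact: measurable0].
Qed.

Lemma full_cellP n u v i y : -1 <= u -> u < v -> v <= 0 -> full_cell n u v i y ->
  exists w z, [/\ i = pickle w, size w = n, u <= z < v & y = inv_branch w z].
Proof.
move=> u1 uv v0; rewrite /full_cell; case E: pickle_inv => [w|//]; case: eqP => // sw.
rewrite /= in_itv/= => /(inv_branch_itv u1 uv v0)[z zI yE].
by exists w, z; split=> //; have := pickle_invK (T := seq nat) i; rewrite E.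
Qed.

Lemma bigcup_full_cell n u v : -1 <= u -> u < v -> v <= 0 ->
  \bigcup_i full_cell n u v i = `[-1, 0[%classic `&` iter n T0 @^-1` `[u, v[%classic.
Proof.
move=> u1 uv v0; apply/seteqP; split=> y.
  case=> i _ /(full_cellP u1 uv v0)[w [z [_ sw /andP[z1 z2] yE]]].
  have zI : -1 <= z < 0 by apply/andP; split; lra.
  split; rewrite /= in_itv/= yE; first exact: inv_branch_range.
  by rewrite -sw iter_inv_branch// z1.
move=> [/=]; rewrite !in_itv/= => yI.
have [w [z [sw zI yE]]] := inv_branch_cover n yI.
rewrite yE -{1 2}sw iter_inv_branch// => /andP[z1 z2].
exists (pickle w) => //; rewrite /full_cell pickleK_inv sw eqxx /= in_itv/=.
case/andP: zI => z3 z4.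
apply/andP; split; last by apply: inv_branch_mono => //; lra.
move: z1; rewrite le_eqVlt => /orP[/eqP -> //|uz]; apply: ltW.
by apply: inv_branch_mono => //; lra.
Qed.

Lemma trivIset_full_cell n u v : -1 <= u -> u < v -> v <= 0 -> trivIset setT (full_cell n u v).
Proof.
move=> u1 uv v0; apply/trivIsetP => i j _ _ ij; apply/seteqP; split=> // y [].
move=> /(full_cellP u1 uv v0)[w [z [iE sw /andP[z1 z2] yE]]].
move=> /(full_cellP u1 uv v0)[w' [z' [jE sw' /andP[z1' z2'] yE']]].
have [] := @inv_branch_inj w w' z z'; rewrite ?sw ?sw' -?yE//; [lra|lra|].
by move=> e _; move/eqP: ij; apply; rewrite iE jE e.
Qed.

(** The first bound says that cylinders shrink: the distance is
    [(z + 1) / ((q - q') * (q + q' * z))] with [q + q' * z >= q * (1 + z)], [q - q' >= 1] and [q]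
    larger than the length of [w]. The witness [t] is [1 / q ^ 2]. *)
Lemma inv_branch_lengths w u v : -1 <= u -> u < v -> v <= 0 ->
  [/\ forall z, -1 <= z < 0 -> `|inv_branch w z - inv_branch w (-1)| <= (size w).+1%:R^-1 &
  exists2 t : R, 0 <= t & (v - u) * t <= inv_branch w v - inv_branch w u /\
    inv_branch w 0 - inv_branch w (- 2^-1) <= t].
Proof.
move=> u1 uv v0; have [q' [q [q'0 q'q sq dist]]] := inv_branch_dist w.
have q0 : 0 < q by lra.
have qq'0 : 0 < q - q' by lra.
have dle z : -1 <= z <= 0 -> q * (1 + z) <= q + q' * z <= q /\ q - q' <= q + q' * z.
  move=> /andP[z1 z0]; have : q' * (- z) <= q * (- z) by apply: ler_wpM2r; lra.
  have : 0 <= q' * (- z) by apply: mulr_ge0; lra.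
  have : q' * (- z) <= q' * 1 by apply: ler_wpM2l; lra.
  by move=> *; split; [apply/andP; split|]; lra.
split.
  move=> z zI; have zI' : -1 <= z <= 0 by case/andP: zI => -> /ltW.
  have m1 : (-1 <= (-1 : R)) && ((-1 : R) <= 0) by rewrite lexx lerN10.
  rewrite dist// mulrN1 opprK.
  have [/andP[h1 h2] h3] := dle _ zI'.
  have zz : 0 <= z + 1 by lra.
  rewrite ger0_norm; last by rewrite divr_ge0// mulr_ge0; lra.
  rewrite ler_pdivrMr; last by rewrite mulr_gt0; lra.
  have sq' : 0 < (size w).+1%:R :> R by [].
  rewrite mulrC ler_pdivlMr// mulrC.
  have k1 : (size w).+1%:R * (z + 1) <= q * (z + 1) by rewrite ler_wpM2r.
  have k2 : q + q' * z <= (q - q') * (q + q' * z) by rewrite ler_peMl; lra.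
  by lra.
exists (q ^- 2); first by rewrite invr_ge0 exprn_ge0// ltW.
have uI : -1 <= u <= 0 by apply/andP; split; lra.
have vI : -1 <= v <= 0 by apply/andP; split; lra.
have hI : (-1 <= (- 2^-1 : R)) && ((- 2^-1 : R) <= 0) by apply/andP; split; lra.
have oI : (-1 <= (0 : R)) && ((0 : R) <= 0) by apply/andP; split; lra.
have [/andP[_ du] du'] := dle _ uI; have [/andP[_ dv] dv'] := dle _ vI.
have [/andP[dh _] dh'] := dle _ hI.
split.
  rewrite dist//; apply: ler_wpM2l; first lra.
  rewrite lef_pV2 ?posrE ?exprn_gt0//; last by rewrite mulr_gt0; lra.
  by rewrite expr2; apply: ler_pM; lra.
rewrite dist// mulr0 addr0 sub0r opprK ler_pdivrMr; last by rewrite mulr_gt0//; lra.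
rewrite mulrC ler_pdivlMr ?exprn_gt0// expr2 mulrA.
by have := ler_wpM2r (ltW q0) dh; lra.
Qed.

End FullBranches.

(** * Densities at small scale *)

Section LocalDensity.
Context {R : realType}.
Let X := measurableTypeR R.
Local Notation leb := (@lebesgue_measure R).
Local Notation T0 := (Talpha (0 : R)).
Local Notation I0 := (`[-1, 0[%classic : set X).

(* [P] is, up to a small error [r], a constant multiple of Lebesgue measure at
   scale [dl]. *)
Definition locally_constant (P : set X -> \bar R) (r : set X -> \bar R) (dl : R) : Prop :=
  forall x : R, -1 <= x <= 0 -> exists2 c : R, 0 <= c & forall S : set X, measurable S -> S `<=` I0 ->
    (forall y : X, S y -> `|y - x : R| <= dl) ->
    (P S <= c%:E * leb S + r S)%E /\ (c%:E * leb S <= P S + r S)%E.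

(* On a cylinder of order [n] the inverse branch has density
   [1 / (q + q' z) ^ 2] with [0 <= q' <= q], so it maps [u, v) to a set of length
   at least [(v - u) / q ^ 2] and [-1/2, 0) to one of length at most [1 / q ^ 2]. *)
Lemma full_branch_compare (P : probability X R) (r : {measure set X -> \bar R}) (dl u v : R) n :
  P (~` I0) = 0%E -> locally_constant P r dl -> n.+1%:R^-1 <= dl ->
  -1 <= u -> u < v -> v <= 0 ->
  ((v - u)%:E * P (iter n T0 @^-1` `[(- 2^-1)%R, 0%R[%classic) <=
    P (iter n T0 @^-1` `[u, v[%classic) + (r I0 + r I0))%E.
Proof.
move=> PI Pr ndl u1 uv v0.
have mI : measurable I0 by exact: measurable_itv.
have mT : measurable_fun setT (iter n T0 : X -> X).
  by apply: measurable_iter; exact: measurable_Talpha.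
have h1 : (-1 : R) <= - 2^-1 by lra.
have h2 : - 2^-1 < (0 : R) by lra.
have decomp (m : {measure set X -> \bar R}) (s t : R) : -1 <= s -> s < t -> t <= 0 ->
    m (I0 `&` iter n T0 @^-1` `[s, t[%classic) = (\sum_(0 <= i <oo) m (full_cell n s t i))%E.
  move=> s1 st t0; have := bigcup_full_cell n s1 st t0; move=> <-.
  rewrite measure_semi_bigcup//.
  - by move=> i; exact: measurable_full_cell.
  - exact: trivIset_full_cell.
  - by apply: bigcup_measurable => i _; exact: measurable_full_cell.
have PE (s t : R) : P (iter n T0 @^-1` `[s, t[%classic) = P (I0 `&` iter n T0 @^-1` `[s, t[%classic).
  have mS : measurable (iter n T0 @^-1` `[s, t[%classic : set X).
    by apply: measurable_preimT => //; exact: measurable_itv.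
  rewrite -[in LHS](setTI (iter n T0 @^-1` _)) -(setUv I0) setIUl measureU//.
  - rewrite [X in (_ + X)%E](_ : _ = 0%E) ?adde0//.
    apply/eqP; rewrite eq_le measure_ge0 andbT -PI; apply: le_measure; rewrite ?inE//.
      by apply: measurableI => //; exact: measurableC.
    exact: measurableC.
  - exact: measurableI.
  - by apply: measurableI => //; exact: measurableC.
  - by rewrite setIACA setICr set0I.
have rle (s t : R) : -1 <= s -> s < t -> t <= 0 -> (\sum_(0 <= i <oo) r (full_cell n s t i) <= r I0)%E.
  move=> s1 st t0; rewrite -decomp//; apply: le_measure; rewrite ?inE//.
  by apply: measurableI => //; apply: measurable_preimT => //; exact: measurable_itv.
have r1 := rle _ _ u1 uv v0; have r2 := rle _ _ h1 h2 (lexx 0).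
rewrite !PE !decomp//.
apply: (@le_trans _ _ (\sum_(0 <= i <oo) (P (full_cell n u v i) +
    (r (full_cell n u v i) + r (full_cell n (- 2^-1)%R 0%R i))))%E); last first.
  rewrite nneseriesD; [|by move=> *|by move=> *; exact: adde_ge0].
  by rewrite leeD2l// nneseriesD//; exact: leeD.
rewrite -nneseriesZl//.
apply: lee_nneseries => i _; first by move=> _; apply: mule_ge0 => //; rewrite lee_fin; lra.
have mU := measurable_full_cell n u v i.
have mB := measurable_full_cell n (- 2^-1) (0 : R) i.
case E : (pickle_inv (T := seq nat) i) => [w|]; last first.
  by rewrite {1}/full_cell E measure0 mule0 !adde_ge0.
have [sw|/negPf sw] := eqVneq (size w) n; last by rewrite {1}/full_cell E sw measure0 mule0 !adde_ge0.
have Ucell : full_cell n u v i = `[inv_branch w u, inv_branch w v[%classic.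
  by rewrite /full_cell E sw eqxx.
have Bcell : full_cell n (- 2^-1)%R 0%R i = `[inv_branch w (- 2^-1), inv_branch w 0[%classic.
  by rewrite /full_cell E sw eqxx.
have [hd [t t0 [hU hB]]] := inv_branch_lengths w u1 uv v0.
have m1 : (-1 <= (-1 : R)) && ((-1 : R) <= 0) by rewrite lexx lerN10.
have [c c0 hc] := Pr _ (inv_branch_range0 w m1).
have near_cell (s s' : R) : -1 <= s -> s < s' -> s' <= 0 -> forall y, full_cell n s s' i y ->
    I0 y /\ `|y - inv_branch w (-1) : R| <= dl.
  move=> s1 ss s0 y; rewrite /full_cell E sw eqxx /= in_itv/=.
  move=> /(inv_branch_itv s1 ss s0)[z /andP[z1 z2] ->].
  have zI : -1 <= z < 0 by apply/andP; split; lra.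
  split; first by rewrite /= in_itv/=; exact: inv_branch_range.
  by apply: le_trans ndl; rewrite -sw; exact: hd.
have [_ hU2] := hc _ mU (fun y h => (near_cell _ _ u1 uv v0 y h).1) (fun y h => (near_cell _ _ u1 uv v0 y h).2).
have [hB1 _] := hc _ mB (fun y h => (near_cell _ _ h1 h2 (lexx 0) y h).1)
  (fun y h => (near_cell _ _ h1 h2 (lexx 0) y h).2).
have lU : ((v - u)%:E * t%:E <= leb (full_cell n u v i))%E.
  rewrite Ucell lebesgue_measure_itv/= lte_fin.
  by rewrite inv_branch_mono// -EFinB -EFinM lee_fin.
have lB : (leb (full_cell n (- 2^-1)%R 0%R i) <= t%:E)%E.
  rewrite Bcell lebesgue_measure_itv/= lte_fin.
  by rewrite inv_branch_mono// -EFinB lee_fin.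
have vu0 : (0 <= (v - u)%:E)%E by rewrite lee_fin; lra.
have vu1 : v - u <= 1 by lra.
apply: (@le_trans _ _ ((v - u)%:E * (c%:E * t%:E + r (full_cell n (- 2^-1)%R 0%R i)))%E).
  apply: lee_wpmul2l => //; apply: (le_trans hB1); apply: leeD => //.
  by apply: lee_wpmul2l => //; rewrite lee_fin.
rewrite ge0_muleDr//; last by rewrite -EFinM lee_fin mulr_ge0.
rewrite addeA; apply: leeD.
  apply: (le_trans _ hU2); rewrite muleCA; apply: lee_wpmul2l => //; by rewrite lee_fin.
rewrite -[leRHS]mul1e; apply: lee_wpmul2r => //.
Qed.

Lemma uniformly_continuous_segment (psi : R -> R) (e a b : R) : continuous psi -> 0 < e ->
  exists2 dl : R, 0 < dl &
    forall x y, a <= x <= b -> `|y - x| <= dl -> `|psi y - psi x| <= e.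
Proof.
move=> cpsi e0; have := @segment_compact R a b => /compact_near_coveringP.
move=> /(_ R (0 : R)^'+ (fun dl x => forall y, `|y - x| <= dl -> `|psi y - psi x| <= e) _) [].
  move=> x _; have e2 : 0 < e / 2 by lra.
  have /cvgrPdist_lt/(_ _ e2) := cpsi x; rewrite /= => /nbhs_ballP[eta /= eta0 he].
  have eta2 : 0 < eta / 2 by lra.
  exists (ball x (eta / 2), [set d | d < eta / 2]).
    split; first exact: nbhsx_ballx.
    exact: nbhs_right_lt.
  move=> [x' d] /= [xx' dd] y yx.
  have h1 : `|psi x - psi y| < e / 2.
    apply: he; rewrite /ball/=; move: xx' yx; rewrite /ball/= => xx' yx.
    have := ler_normD (x - x') (x' - y); rewrite subrKA distrC in yx *; rewrite [`|x' - y|]distrC.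
    by rewrite distrC in yx; lra.
  have h2 : `|psi x - psi x'| < e / 2.
    by apply: he; rewrite /ball/=; move: xx'; rewrite /ball/=; lra.
  move: h1 h2; rewrite !ltr_norml => /andP[? ?] /andP[? ?].
  by rewrite ler_norml; apply/andP; split; lra.
move=> t /= t0 H; exists (t / 2); first by lra.
have /H Ht : ball 0 t (t / 2) by rewrite /ball/= sub0r normrN gtr0_norm; lra.
move=> x y xI xy; apply: (Ht _ x) => //; first by lra.
Qed.

(** The density [g] is approximated in mean by a continuous [psi], and [r] has density
    [|g - psi| + ep / 2], the second term covering the oscillation of [psi] at scale [dl]. The
    constant at [x] is the positive part of [psi x], as [psi] may be negative. *)
Lemma locally_constant_approx (P : probability X R) (K ep : R) : 0 < K -> 0 < ep ->
  (forall A, measurable A -> (P A <= K%:E * leb A)%E) ->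
  exists2 dl : R, 0 < dl & exists2 r : {measure set X -> \bar R},
    (r I0 <= ep%:E)%E & locally_constant P r dl.
Proof.
move=> K0 ep0 PK.
have mI : measurable I0 by exact: measurable_itv.
have lI : leb I0 = 1%E.
  by rewrite lebesgue_measure_itv/= lte_fin ltrN10 -EFinB opprK add0r.
have Pleb : P `<< leb.
  apply/null_content_dominatesP => A mA A0; apply/eqP; rewrite eq_le measure_ge0 andbT.
  by apply: (le_trans (PK _ mA)); rewrite A0 mule0.
have [f [f0 ffin intf Pf]] := radon_nikodym_sigma_finite Pleb.
pose g (x : X) : R := fine (f x).
have gE x : f x = (g x)%:E by rewrite fineK.
have g0 x : 0 <= g x by exact: fine_ge0.
have fg : f = EFin \o g by apply/funext => x /=; rewrite gE.
have mg : measurable_fun [set: X] g by apply/measurable_EFinP; rewrite -fg; exact: measurable_int intf.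
have intg : leb.-integrable I0 (EFin \o g).
  by rewrite -fg; apply: integrableS intf.
have lIoo : (leb I0 < +oo)%E by rewrite lI ltry.
have [psis [cpsi _ lim]] := @approximation_continuous_integrable R I0 g mI lIoo intg.
have ep2 : 0 < ep / 2 by lra.
have [n hn] : exists n, (\int[leb]_(z in I0) `|(g z - psis n z)%:E| <= (ep / 2)%:E)%E.
  move: lim => /fine_cvgP[[m1 _ fin] /cvgrPdist_le/(_ _ ep2)[m2 _ h]].
  exists (m1 + m2)%N; rewrite -[leLHS]fineK; last by apply: fin; rewrite /= leq_addr.
  have := h (m1 + m2)%N; rewrite /= leq_addl => /(_ isT).
  by rewrite sub0r normrN lee_fin; apply: le_trans; exact: ler_norm.
move: (psis n) (cpsi n) hn => psi cps hn.
have [dl dl0 hdl] := uniformly_continuous_segment (-1) 0 cps ep2.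
have mpsi : measurable_fun [set: X] (psi : X -> R) by exact: continuous_measurable_fun.
pose h (x : X) : \bar R := (`|g x - psi x| + ep / 2)%:E.
have mh : measurable_fun [set: X] h.
  apply/measurable_EFinP; apply: measurable_funD => //.
  by apply: measurableT_comp => //; exact: measurable_funB.
have h0 x : (0 <= h x)%E by rewrite lee_fin addr_ge0// ltW.
have [|||r rE] := @measure_of_funP _ X R (fun A => \int[leb]_(x in A) h x)%E.
- by rewrite integral_set0.
- by move=> A; exact: integral_ge0.
- exact: semi_sigma_additive_nng_induced.
exists dl => //; exists r.
  rewrite rE (_ : ep = ep / 2 + ep / 2); last by lra.
  rewrite (_ : (\int[leb]_(x in I0) h x)%E = (\int[leb]_(x in I0) (`|(g x - psi x)%:E| + (ep / 2)%:E))%E); last first.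
    by apply: eq_integral => x _.
  rewrite ge0_integralD//; last 2 first.
  - apply: measurable_funTS; apply: measurableT_comp => //.
    by apply/measurable_EFinP; exact: measurable_funB.
  - by move=> x _; rewrite lee_fin ltW.
  rewrite EFinD; apply: leeD; first exact: hn.
  by rewrite integral_cst// [X in (_ * X)%E]lI mule1.
move=> x xI; exists (Num.max 0 (psi x)); first by rewrite le_max lexx.
set c := Num.max 0 (psi x); move=> S mS SI Sx.
have c0 : 0 <= c by rewrite le_max lexx.
have psc y : S y -> psi y <= c + ep / 2 /\ c <= Num.max 0 (psi y) + ep / 2.
  move=> Sy; have := hdl x y xI (Sx _ Sy); rewrite ler_norml => /andP[? ?].
  have : psi x <= c by rewrite le_max lexx orbT.
  split; first by lra.
  have k0 : 0 <= Num.max 0 (psi y) by rewrite le_max lexx.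
  have k1 : psi y <= Num.max 0 (psi y) by rewrite le_max lexx orbT.
  by rewrite /c ge_max; apply/andP; split; lra.
have mgS : measurable_fun S (fun y => (g y)%:E).
  by apply: measurable_funTS; exact/measurable_EFinP.
have mhS : measurable_fun S h by exact: measurable_funTS.
have PS : P S = (\int[leb]_(y in S) (g y)%:E)%E.
  by rewrite Pf//; apply: eq_integral => y _; rewrite gE.
have cS : (c%:E * leb S = \int[leb]_(y in S) c%:E)%E by rewrite integral_cst.
rewrite rE PS cS -!ge0_integralD//; try by move=> y _; rewrite lee_fin.
split; apply: ge0_le_integral => //; try by move=> y _; rewrite ?lee_fin ?adde_ge0// lee_fin.
- exact: emeasurable_funD.
- move=> y Sy; rewrite -EFinD lee_fin; have [p1 _] := psc _ Sy.
  by have := ler_norm (g y - psi y); lra.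
- exact: emeasurable_funD.
- move=> y Sy; rewrite -EFinD lee_fin; have [_ p2] := psc _ Sy.
  have : Num.max 0 (psi y) <= g y + `|g y - psi y|.
    rewrite ge_max addr_ge0//=; have := ler_norm (psi y - g y); rewrite distrC; lra.
  lra.
Qed.

End LocalDensity.

Lemma harmonic_ge (R : realType) (n : nat) : ln n.+1%:R <= \sum_(i < n) i.+1%:R^-1 :> R.
Proof.
elim: n => [|n IH]; first by rewrite big_ord0 ln1.
rewrite big_ord_recr/=; apply: le_trans (lerD IH (lexx _)).
have np : 0 < n.+1%:R :> R by [].
have -> : n.+2%:R = n.+1%:R * (1 + n.+1%:R^-1) :> R.
  by rewrite mulrDr mulr1 divff ?gt_eqF// natr1.
have ip : 0 < n.+1%:R^-1 :> R by rewrite invr_gt0.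
rewrite lnM ?posrE ?addr_gt0// lerD2l; apply: le_ln1Dx.
by apply: lt_trans ip; rewrite ltrN10.
Qed.

(** * The neutral fixed point -1 of [Talpha 0] *)

Section Escape.
Context {R : realType}.
Local Notation T0 := (Talpha (0 : R)).

(** In the coordinate [s = 1 + x] the map is [s / (1 - s)], that is, [1 / s] decreases by 1; a point
    at distance [s] from -1 needs about [1 / s] steps to get away. *)
Lemma Talpha0_left (x : R) : -1 <= x < - 2^-1 -> 1 + T0 x = (1 + x) / (- x).
Proof.
move=> /andP[x1 x2]; have x0 : 0 < - x by lra.
have i1 : 1 <= (- x)^-1 by rewrite invf_ge1//; lra.
have i2 : (- x)^-1 < 2.
  by rewrite -[ltRHS]invrK ltf_pV2 ?posrE ?invr_gt0//; lra.
have zI : -1 <= (- x)^-1 - 2 < 0 by apply/andP; split; lra.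
have := Talpha0_branch 0 zI; rewrite add0r addrC subrK invrK opprK => ->.
by field; rewrite ?oppr_eq0; apply/eqP => x00; move: x0; rewrite x00 oppr0 ltxx.
Qed.

Lemma iter_Talpha0_left n (x : R) : -1 <= x -> 1 + x < n.+2%:R^-1 -> iter n T0 x < - 2^-1.
Proof.
elim: n x => [|n IH] x x1 xn; first by rewrite /=; lra.
have n0 : 0 <= n%:R :> R by [].
have n3 : n.+3%:R = n%:R + 3 :> R by rewrite -addn3 natrD.
have n2 : n.+2%:R = n%:R + 2 :> R by rewrite -addn2 natrD.
have x2 : x < - 2^-1.
  have : n.+3%:R^-1 <= 3^-1 :> R by rewrite lef_pV2 ?posrE// n3; lra.
  by move: xn; move: (n.+3%:R^-1 : R) => t; lra.
rewrite iterSr; apply: IH; first by have /andP[] := Talpha_itv (0 : R) x; rewrite sub0r.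
rewrite Talpha0_left ?x1// ltr_pdivrMr; last lra.
rewrite n2 mulrC ltr_pdivlMr; last lra.
move: xn; rewrite n3 -[ltRHS]mul1r ltr_pdivlMr; last lra.
lra.
Qed.

End Escape.

Section Vanishing.
Context {R : realType}.
Let X := measurableTypeR R.
Local Notation leb := (@lebesgue_measure R).
Local Notation T0 := (Talpha (0 : R)).
Local Notation I0 := (`[-1, 0[%classic : set X).
Local Notation B0 := (`[(- 2^-1)%R, 0%R[%classic : set X).
Variables (lam : set X -> R) (C : R).
Hypotheses (cl : is_content lam) (C0 : 0 < C).
Hypothesis lamI : lam (~` I0) = 0.
Hypothesis lam_inv : forall A, measurable A -> lam (T0 @^-1` A) = lam A.
Hypothesis lam_le : forall (dl : R) (A : set X), 0 < dl <= 1 -> measurable A -> A `<=` I0 ->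
  (forall x, A x -> dl <= 1 + (x : R)) -> lam A <= C / dl * fine (leb A).

Let mI : measurable I0. Proof. exact: measurable_itv. Qed.
Let mT : measurable_fun setT (T0 : X -> X). Proof. exact: measurable_Talpha. Qed.
Let mTn n : measurable_fun setT (iter n T0 : X -> X). Proof. exact: measurable_iter. Qed.

Let lam_ge0 A : 0 <= lam A. Proof. by case: cl. Qed.
Let lam_add A B : measurable A -> measurable B -> A `&` B = set0 -> lam (A `|` B) = lam A + lam B.
Proof. by case: cl => _ _; exact. Qed.

Lemma content_split A D : measurable A -> measurable D ->
  lam A = lam (D `&` A) + lam (~` D `&` A).
Proof.
move=> mA mD; rewrite -lam_add; [|exact: measurableI| |].
- by rewrite -setIUl setUv setTI.
- by apply: measurableI => //; exact: measurableC.
- by rewrite setIACA setICr set0I.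
Qed.

Lemma lam_iter n A : measurable A -> lam (iter n T0 @^-1` A) = lam A.
Proof.
elim: n A => [//|n IH] A mA.
by rewrite preim_iterS lam_inv ?IH//; exact: measurable_preimT.
Qed.

Definition right_part k : set X := `[-1 + k.+1%:R^-1, 0[%classic.

Lemma measurable_right_part k : measurable (right_part k).
Proof. exact: measurable_itv. Qed.

Lemma right_part_sub k : right_part k `<=` I0.
Proof.
move=> x; rewrite /right_part /= !in_itv/= => /andP[h1 h2]; rewrite h2 andbT.
by apply: le_trans h1; rewrite lerDl.
Qed.

Lemma right_part_mono j k : (j <= k)%N -> right_part j `<=` right_part k.
Proof.
move=> jk x; rewrite /right_part /= !in_itv/= => /andP[h1 h2]; rewrite h2 andbT.
by apply: le_trans h1; rewrite lerD2l lef_pV2 ?posrE// ler_nat.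
Qed.

(** The supremum of these masses may be less than 1, as [lam] can charge every neighbourhood of -1
    without charging the union of the parts fully; near the supremum, further parts add little. *)
Lemma right_part_sup (e : R) : 0 < e -> exists k, forall j, lam (right_part j) <= lam (right_part k) + e.
Proof.
move=> e0; pose S := range (fun k => lam (right_part k)).
have hS : has_sup S.
  split; first by exists (lam (right_part 0)); exists 0%N.
  by exists 1 => _ [k _ <-]; apply: content_le1 => //; exact: measurable_right_part.
have [_ [k _ <-] hk] := sup_adherent e0 hS.
exists k => j; have : lam (right_part j) <= sup S by apply: ub_le_sup; [exact: hS.2|exists j].
lra.
Qed.

(** A point within [1 / (n + 2)] of -1 is still left of [-1/2] after [n] steps, so the preimages of
    [B0] stay in the region where [lam] is dominated. *)
Lemma right_part_escape n : I0 `&` iter n T0 @^-1` B0 `<=` right_part n.+1.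
Proof.
move=> x [/=]; rewrite !in_itv/= => /andP[x1 x0] /andP[y1 _].
rewrite /right_part /= in_itv/= x0 andbT leNgt.
apply/negP => xn; have := @iter_Talpha0_left R n x x1.
have -> : 1 + x < n.+2%:R^-1 by rewrite -ltrBrDl addrC.
by move=> /(_ isT) h; have := lt_le_trans h y1; rewrite ltxx.
Qed.

(** Away from -1 the content is dominated by Lebesgue measure, so its normalized restriction is
    countably additive and has a bounded density. *)
Lemma conditional_probability k : 0 < lam (right_part k) ->
  exists2 P : probability X R, forall A, measurable A ->
      fine (P A) * lam (right_part k) = lam (right_part k `&` A) &
    exists2 K : R, 0 < K & forall A, measurable A -> (P A <= K%:E * leb A)%E.
Proof.
move=> lk; set D := right_part k; have mD : measurable D := measurable_right_part k.
pose kap A := lam (D `&` A) / lam D.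
have ck : is_content kap.
  split.
  - by move=> A; apply: divr_ge0.
  - by rewrite /kap setIT divff// gt_eqF.
  - move=> A B mA mB AB; rewrite /kap setIUr lam_add ?mulrDl//; [exact: measurableI..|].
    by rewrite setIACA AB setI0.
have kap_le A : measurable A -> kap A <= (C * k.+1%:R / lam D) * fine (leb (D `&` A)).
  move=> mA; rewrite /kap mulrAC ler_pM2r ?invr_gt0//.
  have d01 : 0 < (k.+1%:R^-1 : R) <= 1 by rewrite invr_gt0 ltr0n invf_le1 ?ler1n.
  have := lam_le d01 (measurableI _ _ mD mA); rewrite invrK; apply.
    by move=> x [/right_part_sub].
  by move=> x [+ _]; rewrite /D /right_part /= in_itv/= => /andP[h _]; rewrite -lerBlDl addrC.
have K0 : 0 < C * k.+1%:R / lam D by rewrite divr_gt0// mulr_gt0.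
have mid : measurable_fun setT (@id X) by [].
have [m mE] := pushforward_restrP leb mD mid.
have [nu nuE] : exists nu : {measure set X -> \bar R},
    forall A, nu A = ((C * k.+1%:R / lam D)%:E * leb (D `&` A))%E.
  by exists (mscale (NngNum (ltW K0)) m) => A; exact: (congr1 (fun z => (C * k.+1%:R / lam D)%:E * z)%E (mE A)).
have fin A : measurable A -> leb (D `&` A) \is a fin_num.
  move=> mA; rewrite ge0_fin_numE//; apply: (@le_lt_trans _ _ (leb I0)).
    by apply: le_measure; rewrite ?inE//; [exact: measurableI|move=> x [/right_part_sub]].
  by rewrite lebesgue_measure_itv/= lte_fin ltrN10 -EFinB ltry.
have [||P PE] := @content_probability _ X R kap ck nu.
- by rewrite nuE -[X in (_ * X)%E]fineK ?fin// -EFinM ltry.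
- by move=> A mA; rewrite nuE fineM ?fin//; exact: kap_le.
exists P; first by move=> A mA; rewrite PE//= /kap divfK// gt_eqF.
exists (C * k.+1%:R / lam D) => // A mA; rewrite PE//.
apply: (@le_trans _ _ ((C * k.+1%:R / lam D)%:E * leb (D `&` A))%E).
  by rewrite -[X in (_ * X)%E]fineK ?fin// -EFinM lee_fin; exact: kap_le.
apply: lee_wpmul2l; first by rewrite lee_fin ltW.
by apply: le_measure; rewrite ?inE//; exact: measurableI.
Qed.

(* [lam] need not be countably additive near [-1], but the part of it missed by
   [right_part k] contributes little to the preimages of [B0], uniformly in [n]. *)
Lemma content_interval_ge (u v : R) : -1 <= u -> u < v -> v <= 0 ->
  (v - u) * lam B0 <= lam `[u, v[%classic.
Proof.
move=> u1 uv v0; apply/ler_addgt0Pr => e e0.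
have e3 : 0 < e / 3 by lra.
have [k hk] := right_part_sup e3.
have mB : measurable B0 by exact: measurable_itv.
have mE : measurable (`[u, v[%classic : set X) by exact: measurable_itv.
have vu1 : v - u <= 1 by lra.
set D := right_part k; have mD : measurable D := measurable_right_part k.
have outside n : lam (iter n T0 @^-1` B0) <= lam (D `&` iter n T0 @^-1` B0) + e / 3.
  have mnB : measurable (iter n T0 @^-1` B0) by exact: measurable_preimT.
  rewrite (content_split mnB mD) lerD2l.
  (* Inside [I0] the preimage of [B0] lies in [right_part j], and by the choice of [k] the part of
     [right_part j] outside [D] weighs at most [e / 3]. *)
  pose j := maxn k n.+1.
  have mj := measurable_right_part j.
  have Dj : lam (right_part j) = lam D + lam (right_part j `\` D).
    rewrite -lam_add//; [|exact: measurableD|by rewrite setDE setICA setICr setI0].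
    by rewrite setDUK//; apply: right_part_mono; exact: leq_maxl.
  have hj := hk j.
  have mCB := measurableI _ _ (measurableC mD) mnB.
  rewrite (content_inside cl mI mCB lamI).
  apply: (@le_trans _ _ (lam (right_part j `\` D))); last by move: hj; rewrite Dj -/D; lra.
  apply: content_le => //; [exact: measurableI|exact: measurableD|].
  move=> x [xI [nD xB]]; split=> //.
  by apply: right_part_mono (leq_maxr k n.+1) _ _; apply: right_part_escape.
have [l0|lk] := leP (lam D) 0.
  have := outside 0%N; have -> : iter 0 T0 @^-1` B0 = B0 by [].
  have : lam (D `&` B0) <= lam D by apply: content_le => //; exact: measurableI.
  have := lam_ge0 `[u, v[%classic; have := lam_ge0 B0; have := lam_ge0 (D `&` B0) => ? ? ? ? ?.
  have : (v - u) * lam B0 <= lam B0 by rewrite ler_piMl.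
  lra.
have [P PD [K K0 PK]] := conditional_probability lk.
have PI : P (~` I0) = 0%E.
  have h := PD _ (measurableC mI).
  have : fine (P (~` I0)) * lam D = 0.
    rewrite h (_ : right_part k `&` ~` I0 = set0) ?content0//.
    by apply/seteqP; split=> // x [/right_part_sub].
  move=> /eqP; rewrite mulf_eq0 [X in _ || X]gt_eqF// orbF => /eqP f0.
  by rewrite -[LHS]fineK ?f0// fin_num_measure//; exact: measurableC.
have [dl dl0 [r rI rloc]] := locally_constant_approx K0 e3 PK.
have [n hn] : exists n : nat, n.+1%:R^-1 <= dl.
  exists (Num.truncn dl^-1); rewrite -[leRHS]invrK lef_pV2 ?posrE ?invr_gt0//.
  by have /andP[_ /ltW] := @truncn_itv R dl^-1 (ltW (ltac:(by rewrite invr_gt0) : 0 < dl^-1)).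
have := full_branch_compare PI rloc hn u1 uv v0.
have mnB : measurable (iter n T0 @^-1` B0) by exact: measurable_preimT.
have mnE : measurable (iter n T0 @^-1` `[u, v[%classic) by exact: measurable_preimT.
move=> H.
have H2 : (v - u) * fine (P (iter n T0 @^-1` B0)) <= fine (P (iter n T0 @^-1` `[u, v[%classic)) + (e / 3 + e / 3).
  rewrite -lee_fin EFinM !EFinD !fineK ?fin_num_measure//.
  by apply: (le_trans H); apply: leeD => //; exact: leeD.
have H3 : (v - u) * lam (D `&` iter n T0 @^-1` B0) <= lam (D `&` iter n T0 @^-1` `[u, v[%classic) + (e / 3 + e / 3).
  rewrite -!PD// mulrA; apply: (@le_trans _ _ ((fine (P (iter n T0 @^-1` `[u, v[%classic)) + (e / 3 + e / 3)) * lam D)).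
    by apply: ler_wpM2r => //; exact: ltW.
  rewrite mulrDl lerD2l ger_pMr; [exact: content_le1|lra].
have H4 := outside n; rewrite lam_iter// in H4.
have H5 : lam (D `&` iter n T0 @^-1` `[u, v[%classic) <= lam `[u, v[%classic.
  by rewrite -(lam_iter n mE); apply: content_le => //; exact: measurableI.
have H6 : (v - u) * lam B0 <= (v - u) * (lam (D `&` iter n T0 @^-1` B0) + e / 3).
  by rewrite ler_pM2l//; lra.
have H7 : (v - u) * (e / 3) <= e / 3 by rewrite ger_pMl.
lra.
Qed.

Definition left_part j : set X := `[-1, -1 + j.+1%:R^-1[%classic.

Lemma measurable_left_part j : measurable (left_part j).
Proof. exact: measurable_itv. Qed.

(** Left of [-1/2] the map lowers [1 / (1 + x)] by 1, so a point sent into [left_part j] comes from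
    [left_part j.+1]. *)
Lemma left_part_split j : I0 `&` T0 @^-1` left_part j `<=` left_part j.+1 `|` B0.
Proof.
move=> x [/=]; rewrite in_itv/= => /andP[x1 x0].
rewrite /left_part /= !in_itv/= => /andP[_ h2].
have [xB|xB] := leP (- 2^-1) (x : R); first by right; apply/andP.
left; rewrite x1/=; have xl : -1 <= (x : R) < - 2^-1 by rewrite x1.
have := Talpha0_left xl; have j1 : 0 < j.+1%:R :> R by [].
have j2 : 0 < j.+2%:R :> R by [].
have mx : 0 < - (x : R) by lra.
have {}h2 : 1 + T0 x < j.+1%:R^-1 by rewrite -ltrBrDl addrC.
move=> e; move: h2; rewrite e ltr_pdivrMr// mulrC ltr_pdivlMr// => h2.
rewrite -ltrBlDl opprK addrC -[ltRHS]mul1r ltr_pdivlMr// -[j.+2%:R]natr1.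
by move: h2; move: (j.+1%:R : R) => t; lra.
Qed.

(** The preimage of [left_part j] under the branch of digit 3; [left_part j.+1] is the one under the
    branch of digit 2. *)
Definition middle_part j : set X := `[- 2^-1, - (2 + j.+1%:R^-1)^-1[%classic.

Lemma middle_part_sub j : left_part j.+1 `|` middle_part j `<=` T0 @^-1` left_part j.
Proof.
have j1 : 0 < j.+1%:R :> R by [].
have i1 : 0 < j.+1%:R^-1 :> R by rewrite invr_gt0.
have i2 : j.+1%:R^-1 <= 1 :> R by rewrite invf_le1// ler1n.
have m1 : (-1 : R) <= -1 by [].
have m2 : (-1 : R) < -1 + j.+1%:R^-1 by rewrite ltrDl.
have m3 : -1 + j.+1%:R^-1 <= 0 :> R by rewrite addrC subr_le0.
have key c x : inv_branch [:: c] (-1) <= x < inv_branch [:: c] (-1 + j.+1%:R^-1 : R) ->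
    left_part j (T0 x).
  move=> /(inv_branch_itv m1 m2 m3)[z /andP[z1 z2] ->] /=.
  have z0 : z < 0 by apply: lt_le_trans m3.
  by rewrite Talpha0_branch ?z1// /left_part /= in_itv/= z1.
move=> x [|]; rewrite /left_part /middle_part /= in_itv/= => /andP[x1 x2].
  apply: (key 0%N); rewrite /= add0r; apply/andP; split.
    by rewrite (_ : (2 + -1 : R) = 1) ?invr1//; lra.
  apply: (lt_le_trans x2); rewrite -[j.+2%:R]natr1.
  have jn : j.+1%:R != 0 :> R by rewrite gt_eqF.
  have jn' : j.+1%:R + 1 != 0 :> R by rewrite gt_eqF// addr_gt0.
  have -> : 2 + (-1 + j.+1%:R^-1) = (j.+1%:R + 1) / j.+1%:R :> R by field.
  rewrite invf_div le_eqVlt; apply/orP; left; apply/eqP.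
  by move: (j.+1%:R : R) jn jn' => t jn jn'; field.
apply: (key 1%N); rewrite /=; apply/andP; split.
  by rewrite (_ : (1 + 2 + -1 : R) = 2) //; lra.
by rewrite (_ : 1 + 2 + (-1 + j.+1%:R^-1) = 2 + j.+1%:R^-1 :> R) //; ring.
Qed.

Lemma lam_left_part j : lam (left_part j.+1) + j.+1%:R^-1 / 6 * lam B0 <= lam (left_part j).
Proof.
have mV := measurable_left_part; have mE : measurable (middle_part j) by exact: measurable_itv.
have j1 : 0 < j.+1%:R :> R by [].
have j2 : 0 < j.+2%:R :> R by [].
have i1 : 0 < j.+1%:R^-1 :> R by rewrite invr_gt0.
have i2 : j.+1%:R^-1 <= 1 :> R by rewrite invf_le1// ler1n.
have dis : left_part j.+1 `&` middle_part j = set0.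
  apply/seteqP; split=> // x [/=]; rewrite /left_part /middle_part /= !in_itv/= => /andP[_ h1] /andP[h2 _].
  have : j.+2%:R^-1 <= 2^-1 :> R by rewrite lef_pV2 ?posrE// (ler_nat _ 2).
  by move: h1; move: (j.+2%:R^-1 : R) => t h1 h; lra.
have h : lam (left_part j.+1 `|` middle_part j) <= lam (left_part j).
  rewrite -(lam_inv (mV j)); apply: content_le => //; [exact: measurableU|exact: measurable_preimT|].
  exact: middle_part_sub.
rewrite lam_add// in h; apply: le_trans h; rewrite lerD2l.
(* With [t = 1 / (j + 1) <= 1], [middle_part j] has length [t / (2 * (2 + t)) >= t / 6]. *)
apply: (@le_trans _ _ ((- (2 + j.+1%:R^-1)^-1 - - 2^-1) * lam B0)).
  apply: ler_wpM2r => //; move: i1 i2; move: (j.+1%:R^-1 : R) => t t0 t1.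
  have -> : - (2 + t)^-1 - - 2^-1 = t / (2 * (2 + t)) by field; lra.
  by rewrite ler_pM2l// lef_pV2 ?posrE; lra.
have [t2 t3] : (2 + j.+1%:R^-1 : R)^-1 < 2^-1 /\ 0 < (2 + j.+1%:R^-1 : R)^-1.
  move: i1; move: (j.+1%:R^-1 : R) => t t0.
  by split; [rewrite ltf_pV2 ?posrE; lra|rewrite invr_gt0; lra].
by apply: content_interval_ge; [lra|rewrite ltrN2|rewrite oppr_le0 ltW].
Qed.

(* The losses [lam_left_part] sum like the harmonic series. *)
Lemma lam_B0 : lam B0 = 0.
Proof.
apply/eqP; rewrite eq_le lam_ge0 andbT leNgt; apply/negP => B0pos.
have S n : lam (left_part n) + (\sum_(i < n) i.+1%:R^-1) / 6 * lam B0 <= 1.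
  elim: n => [|n IH]; first by rewrite big_ord0 !mul0r addr0; apply: content_le1 => //; exact: measurable_left_part.
  by rewrite big_ord_recr/=; have := lam_left_part n; move: (n.+1%:R^-1 : R) => t; lra.
have [n hn] : exists n : nat, 6 / lam B0 < ln n.+1%:R.
  exists (Num.truncn (expR (6 / lam B0))); rewrite -[ltLHS]expRK ltr_ln ?posrE ?expR_gt0//.
  by have /andP[_] := @truncn_itv R _ (expR_ge0 (6 / lam B0)).
have := S n; have := harmonic_ge R n; have := lam_ge0 (left_part n).
move: hn; rewrite ltr_pdivrMr// => hn l0 hH.
have : ln n.+1%:R * lam B0 <= (\sum_(i < n) i.+1%:R^-1) * lam B0 by rewrite ler_pM2r.
lra.
Qed.

(** Once [B0] is null, invariance and [left_part_split] pass the full mass from each [left_part j]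
    to the next. *)
Lemma content_vanishes (dl : R) : 0 < dl -> lam [set x : X | dl <= 1 + (x : R)] = 0.
Proof.
move=> d0; have mV := measurable_left_part.
have mD : measurable [set x : X | dl <= 1 + (x : R)].
  rewrite (_ : [set x : X | dl <= 1 + (x : R)] = `[dl - 1, +oo[%classic); first exact: measurable_itv.
  by apply/seteqP; split=> x /=; rewrite in_itv/= andbT lerBlDl.
have mB : measurable B0 by exact: measurable_itv.
have V1 j : lam (left_part j) = 1.
  elim: j => [|j IH].
    have -> : left_part 0 = I0 by rewrite /left_part invr1 addNr.
    by have := content_setC cl mI; rewrite lamI => /eqP; rewrite eq_sym subr_eq0 => /eqP.
  apply/eqP; rewrite eq_le content_le1//= -IH -(lam_inv (mV j)).
  have mTV : measurable (T0 @^-1` left_part j) by exact: measurable_preimT.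
  rewrite (content_inside cl mI mTV lamI).
  have mU : measurable (left_part j.+1 `|` B0) by exact: measurableU.
  apply: (le_trans (content_le cl (measurableI _ _ mI mTV) mU (@left_part_split j))).
  have mBV : measurable (~` left_part j.+1 `&` B0) by apply: measurableI => //; exact: measurableC.
  have -> : left_part j.+1 `|` B0 = left_part j.+1 `|` (~` left_part j.+1 `&` B0).
    by rewrite setUIr setUv setTI.
  rewrite lam_add//; last by rewrite setIA setICr set0I.
  rewrite gerDl; apply: (@le_trans _ _ (lam B0)); last by rewrite lam_B0.
  by apply: content_le => // x [].
have [j hj] : exists j : nat, j.+1%:R^-1 <= dl.
  exists (Num.truncn dl^-1); rewrite -[leRHS]invrK lef_pV2 ?posrE ?invr_gt0//.
  by have /andP[_ /ltW] := @truncn_itv R dl^-1 (ltW (ltac:(by rewrite invr_gt0) : 0 < dl^-1)).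
apply/eqP; rewrite eq_le lam_ge0 andbT; have := content_setC cl (mV j); rewrite V1 subrr => <-.
apply: content_le => //; first exact: measurableC.
move=> x /= xd; rewrite /left_part /= in_itv/= => /andP[_ xj].
have : 1 + (x : R) < j.+1%:R^-1 by rewrite -ltrBrDl addrC.
by move=> /(le_lt_trans xd) /lt_le_trans /(_ hj); rewrite ltxx.
Qed.

End Vanishing.

(** * Conclusion *)

Section EntropyLimits.
Context {R : realType}.
Let X := measurableTypeR R.
Local Notation leb := (@lebesgue_measure R).
Variables (mu : R -> probability X R) (C : R).
Hypotheses (C0 : 0 < C) (hmu : forall a, 0 < a <= 1 -> is_unique_acip a (mu a)).
Hypothesis hC : forall (a dl : R) (E : set X), 0 < a <= 1 -> 0 < dl <= 1 -> measurable E ->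
  (forall x, E x -> dl <= 1 + (x : R)) -> (mu a E <= (C / dl)%:E * leb E)%E.

Lemma acip_le_lebesgue a : 0 < a <= 1 -> forall A, measurable A -> (mu a A <= (C / a)%:E * leb A)%E.
Proof.
move=> a01 A mA; have [mua _] := hmu a01.
have mIA : measurable (`[a - 1, a]%classic `&` A : set X).
  by apply: measurableI => //; exact: measurable_itv.
rewrite (acip_inside mua mA); apply: (le_trans (hC a01 a01 mIA _)).
  by move=> x [/=]; rewrite in_itv/= => /andP[? ?] _; lra.
apply: lee_wpmul2l; last by apply: le_measure; rewrite ?inE.
by rewrite lee_fin; apply: divr_ge0; [exact: ltW|case/andP: a01 => /ltW].
Qed.

(** For [i > 0] the ball stays right of [-1/2], where [dl = 1/2] serves every parameter [a]. *)
Lemma acip_nball_le a i : 0 < a <= 1 -> (0 < i)%N ->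
  (mu a (nball i) <= (4 * C * 2^-1 ^+ i)%:E)%E.
Proof.
move=> a01 i0; have h0 : (0 <= 2^-1 :> R) by rewrite invr_ge0.
have mB : measurable (nball i : set X) by exact: measurable_nball.
have i1 : 2^-1 ^+ i <= 2^-1 :> R.
  by rewrite -[leRHS]expr1; apply: ler_wiXn2l; [lra|lra|].
have d01 : 0 < (2^-1 : R) <= 1 by apply/andP; split; lra.
apply: (le_trans (hC a01 d01 mB _)).
  by move=> x; rewrite /nball/= ltr_norml => /andP[? ?]; lra.
have lB := @lebesgue_nball R i.
apply: (le_trans (lee_wpmul2l _ lB)); first by rewrite lee_fin divr_ge0// ltW.
by rewrite -EFinM lee_fin invrK; lra.
Qed.

(** What [I_a] has outside [[-1, 0[] lies in [[0, a]], where [dl = 1] is allowed. *)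
Lemma acip_outside_le a : 0 < a <= 1 -> fine (mu a (~` `[0 - 1, 0[%classic)) <= C * a.
Proof.
move=> a01; have [mua _] := hmu a01; have [a0 a1] := andP a01.
have mI : measurable (~` `[0 - 1, 0[%classic : set X) by apply: measurableC; exact: measurable_itv.
have mJ : measurable (`[a - 1, a]%classic `&` ~` `[0 - 1, 0[%classic : set X).
  by apply: measurableI => //; exact: measurable_itv.
have Jpos x : (`[a - 1, a]%classic `&` ~` `[0 - 1, 0[%classic : set X) x -> 0 <= (x : R) <= a.
  move=> [/=]; rewrite !in_itv/= => /andP[x1 ->] nx; rewrite andbT leNgt; apply/negP => x0.
  by apply: nx; rewrite x0 andbT; lra.
have o01 : 0 < (1 : R) <= 1 by rewrite ltr01 lexx.
rewrite -lee_fin fineK ?fin_num_measure// (acip_inside mua mI).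
apply: (le_trans (hC a01 o01 mJ _)); first by move=> x /Jpos /andP[? _]; lra.
rewrite divr1 EFinM; apply: lee_wpmul2l; first by rewrite lee_fin ltW.
apply: lebesgue_diam => //; first exact: ltW.
by move=> x y /Jpos /andP[? ?] /Jpos /andP[? ?]; rewrite ler_norml; apply/andP; split; lra.
Qed.

Lemma acip_mass_vanishes (dl : R) : 0 < dl ->
  (fun a => fine (mu a [set x : X | dl <= 1 + (x : R)])) @ (0 : R)^'+ --> (0 : R).
Proof.
move=> d0; apply: cvg_ultra => G UG FG.
have PG : ProperFilter G by exact: ultra_proper.
have [lam cl lamP] := ultralimit_content mu UG.
have nearG (e : R) : 0 < e -> G [set a | 0 < a <= 1 /\ C * a <= e].
  move=> e0; apply: FG; near=> a; split.
    by apply/andP; split; [near: a; exact: nbhs_right_gt|near: a; exact: nbhs_right_le].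
  rewrite mulrC -ler_pdivlMr//; near: a; apply: nbhs_right_le; exact: divr_gt0.
have mI : measurable (`[-1, 0[%classic : set X) by exact: measurable_itv.
have lamI : lam (~` `[-1, 0[%classic) = 0.
  apply: (cvg_unique (@Rhausdorff R) (lamP _ (measurableC mI))).
  apply/cvgrPdist_le => e e0; apply: filterS (nearG _ e0) => a [a01 ae].
  rewrite sub0r normrN ger0_norm ?fine_ge0//; apply: le_trans ae.
  by have := acip_outside_le a01; rewrite sub0r.
have lam_inv A : measurable A -> lam (Talpha 0 @^-1` A) = lam A.
  move=> mA; have mTA : measurable (Talpha 0 @^-1` A : set X).
    by apply: measurable_preimT => //; exact: measurable_Talpha.
  have h : (fun a => fine (mu a (Talpha 0 @^-1` A)) - fine (mu a A)) @ G --> lam (Talpha 0 @^-1` A) - lam A.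
    by apply: cvgB; exact: lamP.
  apply/eqP; rewrite -subr_eq0; apply/eqP; apply: (cvg_unique (@Rhausdorff R) h).
  apply/cvgrPdist_le => e e0; apply: filterS (nearG _ e0) => a [a01 ae].
  rewrite sub0r normrN; have [mua _] := hmu a01.
  apply: (le_trans (acip_preimage_diff 0 mua mA)); apply: le_trans ae.
  exact: acip_outside_le.
have lam_le (d : R) (A : set X) : 0 < d <= 1 -> measurable A -> A `<=` `[-1, 0[%classic ->
    (forall x, A x -> d <= 1 + (x : R)) -> lam A <= C / d * fine (leb A).
  move=> d01 mA AI Ad; have lA := cvg_lim (@Rhausdorff R) (lamP _ mA); rewrite -lA.
  apply: limr_le; first by apply/cvg_ex; exists (lam A); exact: lamP.
  apply: filterS (nearG _ ltr01) => a [a01 _].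
  rewrite -lee_fin EFinM !fineK ?fin_num_measure//; first exact: hC.
  rewrite ge0_fin_numE//; apply: (@le_lt_trans _ _ (leb `[-1, 0[%classic)).
    by apply: le_measure; rewrite ?inE.
  by rewrite lebesgue_measure_itv/= lte_fin ltrN10 -EFinB ltry.
have <- := content_vanishes cl C0 lamI lam_inv lam_le d0.
apply: lamP; rewrite (_ : [set x : X | dl <= 1 + (x : R)] = `[dl - 1, +oo[%classic); first exact: measurable_itv.
by apply/seteqP; split=> x /=; rewrite in_itv/= andbT lerBlDl.
Unshelve. all: by end_near. Qed.

Definition mean_neglog a : R := fine (\int[mu a]_x (neglog x)%:E)%E.

Lemma mean_neglogE a : 0 < a <= 1 ->
  (\int[mu a]_x (neglog x)%:E)%E = (mean_neglog a)%:E /\ 0 <= mean_neglog a.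
Proof.
move=> a01; have Ca : 0 < C / a by rewrite divr_gt0//; case/andP: a01.
have [I I0 IE] := neglog_integral_fin Ca (acip_le_lebesgue a01).
by rewrite /mean_neglog IE.
Qed.

Lemma ks_entropyE a : 0 < a <= 1 -> ks_entropy (mu a) (Talpha a) = (2 * mean_neglog a)%:E.
Proof.
move=> a01; have Ca : 0 < C / a by rewrite divr_gt0//; case/andP: a01.
have [mua _] := hmu a01; have [IE _] := mean_neglogE a01.
exact: (ks_entropy_rokhlin Ca (acip_le_lebesgue a01) a01 mua IE).
Qed.

Lemma mean_neglog_vanishes : mean_neglog @ (0 : R)^'+ --> (0 : R).
Proof.
apply/cvgrPdist_le => ep ep0.
have C4 : 0 <= 4 * C by rewrite mulr_ge0// ltW.
have [e [eta [M [e0 eta0 H]]]] := neglog_integral_approx C4 ep0.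
have near_level : \forall a \near (0 : R)^'+, forall i : 'I_M,
    fine (mu a (nlevel (i.+1%:R * e))) <= 0 + eta.
  apply: filter_forall => i; rewrite add0r.
  pose t := i.+1%:R * e; have t0 : 0 < t by rewrite mulr_gt0.
  (* Where [neglog x >= t] one has [|x| <= exp (- t)], so the level set stays at distance at least
     [1 - exp (- t)] from -1. *)
  have d0 : 0 < 1 - expR (- t) by rewrite subr_gt0 -[ltRHS]expR0 ltr_expR oppr_lt0.
  have /cvgrPdist_le/(_ _ eta0) := acip_mass_vanishes d0.
  apply: filterS => a; rewrite sub0r normrN ger0_norm ?fine_ge0//; apply: le_trans.
  have mS : measurable [set x : X | 1 - expR (- t) <= 1 + (x : R)].
    rewrite (_ : [set x : X | _] = `[- expR (- t), +oo[%classic); first exact: measurable_itv.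
    by apply/seteqP; split=> x /=; rewrite in_itv/= andbT lerD2l.
  apply: fine_le; rewrite ?fin_num_measure//; try exact: measurable_nlevel.
  apply: le_measure; rewrite ?inE//; first exact: measurable_nlevel.
  move=> x /= /(neglog_lt t0); rewrite ler_norml => /andP[h _].
  by rewrite lerD2l.
near=> a.
have a01 : 0 < a <= 1.
  by apply/andP; split; [near: a; exact: nbhs_right_gt|near: a; exact: nbhs_right_le].
have [IE I0] := mean_neglogE a01; rewrite sub0r normrN ger0_norm//.
have := H (mu a) (fun i i0 => acip_nball_le a01 i0) (fun=> 0).
rewrite IE lee_fin big1 ?add0r; last by move=> i _; rewrite mulr0.
apply=> i iM; have lev : forall i : 'I_M, fine (mu a (nlevel (i.+1%:R * e))) <= 0 + eta by near: a.
by have := lev (Ordinal iM); rewrite add0r.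
Unshelve. all: by end_near. Qed.

Lemma mean_neglog_cvg (a : R) : 0 < a <= 1 ->
  mean_neglog @ (within [set b | 0 < b <= 1] (nbhs a)) --> mean_neglog a.
Proof.
move=> a01; apply/cvgrPdist_le => ep ep0.
have C4 : 0 <= 4 * C by rewrite mulr_ge0// ltW.
have [e [eta [M [e0 eta0 H]]]] := neglog_integral_approx C4 ep0.
have near_level : \forall b \near within [set b | 0 < b <= 1] (nbhs a), forall i : 'I_M,
    `|fine (mu a (nlevel (i.+1%:R * e))) - fine (mu b (nlevel (i.+1%:R * e)))| <= eta.
  apply: filter_forall => i.
  have mN : measurable (nlevel (i.+1%:R * e) : set X) by exact: measurable_nlevel.
  have hCa b : 0 < b <= 1 -> forall A, measurable A -> (mu b A <= (C / b)%:E * leb A)%E.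
    exact: acip_le_lebesgue.
  by have /cvgrPdist_le/(_ _ eta0) := acip_setwise_cvg hmu C0 hCa a01 mN.
near=> b.
have b01 : 0 < b <= 1 by near: b; rewrite near_withinE; near=> b.
have lev : forall i : 'I_M,
    `|fine (mu a (nlevel (i.+1%:R * e))) - fine (mu b (nlevel (i.+1%:R * e)))| <= eta by near: b.
(* The same level sums bound one integral from above, by the choice of [e], [eta], [M], and the
   other from below, by [neglog_integral_ge]; the roles of [a] and [b] are then exchanged. *)
have one_side c d : 0 < c <= 1 -> 0 < d <= 1 ->
    (forall i : 'I_M, fine (mu c (nlevel (i.+1%:R * e))) <= fine (mu d (nlevel (i.+1%:R * e))) + eta) ->
    mean_neglog c <= mean_neglog d + ep.
  move=> c01 d01 cd; have [IEc _] := mean_neglogE c01; have [IEd _] := mean_neglogE d01.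
  have := H (mu c) (fun i i0 => acip_nball_le c01 i0) (fun i => fine (mu d (nlevel (i.+1%:R * e)))).
  rewrite IEc lee_fin => /(_ (fun i iM => cd (Ordinal iM))) h; apply: (le_trans h); rewrite lerD2r.
  by have := neglog_integral_ge (mu d) M e0; rewrite IEd lee_fin.
have h1 : mean_neglog a <= mean_neglog b + ep.
  by apply: one_side => // i; have := lev i; rewrite ler_norml => /andP[? ?]; lra.
have h2 : mean_neglog b <= mean_neglog a + ep.
  by apply: one_side => // i; have := lev i; rewrite ler_norml => /andP[? ?]; lra.
by rewrite ler_norml; apply/andP; split; lra.
Unshelve. all: by end_near. Qed.

End EntropyLimits.

Theorem theorem1 (R : realType)
  (mu : R -> probability (measurableTypeR R) R)
  (hmu : forall alpha : R, 0 < alpha <= 1 -> is_unique_acip alpha (mu alpha)) :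
  let h : R -> \bar R := fun alpha => ks_entropy (mu alpha) (Talpha alpha) in
  [/\ forall alpha : R, 0 < alpha <= 1 -> h alpha \is a fin_num,
      {within `]0, 1], continuous (fun alpha : R => fine (h alpha))}
    & (fun alpha : R => fine (h alpha)) @ 0^'+ --> (0 : R)].
Proof.
have [C [C0 hC]] : exists C : R, 0 < C /\ forall (a dl : R) (E : set (measurableTypeR R)),
    0 < a <= 1 -> 0 < dl <= 1 -> measurable E -> (forall x, E x -> dl <= 1 + (x : R)) ->
    (mu a E <= (C / dl)%:E * @lebesgue_measure R E)%E.
  exists 720; split; first by rewrite ltr0n.
  by move=> a dl E a01 d01 mE Ed; exact: (acip_density_bound a01 (hmu a a01) d01 mE Ed).
have hE := ks_entropyE C0 hmu hC.
have cont (a : R) : 0 < a <= 1 ->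
    fine (ks_entropy (mu b) (Talpha b)) @[b --> within [set b : R | 0 < b <= 1] (nbhs a)] -->
    (fine (ks_entropy (mu a) (Talpha a)) : R).
  move=> a01; rewrite hE//=.
  have h : 2 * mean_neglog mu b @[b --> within [set b : R | 0 < b <= 1] (nbhs a)] --> 2 * mean_neglog mu a.
    apply: cvgMr.
    exact: (mean_neglog_cvg C0 hmu hC a01).
  apply: cvg_trans h; apply: near_eq_cvg.
  by rewrite near_withinE; near=> b => b01; rewrite hE.
split.
- by move=> a a01; rewrite hE.
- apply/subspace_continuousP => a /=; rewrite in_itv/= => a01.
  have -> : (`]0, 1]%classic : set R) = [set b : R | 0 < b <= 1].
    by apply/seteqP; split=> b /=; rewrite in_itv.
  exact: cont.
have h : 2 * mean_neglog mu b @[b --> (0 : R)^'+] --> 2 * (0 : R).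
  by apply: cvgMr; exact: (mean_neglog_vanishes C0 hmu hC).
rewrite mulr0 in h.
apply: cvg_trans h; apply: near_eq_cvg.
near=> b; rewrite hE//; apply/andP; split; near: b; [exact: nbhs_right_gt|exact: nbhs_right_le].
Unshelve. all: by end_near. Qed.
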